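(* Let $\Gamma$ be an infinite, finitely generated, amenable group admitting a finite-index left-orderable subgroup $H$, with $m=[\Gamma:H]$, and let $G=(V,E)=\operatorname{Cay}(\Gamma,S)$ be a Cayley graph of $\Gamma$. Consider Bernoulli bond percolation on $G$ with parameter $p\in(0,1)$ and an exhaustive Følner sequence $(A_r)_{r\ge1}$. Fix a local graph simplicial complex rule $\Delta$ over $G$ and an integer $n\ge0$, and let $\beta_n^r$ denote the $n$-th Betti number of the simplicial complex $\Delta(G(\omega;A_r))$. If $\beta_n^r>0$ a.s. for some $r$, then there exist a finite $H$-fundamental set of edges $\tilde E\subset E$ and an $H$-invariant total order $\preccurlyeq$ on $E$ such that: 1. $\displaystyle\lim_{r\to\infty}\frac{1}{|A_r|}\operatorname{Var}_p(\beta_n^r)=\sigma^2$; 2. $\displaystyle|A_r|^{-1/2}\bigl(\beta_n^r-\mathbb{E}_p[\beta_n^r]\bigr)\Longrightarrow\mathcal{N}(0,\sigma^2)$ in distribution as $r\to\infty$. Moreover, the asymptotic variance is given by $$\sigma^2=\frac{1}{2m}\sum_{e\in\tilde E}\mathbb{E}_p\Bigl[\mathbb{E}_p\bigl[D_e^\infty\,\big|\,\mathcal{F}_e\bigr]^2\Bigr],$$ where $D_e^\infty$ is the limit in probability, as $r\to\infty$, of the difference $\beta_n^r(\omega)-\beta_n^r(\omega^e)$ caused by perturbing the state of $e$, and $\mathcal{F}_e$ is the $\sigma$-algebra generated by the states $\omega(e')$ of the edges $e'\preccurlyeq e$.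
   Context: Cayley graph: $S$ is a finite symmetric generating set of $\Gamma$ ($S=S^{-1}$, $1\notin S$); $\operatorname{Cay}(\Gamma,S)$ has vertex set $V=\Gamma$ and edge set $E=\{\{g,gs\}: g\in\Gamma,s\in S\}$; $d_G$ is the graph distance. A group is left-orderable if it admits a strict total order $<$ with $g<h\Rightarrow kg<kh$ for all $g,h,k$. For $W\subset V$, $\partial W=\{u\in W:\exists v\in V\setminus W,\ \{u,v\}\in E\}$. A Følner sequence is a sequence of finite nonempty sets $A_r\subset V$ with $|\partial A_r|/|A_r|\to0$; it is exhaustive if $A_r\subseteq A_{r+1}$ for all $r$ and $\bigcup_rA_r=V$. $\Gamma$ is amenable if and only if $G$ admits a Følner sequence. $H$ acts on $E$ by left translation $h\cdot\{x,y\}=\{hx,hy\}$. $\tilde E\subseteq E$ is an $H$-fundamental set of edges if for every $e\in E$ there is $h\in H$ (not necessarily unique) with $h\cdot e\in\tilde E$. A total order $\preccurlyeq$ on $E$ is $H$-invariant if $e\preccurlyeq f\Rightarrow h\cdot e\preccurlyeq h\cdot f$ for all $h\in H$. Percolation: $\Omega=\{0,1\}^E$ with the product measure $\mathbb{P}_p$ under which the $\omega(e)$ are i.i.d. with $\mathbb{P}_p(\omega(e)=1)=p$; $\mathbb{E}_p,\operatorname{Var}_p$ are expectation and variance. For $A\subseteq V$, $G(\omega;A)$ is the graph with vertex set $A$ and edge set $\{\{x,y\}\in E:x,y\in A,\ \omega(\{x,y\})=1\}$. For $e\in E$, $\omega^e$ is obtained from $\omega$ by replacing the state of $e$ with an independent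 copy (on a suitably enlarged probability space, $\omega^e(e)$ has the law of $\omega(e)$ and is independent of $\omega$, and $\omega^e(e')=\omega(e')$ for $e'\neq e$). A simplicial complex on a vertex set $W$ is a collection of subsets of $W$ (simplices) closed under taking subsets; a simplex $\sigma$ has dimension $|\sigma|-1$. A graph simplicial complex on $G$ is a map $\Delta$ assigning to each subgraph $K=(W,F)\subseteq G$ a simplicial complex $\Delta(K)\subseteq\mathcal{P}(W)$ that is equivariant: $\Delta(\varphi(K))=\varphi(\Delta(K))$ for every $\varphi\in\operatorname{Aut}(G)$ and every subgraph $K$. It is a local graph simplicial complex rule if in addition: - Monotonicity: $K\subseteq L$ subgraphs of $G$ implies $\Delta(K)\subseteq\Delta(L)$. - Connectivity: for every subgraph $K\subseteq G$ and $\sigma\in\Delta(K)$, all vertices of $\sigma$ lie in a single connected component of $K$. - Confinement: there is $T\ge0$ such that for every subgraph $K\subseteq G$ and $\sigma\in\Delta(K)$ there is a nonempty subgraph $K_\sigma\subseteq K$ with $\sup_{u,v\in V(K_\sigma)}d_G(u,v)\le T$ and $\sigma\in\Delta(K_\sigma)$. Betti numbers are dimensions of (unreduced) simplicial homology groups with real coefficients: $\beta_n=\dim(\ker\partial_n/\operatorname{im}\partial_{n+1})$, where $\partial_n$ is the usual boundary operator on the real span of oriented $n$-simplices. *)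

(* Defs.v *)
From HB Require Import structures.
From mathcomp Require Import all_boot all_order all_algebra all_fingroup finmap.
From mathcomp Require Import all_classical all_reals all_analysis.
From mathcomp Require Import zify.

Set Implicit Arguments.
Unset Strict Implicit.
Unset Printing Implicit Defensive.

Import Order.TTheory GRing.Theory Num.Theory.
Import numFieldNormedType.Exports.

Local Open Scope classical_set_scope.
Local Open Scope ring_scope.

Section Groups.
Variable Gamma : groupType.
Implicit Types (S : {fset Gamma}) (H : set Gamma) (m : nat).

Definition symmetric_generating S : Prop :=
  [/\ forall s, s \in S -> (s^-1)%g \in S,
      (1%g : Gamma) \notin S &
      forall g : Gamma, exists2 l : seq Gamma,
        {subset l <= S} & g = (\prod_(s <- l) s)%g].

Definition subgroup H : Prop := group_closed (mem H).

Definition left_cosets H : set (set Gamma) :=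
  [set [set (g * h)%g | h in H] | g in [set: Gamma]].

Definition has_index H m : Prop := (left_cosets H #= `I_m)%card.

Definition left_orderable H : Prop :=
  exists lt : Gamma -> Gamma -> Prop,
    [/\ forall g, H g -> ~ lt g g,
        forall g h k, H g -> H h -> H k -> lt g h -> lt h k -> lt g k,
        forall g h, H g -> H h -> [\/ lt g h, g = h | lt h g] &
        forall g h k, H g -> H h -> H k ->
          lt g h -> lt (k * g)%g (k * h)%g].

End Groups.

Record graph (V : Type) := Graph { vset : set V ; eset : set (set V) }.

Section CayleyGraph.
Variables (Gamma : groupType) (S : {fset Gamma}).
Implicit Types (K L : graph Gamma) (W : set Gamma).

Definition edges : set (set Gamma) :=
  [set e | exists g s : Gamma, s \in S /\ e = [set g; (g * s)%g]].

Definition edge : choiceType := set_type edges.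

Definition cayley : graph Gamma := Graph setT edges.

Definition is_subgraph K : Prop :=
  eset K `<=` edges /\ (forall e, eset K e -> e `<=` vset K).

Definition subgraph_le K L : Prop :=
  vset K `<=` vset L /\ eset K `<=` eset L.

Definition adj K : rel Gamma := fun x y => `[< eset K [set x; y] >].

Definition walk K (x y : Gamma) (l : nat) : Prop :=
  exists s : seq Gamma, [/\ path (adj K) x s, last x s = y & size s = l].

Definition gdist (x y : Gamma) : nat :=
  xget 0%N [set l | walk cayley x y l /\
                    forall k, walk cayley x y k -> (l <= k)%N].

Definition graph_aut (phi : Gamma -> Gamma) : Prop :=
  bijective phi /\
  forall x y, edges [set phi x; phi y] <-> edges [set x; y].

Definition map_graph (phi : Gamma -> Gamma) K : graph Gamma :=
  Graph (phi @` vset K) [set phi @` e | e in eset K].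

Definition boundary (W : {fset Gamma}) : {fset Gamma} :=
  [fset u in W | `[< exists v, v \notin W /\ edges [set u; v] >]]%fset.

Lemma translate_edge (h : Gamma) (e : edge) :
  [set (h * x)%g | x in val e] \in edges.
Proof.
have /set_mem[g [s [sS ->]]] := valP e.
by apply/mem_set; exists (h * g)%g, s; rewrite image_setU !image_set1 mulgA.
Qed.

Definition eact (h : Gamma) (e : edge) : edge :=
  exist (fun f => f \in edges) _ (translate_edge h e).

Definition fundamental_edges (H : set Gamma) (Et : {fset edge}) : Prop :=
  forall e : edge, exists2 h, H h & eact h e \in Et.

Definition total_order (le : rel edge) : Prop :=
  [/\ reflexive le, antisymmetric le, transitive le & total le].

Definition invariant_order (H : set Gamma) (le : rel edge) : Prop :=
  forall h e f, H h -> le e f -> le (eact h e) (eact h f).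

Definition open_subgraph (w : edge -> bool) W : graph Gamma :=
  Graph W [set e | e `<=` W /\ exists2 f : edge, val f = e & w f].

Definition resample (w : edge -> bool) (e : edge) (b : bool) : edge -> bool :=
  fun f => if f == e then b else w f.

End CayleyGraph.

Section Folner.
Variables (R : realType) (Gamma : groupType) (S : {fset Gamma}).

Definition folner (A : nat -> {fset Gamma}) : Prop :=
  (forall r, A r != fset0) /\
  (fun r => (#|` boundary S (A r)|%:R / #|` A r|%:R : R)) @ \oo --> (0 : R).

Definition exhaustive (A : nat -> {fset Gamma}) : Prop :=
  (forall r, (A r `<=` A r.+1)%fset) /\ (forall g, exists r, g \in A r).

Definition amenable : Prop := exists A, folner A.

End Folner.

Section GraphComplexes.
Variables (Gamma : groupType) (S : {fset Gamma}).

Definition simplicial_complex (W : set Gamma) (X : set (set Gamma)) : Prop :=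
  (forall s, X s -> s `<=` W) /\ (forall s t, X s -> t `<=` s -> X t).

(* The values of Delta outside the subgraphs of the Cayley graph are never
   constrained and never used. *)
Definition graph_complex (Delta : graph Gamma -> set (set Gamma)) : Prop :=
  (forall K, is_subgraph S K -> simplicial_complex (vset K) (Delta K)) /\
  (forall phi K, graph_aut S phi -> is_subgraph S K ->
     Delta (map_graph phi K) = [set phi @` s | s in Delta K]).

Definition monotone_complex (Delta : graph Gamma -> set (set Gamma)) : Prop :=
  forall K L, is_subgraph S K -> is_subgraph S L -> subgraph_le K L ->
    Delta K `<=` Delta L.

Definition connected_complex (Delta : graph Gamma -> set (set Gamma)) : Prop :=
  forall K s, is_subgraph S K -> Delta K s ->
    forall u v, s u -> s v -> exists l, walk K u v l.

Definition confined_complex (Delta : graph Gamma -> set (set Gamma)) : Prop :=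
  exists T : nat, forall K s, is_subgraph S K -> Delta K s ->
    exists L, [/\ is_subgraph S L, subgraph_le L K, vset L !=set0,
      forall u v, vset L u -> vset L v -> (gdist S u v <= T)%N &
      Delta L s].

Definition local_rule (Delta : graph Gamma -> set (set Gamma)) : Prop :=
  [/\ graph_complex Delta, monotone_complex Delta, connected_complex Delta &
      confined_complex Delta].

End GraphComplexes.

(* The oriented simplex [t 0, ..., t n] is represented by the normalised
   antisymmetrisation of the ordered tuple t, so that permuting t multiplies it
   by the signature ([orient_perm]); with this normalisation the alternating
   face sum on ordered tuples restricts to the boundary operator of the
   oriented chain complex ([boundary_orient]). *)
Section Homology.
Variables (R : realType) (V : choiceType) (W : {fset V}).

Definition tuples n := {ffun 'I_n.+1 -> W}.
Definition chain n := {ffun tuples n -> R^o}.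

Definition face n (i : 'I_n.+2) (t : tuples n.+1) : tuples n :=
  [ffun j => t (lift i j)].

Definition tperm_by n (t : tuples n) (s : 'S_n.+1) : tuples n :=
  [ffun j => t (s j)].

Definition delta n (t : tuples n) : chain n := [ffun u => (u == t)%:R].

Definition orient n (t : tuples n) : chain n :=
  (n.+1)`!%:R^-1 *: \sum_(s : 'S_n.+1) (-1) ^+ s *: delta (tperm_by t s).

Definition bd_fun n (c : chain n.+1) : chain n :=
  \sum_(t : tuples n.+1) c t *: \sum_(i < n.+2) (-1) ^+ i *: delta (face i t).

Lemma bd_fun_linear n : linear (@bd_fun n).
Proof.
move=> a c d; rewrite /bd_fun scaler_sumr -big_split /=.
by apply: eq_bigr => t _; rewrite !ffunE scalerDl scalerA.
Qed.

HB.instance Definition _ n :=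
  GRing.isLinear.Build R (chain n.+1) (chain n) *:%R (@bd_fun n)
    (@bd_fun_linear n).

Definition bd n : 'Hom(chain n.+1, chain n) := linfun (@bd_fun n).

Lemma orient_perm n (t : tuples n) (s : 'S_n.+1) :
  orient (tperm_by t s) = (-1) ^+ s *: orient t.
Proof.
rewrite /orient scalerA mulrC -scalerA; congr (_ *: _).
rewrite scaler_sumr (reindex_inj (mulIg s^-1%g)) /=.
apply: eq_bigr => u _; rewrite scalerA odd_permM odd_permV signr_addb mulrC.
congr (_ *: delta _); apply/ffunP => j; rewrite !ffunE permM.
by rewrite permKV.
Qed.

Lemma bd_delta n (t : tuples n.+1) :
  bd n (delta t) = \sum_(i < n.+2) (-1) ^+ i *: delta (face i t).
Proof.
rewrite lfunE /= /bd_fun (bigD1 t) //= ffunE eqxx scale1r [X in _ + X]big1 ?addr0 //.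
by move=> u ut; rewrite ffunE (negPf ut) scale0r.
Qed.

Lemma sum_perm_lift n (M : lmodType R) (i : 'I_n.+1) (F : 'S_n.+1 -> M) :
  \sum_(s : 'S_n.+1) F s =
  \sum_(k < n.+1) \sum_(s : 'S_n) F (lift_perm i k s).
Proof.
rewrite (partition_big (fun s : 'S_n.+1 => s i) xpredT) //=.
apply: eq_bigr => k _; rewrite (reindex (lift_perm i k)) /=; last first.
  pose ulsf i (s : 'S_n.+1) k := odflt k (unlift (s i) (s (lift i k))).
  have ulsfK j (s : 'S_n.+1) l : lift (s j) (ulsf j s l) = s (lift j l).
    rewrite /ulsf; have := neq_lift j l.
    by rewrite -(can_eq (permK s)) => /unlift_some[] ? ? ->.
  have inj_ulsf : injective (ulsf i _).
    move=> s; apply: can_inj (ulsf (s i) s^-1%g) _ => l.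
    by rewrite {1}/ulsf ulsfK !permK liftK.
  exists (fun s => perm (inj_ulsf s)) => [s _ | s].
    by apply/permP => l; rewrite permE /ulsf lift_perm_lift lift_perm_id liftK.
  move/(s _ =P _) => si; apply/permP => l.
  case: (unliftP i l) => [l'|] ->; rewrite ?lift_perm_id //.
  by rewrite lift_perm_lift -si permE ulsfK.
by apply: eq_bigl => s; rewrite lift_perm_id eqxx.
Qed.

Lemma face_perm_by n (t : tuples n.+1) (i k : 'I_n.+2) (s : 'S_n.+1) :
  face i (tperm_by t (lift_perm i k s)) = tperm_by (face k t) s.
Proof. by apply/ffunP => j; rewrite !ffunE lift_perm_lift. Qed.

Lemma boundary_orient n (t : tuples n.+1) :
  bd n (orient t) = \sum_(i < n.+2) (-1) ^+ i *: orient (face i t).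
Proof.
rewrite /orient linearZ linear_sum /=.
under eq_bigr => s _ do rewrite linearZ /= bd_delta scaler_sumr.
rewrite exchange_big /=.
under eq_bigr => i _ do rewrite (sum_perm_lift i).
under [in RHS]eq_bigr => k _ do rewrite scalerA mulrC -scalerA scaler_sumr.
rewrite -scaler_sumr.
have -> : \sum_(i < n.+2) \sum_(k < n.+2) \sum_(s : 'S_n.+1)
      (-1) ^+ lift_perm i k s *:
        ((-1) ^+ i *: delta (face i (tperm_by t (lift_perm i k s)))) =
    n.+2%:R *: \sum_(k < n.+2) \sum_(s : 'S_n.+1)
      (-1) ^+ k *: ((-1) ^+ s *: delta (tperm_by (face k t) s)).
  set B := (X in _ = n.+2%:R *: X).
  transitivity (\sum_(i < n.+2) B); last by rewrite sumr_const card_ord scaler_nat.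
  apply: eq_bigr => i _; apply: eq_bigr => k _; apply: eq_bigr => s _.
  rewrite !scalerA face_perm_by odd_lift_perm; congr (_ *: _).
  by rewrite !signr_addb !signr_odd mulrC !mulrA -expr2 sqrr_sign mul1r.
rewrite scalerA; congr (_ *: _).
by rewrite factS natrM invfM mulrAC mulVf ?mul1r // pnatr_eq0.
Qed.

Lemma bd_bd n (c : chain n.+2) : bd n (bd n.+1 c) = 0.
Proof.
have -> : c = \sum_t c t *: delta t.
  apply/ffunP => u; rewrite sum_ffunE (bigD1 u) //= !ffunE eqxx big1 ?addr0.
    by rewrite /GRing.scale /= mulr1.
  by move=> t tu; rewrite !ffunE eq_sym (negPf tu) scaler0.
rewrite !linear_sum big1 // => t _; rewrite !linearZ /= bd_delta linear_sum.
under eq_bigr => i _ do rewrite linearZ /= bd_delta scaler_sumr.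
rewrite pair_bigA /=; set E := \sum_ _ _.
have EN : E = - E -> E = 0.
  move/eqP; rewrite -addr_eq0 -mulr2n -scaler_nat scaler_eq0 pnatr_eq0 /=.
  by move/eqP.
suff /EN -> : E = - E by rewrite scaler0.
pose sw (p : 'I_n.+3 * 'I_n.+2) : 'I_n.+3 * 'I_n.+2 :=
  (lift p.1 p.2, odflt p.2 (unlift (lift p.1 p.2) p.1)).
have swE p : lift (sw p).1 (sw p).2 = p.1.
  rewrite /sw /=; have := neq_lift p.1 p.2.
  by rewrite eq_sym => /unlift_some[q pq ->] /=; rewrite -pq.
have swK : involutive sw.
  move=> p; have sp : (sw (sw p)).1 = p.1 by rewrite -[RHS]swE.
  have sp2 : (sw (sw p)).2 = p.2.
    by apply: (@lift_inj _ p.1); have := swE (sw p); rewrite sp => ->.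
  by rewrite [LHS]surjective_pairing sp sp2 -surjective_pairing.
rewrite {1}/E (reindex_inj (inv_inj swK)) -sumrN; apply: eq_bigr => p _.
rewrite -scaleNr !scalerA; congr (_ *: delta _).
  have := congr1 val (swE p); rewrite /sw /= /bump; case: p => i j /=.
  move: (odflt j _) => q qE; rewrite -!exprD mulNr -exprD -[RHS]mulN1r -exprS.
  have sgE a b : odd a = odd b -> (-1) ^+ a = (-1) ^+ b :> R.
    by move=> ab; rewrite -signr_odd ab signr_odd.
  by apply: sgE; lia.
apply/ffunP => k; rewrite !ffunE; congr (t _); apply: val_inj => /=.
have := congr1 val (swE p); rewrite /sw /= /bump; case: p => i j /=.
by move: (odflt j _) => q; lia.
Qed.

Variable X : set (set V).

Definition chains n : {vspace chain n} :=
  <<[seq orient t | t : tuples n <- enum (tuples n) &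
       injectiveb t && `[< X (range (fun i => val (t i))) >]]>>%VS.

Definition cycles n : {vspace chain n} :=
  match n with
  | 0 => chains 0
  | k.+1 => (chains k.+1 :&: lker (bd k))%VS
  end.

Definition boundaries n : {vspace chain n} := (bd n @: chains n.+1)%VS.

Lemma boundaries_sub_cycles n :
  (forall s t : set V, X s -> t `<=` s -> X t) ->
  (boundaries n <= cycles n)%VS.
Proof.
move=> Xsub; have BC : (boundaries n <= chains n)%VS.
  rewrite /boundaries limg_span; apply/span_subvP => _ /mapP[_ /mapP[t + ->] ->].
  rewrite mem_filter => /andP[/andP[/injectiveP tinj /asboolP tX] _].
  rewrite boundary_orient memv_suml // => i _; apply/memvZ/memv_span/map_f.
  rewrite mem_filter mem_enum andbT; apply/andP; split.
    by apply/injectiveP => j k; rewrite !ffunE => /tinj /lift_inj.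
  by apply/asboolP/(Xsub _ _ tX) => _ [j _ <-]; rewrite ffunE; exists (lift i j).
case: n BC => [//|n] BC; rewrite subv_cap BC /=.
apply/subvP => _ /memv_imgP[c _ ->].
by rewrite memv_ker bd_bd.
Qed.

Definition betti n : nat := (\dim (cycles n) - \dim (boundaries n))%N.

End Homology.

Section Probability.
Context {d : measure_display} {T : measurableType d} {R : realType}.
Variable P : probability T R.
Implicit Types (X Y : T -> R).

Section Families.
Variable I : choiceType.

Definition sigma_gen (w : I -> T -> bool) (J : set I) : set (set T) :=
  <<s \bigcup_(i in J) preimage_set_system setT (w i) measurable >>.

Definition mutually_independent (w : I -> T -> bool) : Prop :=
  forall (J : {fset I}) (B : I -> set bool),
    P (\bigcap_(i in [set` J]) w i @^-1` B i) =
    (\prod_(i <- J) P (w i @^-1` B i))%E.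

Definition iid_bernoulli (p : R) (w : I -> T -> bool) : Prop :=
  [/\ forall i, measurable_fun setT (w i),
      forall i, P (w i @^-1` [set true]) = p%:E &
      mutually_independent w].

(* eta e is the fresh state of e: a Bernoulli(p) variable independent of the
   whole configuration w; different eta e need not be independent. *)
Definition fresh_bernoulli (p : R) (w eta : I -> T -> bool) : Prop :=
  forall i, [/\ measurable_fun setT (eta i),
      P (eta i @^-1` [set true]) = p%:E &
      forall (B : set bool) (A : set T), sigma_gen w setT A ->
        P (eta i @^-1` B `&` A) = (P (eta i @^-1` B) * P A)%E].

End Families.

Definition cvg_in_probability (X : nat -> T -> R) Y : Prop :=
  forall eps : R, 0 < eps ->
    (fun r => P [set t | eps <= `|X r t - Y t|]) @ \oo --> 0%E.

Definition is_cond_expectation (F : set (set T)) X Y : Prop :=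
  [/\ P.-integrable setT (EFin \o X), P.-integrable setT (EFin \o Y),
      forall B : set R, measurable B -> F (Y @^-1` B) &
      forall A, F A ->
        (\int[P]_(t in A) (Y t)%:E = \int[P]_(t in A) (X t)%:E)%E].

Definition cvg_in_distribution (X : nat -> T -> R)
    (mu : probability (measurableTypeR R) R) : Prop :=
  forall f : R -> R, continuous f -> (exists M : R, forall x, `|f x| <= M) ->
    (fun r => 'E_P[f \o X r])%E @ \oo --> (\int[mu]_x (f x)%:E)%E.

End Probability.

(* normal_prob is not the Dirac mass when its standard deviation is 0, so the
   degenerate Gaussian law is treated apart; v is the variance. *)
Definition gaussian (R : realType) (mean v : R) :
    probability (measurableTypeR R) R :=
  if v == 0 then (\d_(mean : measurableTypeR R) : probability _ R)
  else (normal_prob mean (Num.sqrt v) : probability _ R).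

(* Main.v *)
Require Import Defs.
From HB Require Import structures.
From mathcomp Require Import all_boot all_order all_algebra all_fingroup finmap.
From mathcomp Require Import all_classical all_reals all_analysis.
From mathcomp Require Import measurable_realfun complex.
From mathcomp Require Import ring lra zify.

Set Implicit Arguments.
Unset Strict Implicit.
Unset Printing Implicit Defensive.

Import Order.TTheory GRing.Theory Num.Theory.
Import numFieldNormedType.Exports.

Local Open Scope classical_set_scope.
Local Open Scope ring_scope.

(** The centred Betti number of the window A_r is a sum of martingale increments
along the H-invariant order, one for each edge e of the window: the increment is
(omega(e) - p) times the mean, over the edges after e, of the response of the
Betti number to opening e ([martingale_decomposition]).  So a law of large
numbers for the squared increments gives the variance and the central limit
theorem.

The Betti number is dim Z_n + dim Z_(n+1) - dim C_(n+1) by rank-nullity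
([betti_dim]).  Unlike the Betti number itself, each of these dimensions
responds monotonically: opening e increases the dimension by an amount bounded
by the number of tuples near e, and this amount is nondecreasing in the window,
since a simplex created by e in a small window remains new in a large one by
confinement ([dim_gap_widen], [stabilizing_dimC], [stabilizing_dimZ]).  Hence
all responses converge pointwise and boundedly, and the limits
D_e^infinity and E(D_e^infinity | F_e) are obtained by bounded convergence
([limit_incr_cond_expectation]).  Monotonicity also makes the L1 distance of
two responses a difference of means ([resp_close]), and means are invariant
under translation by H.

A left-ordered group is torsion free, so H acts freely on the edges
([eact_free]); an edge is a position in H and an orbit, and ordering by the
position first gives the invariant order ([orbit_structure]).  Along a Folner
sequence a proportion 1/m of the translates of a fixed window D lie in A_r
([pattern_density]).  Replacing the increment of e by the one computed in the
translate of D at e costs little, and the squares of the latter are pairwise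
independent up to boundedly many exceptions for each edge.  Therefore their
mean over A_r converges in L1 to 1/m times the sum over the orbits of the
limiting second moments ([mean_sqr_incr_cvg]).

From there, McLeish's comparison of exp(ix) with (1 + ix) exp(-x^2/2) gives the
convergence of the cosine transforms ([mcleish_bound], [law_cos_cvg]).  These
determine convergence in law: a continuous function is, on a segment, a uniform
limit of polynomials in a sine ([sin_poly_approx]), and tightness takes care of
the complement ([weak_convergence_of_cos]).  The Gaussian transform solves
F' = - v t F ([gaussian_cos]).

Expectations of functions of finitely many edges are computed by averaging one
coordinate after the other; [expectation_cylinder] identifies these averages
with integrals over the probability space. *)

(** * Averaging over independent Bernoulli coordinates *)

Section Averages.
Variables (R : realType) (E : choiceType) (p : R).
Implicit Types (w : E -> bool) (e : E) (s : seq E) (f g : (E -> bool) -> R).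

Definition upd w e (b : bool) : E -> bool := fun e' => if e' == e then b else w e'.

(** The conditional expectation of f given all coordinates but e. Keeping it as an
operator on functions of configurations makes conditional expectations of
functions of finitely many coordinates purely algebraic. *)
Definition avg e f : (E -> bool) -> R :=
  fun w => p * f (upd w e true) + (1 - p) * f (upd w e false).

Definition avgs s f : (E -> bool) -> R := foldr avg f s.

Definition gap e f : (E -> bool) -> R :=
  fun w => f (upd w e true) - f (upd w e false).

Definition coord e : (E -> bool) -> R := fun w => (w e)%:R.

Definition ignores e f := forall w b, f (upd w e b) = f w.

Definition depends (J : set E) f :=
  forall w w', (forall e, J e -> w e = w' e) -> f w = f w'.

(** The configuration at which the average is taken is irrelevant when f depends on
s only, by avgs_const below. *)
Definition mean s f : R := avgs s f (fun=> false).

Lemma upd_same w e b c : upd (upd w e b) e c = upd w e c.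
Proof. by apply/funext => f; rewrite /upd; case: (f == e). Qed.

Lemma upd_swap w e e' b c : e != e' ->
  upd (upd w e b) e' c = upd (upd w e' c) e b.
Proof.
move=> ne; apply/funext => f; rewrite /upd.
case: (eqVneq f e') => [fe'|//]; case: (eqVneq f e) => // fe.
by rewrite -fe -fe' eqxx in ne.
Qed.

Lemma upd_id w e : upd w e (w e) = w.
Proof. by apply/funext => f; rewrite /upd; case: eqP => [->|]. Qed.

Lemma depends_ignores J f e : depends J f -> ~ J e -> ignores e f.
Proof.
move=> Jf Je w b; apply: Jf => e' Je'; rewrite /upd.
by case: eqP => // ee'; rewrite ee' in Je'.
Qed.

Lemma depends_sub J J' f : J `<=` J' -> depends J f -> depends J' f.
Proof. by move=> JJ' fJ w w' ww'; apply: fJ => e /JJ'; exact: ww'. Qed.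

Lemma avg_ignores e f : ignores e f -> avg e f = f.
Proof. by move=> fe; apply/funext => w; rewrite /avg !fe; ring. Qed.

Lemma ignores_avg e e' f : ignores e f -> ignores e (avg e' f).
Proof.
move=> fe w b; rewrite /avg; have [->|ne] := eqVneq e e'.
  by rewrite !upd_same.
by rewrite !(upd_swap _ _ _ ne) !fe.
Qed.

Lemma ignores_avg_same e f : ignores e (avg e f).
Proof. by move=> w b; rewrite /avg !upd_same. Qed.

Lemma ignores_avgs e s f : ignores e f -> ignores e (avgs s f).
Proof. by move=> fe; elim: s => //= e' s; exact: ignores_avg. Qed.

Lemma ignores_avgs_mem e s f : e \in s -> ignores e (avgs s f).
Proof.
elim: s => //= e' s IH; rewrite inE => /orP[/eqP ->|/IH].
  exact: ignores_avg_same.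
exact: ignores_avg.
Qed.

Lemma ignores_gap_same e f : ignores e (gap e f).
Proof. by move=> w b; rewrite /gap !upd_same. Qed.

Lemma ignores_coord e e' : e != e' -> ignores e (coord e').
Proof. by move=> ee' w b; rewrite /coord /upd eq_sym (negPf ee'). Qed.

Lemma avgC e e' f : avg e (avg e' f) = avg e' (avg e f).
Proof.
have [->//|ne] := eqVneq e e'; apply/funext => w.
rewrite /avg !(upd_swap _ _ _ ne); ring.
Qed.

Lemma avg_avgs e s f : avg e (avgs s f) = avgs s (avg e f).
Proof. by elim: s => //= e' s IH; rewrite avgC IH. Qed.

Lemma avgs_cat s s' f : avgs (s ++ s') f = avgs s (avgs s' f).
Proof. by rewrite /avgs foldr_cat. Qed.

Lemma avgs_rcons s e f : avgs (rcons s e) f = avgs s (avg e f).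
Proof. by rewrite -cats1 avgs_cat. Qed.

Lemma avgsC s s' f : avgs s (avgs s' f) = avgs s' (avgs s f).
Proof. by elim: s => //= e s ->; rewrite avg_avgs. Qed.

Lemma avgs_perm s s' f : perm_eq s s' -> avgs s f = avgs s' f.
Proof.
elim: s s' => [|e s IH] s' /=; first by rewrite perm_sym => /perm_nilP ->.
move=> ss'; have es' : e \in s' by rewrite -(perm_mem ss') mem_head.
have := perm_to_rem es' => /(perm_trans ss'); rewrite perm_cons => /IH ->.
elim: s' {ss' IH s} es' => //= e' s' IH; rewrite inE.
case: eqVneq => [<-|ne] //=.
by move=> /IH <-; rewrite avgC.
Qed.

Lemma avgs_ignores s f : (forall e, e \in s -> ignores e f) -> avgs s f = f.
Proof.
elim: s => //= e s IH se; rewrite IH ?avg_ignores //; first exact/se/mem_head.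
by move=> e' es; apply: se; rewrite inE es orbT.
Qed.

Lemma avgs_filter (a : pred E) s f :
  (forall e, e \in s -> ~~ a e -> ignores e f) -> avgs s f = avgs [seq e <- s | a e] f.
Proof.
elim: s => //= e s IH se.
have IHs : avgs s f = avgs [seq e <- s | a e] f.
  by apply: IH => e' es; apply: se; rewrite inE es orbT.
rewrite IHs; case: ifPn => // /(se e (mem_head _ _)) ae.
by rewrite avg_ignores //; exact: ignores_avgs.
Qed.

Lemma avgs_widen s s' f : uniq s -> uniq s' -> {subset s <= s'} ->
  depends [set` s] f -> avgs s' f = avgs s f.
Proof.
move=> us us' ss' fs; rewrite (@avgs_filter (mem s)); last first.
  by move=> e _ es; apply: (depends_ignores fs) => /=; exact/negP.
apply: avgs_perm; apply: uniq_perm; rewrite ?filter_uniq // => e.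
by rewrite mem_filter; apply/andP/idP => [[]//|es]; split=> //; exact: ss'.
Qed.

Lemma mean_widen s s' f : uniq s -> uniq s' -> {subset s <= s'} ->
  depends [set` s] f -> mean s' f = mean s f.
Proof. by move=> *; rewrite /mean (avgs_widen (s := s)). Qed.

Lemma avgs_const s f w w' : depends [set` s] f -> avgs s f w = avgs s f w'.
Proof.
move=> fs; have di s' : depends ([set` s] `\` [set` s']) (avgs s' f).
  elim: s' => [|e s' IH] /=; first by rewrite set_nil setD0.
  move=> v v' vv'; rewrite /avg; congr (_ * _ + _ * _); apply: IH => e' [es nes];
  rewrite /upd; case: (eqVneq e' e) => // ne; apply: vv'; split => //=;
  by move=> /orP[/eqP|//]; exact/eqP.
by apply: di => e [].
Qed.

Lemma depends_avg J e f : depends J f -> depends (J `\ e) (avg e f).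
Proof.
move=> fJ w w' ww'; rewrite /avg; congr (_ * _ + _ * _); apply: fJ => e' Je';
  by rewrite /upd; case: (eqVneq e' e) => // ne; apply: ww'; split => //; exact/eqP.
Qed.

Lemma depends_avgs J s f : depends J f -> depends (J `\` [set` s]) (avgs s f).
Proof.
move=> fJ; elim: s => [|e s IH] /=; first by rewrite set_nil setD0.
apply: depends_sub (depends_avg IH) => e' [[Je es] ne]; split => //=.
by move=> /orP[/eqP|//]; exact: ne.
Qed.

Lemma depends_gap J e f : depends J f -> depends J (gap e f).
Proof.
move=> fJ w w' ww'; rewrite /gap; congr (_ - _); apply: fJ => e' Je';
  by rewrite /upd; case: eqP => // _; exact: ww'.
Qed.

Lemma avgs_pull s f g : (forall e, e \in s -> ignores e g) ->
  avgs s (fun w => g w * f w) = (fun w => g w * avgs s f w).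
Proof.
elim: s => //= e s IH se; rewrite IH; last first.
  by move=> e' es; apply: se; rewrite inE es orbT.
apply/funext => w; rewrite /avg !(se e (mem_head _ _)); ring.
Qed.

Lemma avgsD s f g : avgs s (fun w => f w + g w) = (fun w => avgs s f w + avgs s g w).
Proof. by elim: s => //= e s ->; apply/funext => w; rewrite /avg; ring. Qed.

Lemma avgsZ s a f : avgs s (fun w => a * f w) = (fun w => a * avgs s f w).
Proof. exact: avgs_pull. Qed.

Lemma avgs_cst s a : avgs s (fun=> a) = (fun=> a).
Proof. exact: avgs_ignores. Qed.

Lemma avgsB s f g : avgs s (fun w => f w - g w) = (fun w => avgs s f w - avgs s g w).
Proof.
have -> : (fun w => f w - g w) = (fun w => f w + (-1) * g w).
  by apply/funext => w; ring.
by rewrite avgsD avgsZ; apply/funext => w; ring.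
Qed.

Lemma meanD s f g : mean s (fun w => f w + g w) = mean s f + mean s g.
Proof. by rewrite /mean avgsD. Qed.
Lemma meanB s f g : mean s (fun w => f w - g w) = mean s f - mean s g.
Proof. by rewrite /mean avgsB. Qed.
Lemma meanZ s a f : mean s (fun w => a * f w) = a * mean s f.
Proof. by rewrite /mean avgsZ. Qed.
Lemma mean_cst s a : mean s (fun=> a) = a.
Proof. by rewrite /mean avgs_cst. Qed.

Lemma mean_sum s (I : Type) (r : seq I) (P : pred I) (F : I -> (E -> bool) -> R) :
  mean s (fun w => \sum_(i <- r | P i) F i w) = \sum_(i <- r | P i) mean s (F i).
Proof.
elim: r => [|i r IH].
  rewrite big_nil -[RHS](mean_cst s 0); congr mean; apply/funext => w.
  by rewrite big_nil.
rewrite big_cons -IH; case: (boolP (P i)) => Pi.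
  rewrite -meanD; congr mean; apply/funext => w; by rewrite big_cons Pi.
congr mean; apply/funext => w; by rewrite big_cons (negPf Pi).
Qed.

Lemma gap_avgs e s f : e \notin s -> gap e (avgs s f) = avgs s (gap e f).
Proof.
elim: s => //= e' s IH; rewrite inE negb_or => /andP[ne es].
rewrite -IH //; apply/funext => w; rewrite /gap /avg !(upd_swap _ _ _ ne); ring.
Qed.

(** The deviation is (1 - p) or - p times the gap, according to the state of e. *)
Lemma sub_avg e f w : f w - avg e f w = (coord e w - p) * gap e f w.
Proof.
rewrite /avg /gap /coord -{1}(upd_id w e); case: (w e) => /=; ring.
Qed.

Fixpoint after e s := if s is e' :: s' then if e' == e then s' else after e s'
  else [::].

Definition increment s f e : (E -> bool) -> R :=
  fun w => (coord e w - p) * avgs (after e s) (gap e f) w.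

(** Averaging the coordinates one at a time, the last one first, telescopes. The
factor of the increment of e which multiplies the centred coordinate only sees
the coordinates before e, so the increments are martingale increments. *)
Lemma martingale_decomposition s f w : uniq s ->
  f w - avgs s f w = \sum_(e <- s) increment s f e w.
Proof.
elim: s => [|e s IH] /=; first by rewrite big_nil subrr.
move=> /andP[es us]; rewrite big_cons.
rewrite (eq_big_seq (fun e' => increment s f e' w)); last first.
  move=> e' e's; rewrite /increment /=; case: eqP => // ee'.
  by rewrite ee' e's in es.
rewrite -IH // {1}/increment /= eqxx -gap_avgs // -sub_avg; ring.
Qed.

Lemma after_rcons e e' s : e \in s -> after e (rcons s e') = rcons (after e s) e'.
Proof. by elim: s => //= e1 s IH; rewrite inE eq_sym; case: eqP => //= _; exact: IH. Qed.

End Averages.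

Section AveragesOrder.
Variables (R : realType) (E : choiceType) (p : R).
Hypotheses (p_ge0 : 0 <= p) (p_le1 : p <= 1).
Implicit Types (w : E -> bool) (e : E) (s : seq E) (f g : (E -> bool) -> R).

Lemma le_avgs s f g : (forall w, f w <= g w) -> forall w, avgs p s f w <= avgs p s g w.
Proof.
move=> fg; elim: s => //= e s IH w; rewrite /avg.
by rewrite lerD // ler_wpM2l // subr_ge0.
Qed.

Lemma avgs_ge0 s f : (forall w, 0 <= f w) -> forall w, 0 <= avgs p s f w.
Proof. by move=> f0 w; rewrite -[leLHS](congr1 (@^~ w) (avgs_cst p s 0)); exact: le_avgs. Qed.

Lemma avgs_norm s f C : (forall w, `|f w| <= C) -> forall w, `|avgs p s f w| <= C.
Proof.
move=> fC w; rewrite ler_norml; apply/andP; split.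
  rewrite -[leLHS](congr1 (@^~ w) (avgs_cst p s (- C))); apply: le_avgs => w'.
  by have := fC w'; rewrite ler_norml => /andP[].
rewrite -[leRHS](congr1 (@^~ w) (avgs_cst p s C)); apply: le_avgs => w'.
by have := fC w'; rewrite ler_norml => /andP[].
Qed.

Lemma le_mean s f g : (forall w, f w <= g w) -> mean p s f <= mean p s g.
Proof. by move=> fg; exact: le_avgs. Qed.

Lemma mean_ge0 s f : (forall w, 0 <= f w) -> 0 <= mean p s f.
Proof. by move=> f0; exact: avgs_ge0. Qed.

Lemma mean_norm s f : `|mean p s f| <= mean p s (fun w => `|f w|).
Proof.
rewrite ler_norml; apply/andP; split; last first.
  by apply: le_mean => w; exact: ler_norm.
have -> : - mean p s (fun w => `|f w|) = mean p s (fun w => - 1 * `|f w|).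
  by rewrite meanZ mulN1r.
by apply: le_mean => w; rewrite mulN1r lerNl -normrN ler_norm.
Qed.

End AveragesOrder.

(** * A characteristic function estimate for bounded martingale increments *)

Section Elementary.
Variable R : realType.
Implicit Types (x y : R).

Lemma mvt_from0 (f f' : R -> R) x :
  (forall y, is_derive y 1 f (f' y)) ->
  exists2 c, `|c| <= `|x| & f x - f 0 = f' c * x.
Proof.
move=> df; have cf (a b : R) : {within `[a, b], continuous f}.
  by apply: derivable_within_continuous => y _; case: (df y).
have [x0|x0|->] := ltgtP x 0.
- have [c] := MVT x0 (fun y _ => df y) (cf _ _).
  rewrite in_itv /= => /andP[xc c0] e; exists c.
    by rewrite !ltr0_norm // lerN2 ltW.
  by rewrite -opprB e; ring.
- have [c] := MVT x0 (fun y _ => df y) (cf _ _).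
  rewrite in_itv /= => /andP[c0 cx] e; exists c.
    by rewrite !gtr0_norm // ltW.
  by rewrite e subr0.
- by exists 0; rewrite ?subrr ?mulr0.
Qed.

Lemma norm_sin_le x : `|sin x| <= `|x|.
Proof.
have [c _] := @mvt_from0 sin cos x (fun y => is_derive_sin y).
by rewrite sin0 subr0 => ->; rewrite normrM ler_piMl // cos_max.
Qed.

Lemma cos_ge_sqr x : 1 - x ^+ 2 / 2 <= cos x.
Proof.
have [y ->] : exists y, x = y *+ 2 by exists (x / 2); rewrite mulr2n; lra.
rewrite cos_mulr2n cos2sin2.
have : sin y ^+ 2 <= y ^+ 2.
  rewrite -[leLHS]real_normK ?num_real // -[leRHS]real_normK ?num_real //.
  by rewrite ler_sqr ?nnegrE // norm_sin_le.
rewrite -[y *+ 2]mulr_natr exprMn; lra.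
Qed.

Lemma sin_sub_norm x : `|sin x - x| <= `|x| ^+ 3 / 2.
Proof.
have [c cx] := @mvt_from0 (fun y => sin y - y) (fun y => cos y - 1) x
  (fun y => is_deriveB (is_derive_sin y) (is_derive_id y 1)).
rewrite sin0 !subr0 => ->; rewrite normrM.
have -> : `|x| ^+ 3 / 2 = (`|x| ^+ 2 / 2) * `|x| by ring.
rewrite ler_wpM2r //.
rewrite ler0_norm ?subr_le0 ?cos_le1 // opprB.
have := cos_ge_sqr c; have : c ^+ 2 <= `|x| ^+ 2.
  by rewrite -[leLHS]real_normK ?num_real // ler_sqr ?nnegrE.
lra.
Qed.

Lemma cos_sub_norm x : `|x| <= 1 -> `|cos x - (1 - x ^+ 2 / 2)| <= `|x| ^+ 3 / 2.
Proof.
move=> x1.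
have df y : is_derive y 1 (fun y => cos y + y ^+ 2 / 2) (y - sin y).
  by apply: is_derive_eq; rewrite -mulr_natr !scaler0 add0r /GRing.scale /=; field.
have [c cx] := mvt_from0 x df.
rewrite cos0 expr0n /= mul0r addr0 => e.
have -> : cos x - (1 - x ^+ 2 / 2) = cos x + x ^+ 2 / 2 - 1 by ring.
rewrite e normrM distrC.
have c3 : `|sin c - c| <= `|x| ^+ 3 / 2.
  apply: le_trans (sin_sub_norm c) _; rewrite ler_wpM2r ?invr_ge0 //.
  by rewrite lerXn2r ?nnegrE.
by apply: le_trans (ler_pM _ _ c3 x1) _; rewrite ?mulr1.
Qed.

Lemma expRN_bounds (u : R) : 0 <= u -> 1 - u <= expR (- u) <= 1 - u + u ^+ 2.
Proof.
move=> u0; rewrite expR_ge1Dx /= expRN.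
apply: (@le_trans _ _ (1 + u)^-1).
  rewrite lef_pV2 ?posrE ?expR_gt0 ?expR_ge1Dx //; lra.
rewrite -div1r ler_pdivrMr; last lra.
have : 0 <= u ^+ 3 by rewrite exprn_ge0.
rewrite !exprS expr0; nra.
Qed.

Lemma expRN_lipschitz (a b : R) : 0 <= a -> 0 <= b ->
  `|expR (- a) - expR (- b)| <= `|a - b|.
Proof.
wlog ab : a b / a <= b => [H a0 b0|a0 b0].
  case: (leP a b) => [/H|/ltW/H]; first exact.
  by rewrite distrC (distrC a); exact.
have le1 : expR (- a) <= 1 by rewrite -expR0 ler_expR oppr_le0.
rewrite ger0_norm ?subr_ge0 ?ler_expR ?lerN2 // distrC ger0_norm ?subr_ge0 //.
have -> : - b = - a + - (b - a) by ring.
rewrite expRD; have := expR_ge1Dx (- (b - a)); have := expR_gt0 (- a).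
nra.
Qed.

Local Notation C := (complex R).

Lemma mul_Complex (a b c d : R) :
  Complex a b * Complex c d = Complex (a * c - b * d) (a * d + b * c) :> C.
Proof. by []. Qed.

Definition cis x : C := Complex (cos x) (sin x).

Lemma cisD x y : cis (x + y) = cis x * cis y.
Proof. by rewrite /cis cosD sinD mul_Complex; congr Complex; ring. Qed.

Lemma cis0 : cis 0 = 1.
Proof. by rewrite /cis cos0 sin0. Qed.

Lemma normc_cis x : ComplexField.Normc.normc (cis x) = 1.
Proof. by rewrite /= cos2Dsin2 sqrtr1. Qed.

Local Notation normc := ComplexField.Normc.normc.

Lemma normc_le_sum (z : C) : normc z <= `|complex.Re z| + `|complex.Im z|.
Proof.
case: z => a b /=; rewrite -[leRHS]ger0_norm ?addr_ge0 // -sqrtr_sqr ler_wsqrtr //.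
have := normr_ge0 a; have := normr_ge0 b.
rewrite -[a ^+ 2]real_normK ?num_real // -[b ^+ 2]real_normK ?num_real //.
by move: `|a| `|b| => u v; nra.
Qed.

Lemma Re_le_normc (z : C) : `|complex.Re z| <= normc z.
Proof. by case: z => a b /=; rewrite -sqrtr_sqr ler_wsqrtr // lerDl sqr_ge0. Qed.

Definition step x : C := Complex 1 x.

Lemma normc_step x : normc (step x) <= expR (x ^+ 2 / 2).
Proof.
rewrite /= expr1n -[leRHS]ger0_norm ?expR_ge0 // -sqrtr_sqr ler_wsqrtr //.
rewrite -expRM_natl; apply: le_trans (expR_ge1Dx _) _.
by rewrite ler_expR; lra.
Qed.

(** The limit theorem replaces exp(ix) by this factor, in which the linear and the
quadratic parts are separated. *)
Definition damped x : C := step x * Complex (expR (- (x ^+ 2 / 2))) 0.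

Lemma normcR x : normc (Complex x 0) = `|x|.
Proof. by rewrite /= expr0n addr0 sqrtr_sqr. Qed.

Lemma normc_damped x : normc (damped x) <= 1.
Proof.
rewrite /damped ComplexField.Normc.normcM normcR ger0_norm ?expR_ge0 // expRN.
by rewrite ler_pdivrMr ?expR_gt0 // mul1r normc_step.
Qed.

(** Both agree up to third order, so the error of the replacement is a sum of
cubes, which is small for many small increments. *)
Lemma cis_sub_damped x : `|x| <= 1 -> normc (cis x - damped x) <= 2 * `|x| ^+ 3.
Proof.
move=> x1; apply: le_trans (normc_le_sum _) _.
have u0 : 0 <= x ^+ 2 / 2 by rewrite divr_ge0 ?sqr_ge0.
have /andP[g1 g2] := expRN_bounds u0.
rewrite /damped /step /cis mul_Complex /= !mul1r !mulr0 subr0 add0r.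
set g := expR _ in g1 g2 *.
have xx : x ^+ 2 = `|x| ^+ 2 by rewrite real_normK ?num_real.
have n0 := normr_ge0 x.
have h1 : `|cos x - g| <= `|x| ^+ 3 / 2 + (x ^+ 2 / 2) ^+ 2.
  rewrite (_ : cos x - g = (cos x - (1 - x ^+ 2 / 2)) + (1 - x ^+ 2 / 2 - g)); last ring.
  apply: le_trans (ler_normD _ _) _; rewrite lerD ?cos_sub_norm //.
  by rewrite ler0_norm; lra.
have h2 : `|sin x - x * g| <= `|x| ^+ 3 / 2 + `|x| * (x ^+ 2 / 2).
  rewrite (_ : sin x - x * g = (sin x - x) + x * (1 - g)); last ring.
  apply: le_trans (ler_normD _ _) _; rewrite lerD ?sin_sub_norm // normrM.
  rewrite ler_wpM2l // ger0_norm; first lra.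
  by rewrite subr_ge0 -expR0 ler_expR oppr_le0.
move: h1 h2; rewrite xx; move: (`|cos x - g|) (`|sin x - x * g|) => a b.
have : `|x| ^+ 3 * `|x| <= `|x| ^+ 3 by rewrite ler_piMr // exprn_ge0.
move: `|x| x1 n0 => t t1 t0; rewrite !exprS expr0; nra.
Qed.

Lemma normc_prod_le1 (I : Type) (s : seq I) (f : I -> C) :
  (forall i, normc (f i) <= 1) -> normc (\prod_(i <- s) f i) <= 1.
Proof.
move=> f1; elim: s => [|i s IH].
  by rewrite big_nil ComplexField.Normc.normc1.
rewrite big_cons ComplexField.Normc.normcM mulr_ile1 //.
all: by case: (f i) => *; rewrite ?sqrtr_ge0 //; case: (\prod_(_ <- _) _) => *; exact: sqrtr_ge0.
Qed.

Lemma normc_ge0 (z : C) : 0 <= normc z.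
Proof. by case: z => a b; exact: sqrtr_ge0. Qed.

(** The factors are exchanged one at a time; the others have modulus at most 1. *)
Lemma normc_prod_sub (I : Type) (s : seq I) (f g : I -> C) :
  (forall i, normc (f i) <= 1) -> (forall i, normc (g i) <= 1) ->
  normc (\prod_(i <- s) f i - \prod_(i <- s) g i) <=
    \sum_(i <- s) normc (f i - g i).
Proof.
move=> f1 g1; elim: s => [|i s IH].
  by rewrite !big_nil subrr ComplexField.Normc.normc0.
rewrite !big_cons; set F := \prod_(_ <- s) _; set G := \prod_(_ <- s) _.
have -> : f i * F - g i * G = (f i - g i) * F + g i * (F - G) by ring.
apply: le_trans (le_normcD _ _) _.
rewrite !ComplexField.Normc.normcM lerD //.
  by rewrite ler_piMr ?normc_ge0 // normc_prod_le1.
by apply: le_trans IH; rewrite ler_piMl ?normc_ge0.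
Qed.

Lemma cis_sum (I : Type) (s : seq I) (f : I -> R) :
  cis (\sum_(i <- s) f i) = \prod_(i <- s) cis (f i).
Proof.
by elim: s => [|i s IH]; rewrite ?big_nil ?cis0 // !big_cons cisD IH.
Qed.

Lemma damped_prod (I : Type) (s : seq I) (f : I -> R) :
  \prod_(i <- s) damped (f i) =
  (\prod_(i <- s) step (f i)) *
    Complex (expR (- ((\sum_(i <- s) f i ^+ 2) / 2))) 0.
Proof.
elim: s => [|i s IH]; first by rewrite !big_nil mul0r oppr0 expR0 mulr1.
rewrite !big_cons IH /damped mulrDl opprD expRD.
have -> a b : Complex (a * b) 0 = Complex a 0 * Complex b 0 :> C.
  by rewrite mul_Complex; congr Complex; ring.
ring.
Qed.

Lemma normc_prod_step (I : Type) (s : seq I) (f : I -> R) :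
  normc (\prod_(i <- s) step (f i)) <= expR ((\sum_(i <- s) f i ^+ 2) / 2).
Proof.
elim: s => [|i s IH]; first by rewrite !big_nil mul0r expR0 ComplexField.Normc.normc1.
rewrite !big_cons mulrDl expRD ComplexField.Normc.normcM.
by apply: ler_pM; rewrite ?normc_ge0 ?normc_step.
Qed.

End Elementary.

Section McLeish.
Variables (R : realType) (E : choiceType) (p : R).
Hypotheses (p_ge0 : 0 <= p) (p_le1 : p <= 1).
Variable y : E -> (E -> bool) -> R.
Local Notation normc := ComplexField.Normc.normc.
Local Notation C := (complex R).

Let x e : (E -> bool) -> R := fun w => (coord R e w - p) * y e w.

Definition predictable s :=
  forall e, e \in s -> ignores e (y e) /\ {in after e s, forall e', ignores e' (y e)}.

(** The product of the factors 1 + i x_e has mean 1: averaging out the last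
coordinate kills the last increment. *)
Lemma mean_prod_step s (z : C) : uniq s -> predictable s ->
  mean p s (fun w => complex.Re (z * \prod_(e <- s) step (x e w))) = complex.Re z.
Proof.
elim/last_ind: s => [|s e IH] us ps.
  by rewrite /mean /= big_nil mulr1.
move: us; rewrite rcons_uniq => /andP[es us].
have ps' : predictable s.
  move=> e' e's; have [|h1 h2] := ps e'; first by rewrite mem_rcons inE e's orbT.
  split=> // f fs; apply: h2; rewrite after_rcons // mem_rcons inE fs orbT //.
rewrite -[RHS](IH us ps') /mean avgs_rcons; congr avgs; apply/funext => w.
have ig b : z * \prod_(e1 <- s) step (x e1 (upd w e b)) =
            z * \prod_(e <- s) step (x e w).
  congr (_ * _); apply: eq_big_seq => e' e's; congr step.
  have ne : e != e' by apply: contraNneq es => ->.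
  rewrite /x (ignores_coord R ne); congr (_ * _).
  have [|_ h2] := ps e'; first by rewrite mem_rcons inE e's orbT.
  by apply: h2; rewrite after_rcons // mem_rcons mem_head.
have ye : ignores e (y e).
  by have [|//] := ps e; rewrite mem_rcons mem_head.
rewrite /avg.
have st b : complex.Re (z * \prod_(e1 <- rcons s e) step (x e1 (upd w e b))) =
  let Z := z * \prod_(e <- s) step (x e w) in
  complex.Re Z - complex.Im Z * ((b%:R - p) * y e w).
  rewrite big_rcons mulrA ig /=.
  have -> : x e (upd w e b) = (b%:R - p) * y e w.
    by rewrite /x ye /coord /upd eqxx.
  by case: (z * _) => a b' /=; rewrite mulr1.
rewrite !st /=; ring.
Qed.

(** If the sum of the squares were the constant v, the product of the damped factors
would be exp(-v/2) times the product of the 1 + i x_e, whose mean is 1. The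
deviation of the sum of squares from v is multiplied by the modulus of that
product, which is at most exp(N c^2 / 2). *)
Lemma mcleish_bound s (c v phi : R) : uniq s -> predictable s ->
  0 <= c <= 1 -> (forall e w, e \in s -> `|x e w| <= c) -> 0 <= v ->
  `|mean p s (fun w => cos (phi + \sum_(e <- s) x e w)) - cos phi * expR (- (v / 2))|
  <= 2 * (size s)%:R * c ^+ 3 +
     expR ((size s)%:R * c ^+ 2 / 2) *
     (mean p s (fun w => `|\sum_(e <- s) x e w ^+ 2 - v|) / 2).
Proof.
move=> us ps /andP[c0 c1] xc v0.
pose T w := \prod_(e <- s) step (x e w).
pose V w := \sum_(e <- s) x e w ^+ 2.
have mT : mean p s (fun w => complex.Re (cis phi * T w)) = cos phi.
  exact: mean_prod_step.
have V0 w : 0 <= V w by apply: sumr_ge0 => e _; exact: sqr_ge0.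
have Vc w : V w <= (size s)%:R * c ^+ 2.
  rewrite /V -sum1_size natr_sum mulr_suml big_seq [leRHS]big_seq; apply: ler_sum => e es.
  rewrite mul1r -[leLHS]real_normK ?num_real // ler_sqr ?nnegrE //; exact: xc.
set EN := expR (_ * c ^+ 2 / 2).
have key w : `|cos (phi + \sum_(e <- s) x e w) -
               expR (- (v / 2)) * complex.Re (cis phi * T w)| <=
     2 * (size s)%:R * c ^+ 3 + EN / 2 * `|V w - v|.
  have -> : cos (phi + \sum_(e <- s) x e w) =
      complex.Re (cis phi * \prod_(e <- s) cis (x e w)).
    by rewrite -cis_sum -cisD.
  set P := \prod_(e <- s) cis _; pose g := expR (- (V w / 2)).
  have gP : complex.Re (cis phi * \prod_(e <- s) damped (x e w)) = g * complex.Re (cis phi * T w).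
    rewrite damped_prod mulrA -/(T w) -/(V w) -/g.
    by case: (cis phi * T w) => a b /=; rewrite mulr0 subr0 mulrC.
  set r := complex.Re (cis phi * T w) in gP *.
  rewrite (_ : _ - _ = (complex.Re (cis phi * P) - g * r) + (g - expR (- (v / 2))) * r); last ring.
  apply: le_trans (ler_normD _ _) _; apply: lerD.
    rewrite -gP.
    rewrite (_ : _ - _ = complex.Re (cis phi * (P - \prod_(e <- s) damped (x e w)))); last first.
      by rewrite mulrBr; case: (_ * P) => ? ?; case: (_ * _) => ? ?.
    apply: le_trans (Re_le_normc _) _.
    rewrite ComplexField.Normc.normcM normc_cis mul1r.
    apply: le_trans (normc_prod_sub _ _ _) _ => [e|e|].
    - by rewrite normc_cis.
    - exact: normc_damped.
    rewrite -sum1_size natr_sum mulrAC mulr_sumr big_seq [leRHS]big_seq.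
    apply: ler_sum => e es; apply: le_trans (cis_sub_damped _) _.
      by apply: le_trans c1; exact: xc.
    by rewrite mulr1 ler_wpM2l // lerXn2r ?nnegrE ?xc.
  rewrite normrM mulrC (_ : EN / 2 * _ = EN * (`|V w - v| / 2)); last ring.
  apply: ler_pM => //.
    apply: le_trans (Re_le_normc _) _.
    rewrite ComplexField.Normc.normcM normc_cis mul1r.
    apply: le_trans (normc_prod_step _ _) _. rewrite /EN ler_expR ler_wpM2r ?invr_ge0 //.
    exact: Vc.
  apply: le_trans (expRN_lipschitz _ _) _; rewrite ?divr_ge0 //.
  by rewrite -mulrBl normrM (@ger0_norm _ 2^-1) ?invr_ge0.
rewrite -[cos phi]mT mulrC -meanZ -meanB; apply: le_trans (mean_norm p_ge0 p_le1 _ _) _.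
apply: le_trans (le_mean p_ge0 p_le1 _ key) _.
by rewrite meanD mean_cst meanZ lerD2l [leRHS](_ : _ = EN / 2 * mean p s (fun w => `|V w - v|)) ?lexx //; rewrite /V; ring.
Qed.

End McLeish.

(** * From trigonometric to bounded continuous test functions *)

Section MeanSquare.
Variables (R : realType) (E : choiceType) (p : R).
Implicit Types (s : seq E) (f g : (E -> bool) -> R).

Lemma mean_sqr_sum s (I : Type) (r : seq I) (F : I -> (E -> bool) -> R) :
  mean p s (fun w => (\sum_(i <- r) F i w) ^+ 2) =
  \sum_(i <- r) \sum_(j <- r) mean p s (fun w => F i w * F j w).
Proof.
rewrite -(eq_bigr _ (fun i _ => mean_sum _ _ _ _ _)) -mean_sum.
congr mean; apply/funext => w; rewrite expr2 mulr_suml.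
by apply: eq_bigr => i _; rewrite mulr_sumr.
Qed.

(** Averaging over J first turns f into a constant and leaves g alone. *)
Lemma mean_mul_disjoint s (J K : set E) f g : depends [set` s] f ->
  depends J f -> depends K g -> J `&` K = set0 ->
  mean p s (fun w => f w * g w) = mean p s f * mean p s g.
Proof.
move=> fs fJ gK JK; pose sJ := [seq e <- s | `[< J e >]].
have sJ_perm : perm_eq s (sJ ++ [seq e <- s | ~~ `[< J e >]]).
  by rewrite perm_sym; apply/permPl/perm_filterC.
have igJ e : e \in sJ -> ignores e g.
  rewrite mem_filter => /andP[/asboolP Je _]; apply: (depends_ignores gK) => Ke.
  by have : (J `&` K) e by []; rewrite JK.
have fJs : avgs p s f = avgs p sJ f.
  apply: avgs_filter => e _ /asboolP Je; exact: depends_ignores Je.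
rewrite /mean (avgs_perm p _ sJ_perm) avgs_cat.
have fcst : avgs p sJ f = fun=> mean p s f.
  apply/funext => w; rewrite /mean -fJs; exact: avgs_const.
rewrite avgsC.
have -> : avgs p sJ (fun w => f w * g w) = fun w => mean p s f * g w.
  transitivity (avgs p sJ (fun w => g w * f w)).
    by congr avgs; apply/funext => w; rewrite mulrC.
  by rewrite avgs_pull // fcst; apply/funext => w; rewrite mulrC.
rewrite avgsZ; congr (_ * _).
by rewrite (avgs_perm p g sJ_perm) avgs_cat avgsC (avgs_ignores p igJ).
Qed.

End MeanSquare.

Section Bernstein.
Variable R : realType.

Lemma avgs_horner (E : choiceType) (s : seq E) (f : (E -> bool) -> R) w :
  exists q : {poly R}, forall y, avgs y s f w = q.[y].
Proof.
elim: s w => [|e s IH] w; first by exists (f w)%:P => y; rewrite hornerC.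
have [q1 h1] := IH (upd w e true); have [q2 h2] := IH (upd w e false).
exists ('X * q1 + (1 - 'X) * q2) => y.
by rewrite /= /avg h1 h2 !hornerE.
Qed.

Let heads n (w : nat -> bool) : R := \sum_(i <- iota 0 n) (w i)%:R.

(** The Bernstein polynomial of g: the mean of g at the frequency of successes in n
trials of parameter y. *)
Definition bernstein n (g : R -> R) (y : R) : R :=
  mean y (iota 0 n) (fun w => g (heads n w / n%:R)).

Let natr_sum1 n : n%:R = \sum_(i <- iota 0 n) 1 :> R.
Proof. by rewrite big_const_seq count_predT size_iota iter_addr_0. Qed.

(** Distinct trials are uncorrelated, so only the variances of the trials remain. *)
Lemma mean_heads_sqr n (y : R) : 0 <= y <= 1 ->
  mean y (iota 0 n) (fun w => (heads n w - n%:R * y) ^+ 2) <= n%:R.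
Proof.
move=> /andP[y0 y1].
pose F (i : nat) (w : nat -> bool) : R := (w i)%:R - y.
have -> : (fun w => (heads n w - n%:R * y) ^+ 2) =
          (fun w => (\sum_(i <- iota 0 n) F i w) ^+ 2).
  apply/funext => w; rewrite big_split /= sumrN big_const_seq count_predT size_iota.
  by rewrite iter_addr_0 mulr_natl.
rewrite mean_sqr_sum [leRHS]natr_sum1.
rewrite big_seq [leRHS]big_seq; apply: ler_sum => i ii.
have dF j : depends [set j] (F j) by move=> w w' ww'; rewrite /F ww'.
have mF j : j \in iota 0 n -> mean y (iota 0 n) (F j) = 0.
  move=> jn; rewrite (@mean_widen _ _ _ [:: j]) ?iota_uniq //.
  - by rewrite /mean /= /avg /F /upd eqxx /=; ring.
  - by move=> k; rewrite inE => /eqP ->.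
  - by move=> w w' ww'; apply: (dF j) => k ->; apply: ww'; rewrite /= inE.
rewrite (bigD1_seq i) ?iota_uniq //= big1_seq ?addr0 => [|j /andP[ji jn]].
  rewrite -[leRHS](mean_cst y (iota 0 n) 1); apply: le_mean => // w.
  by rewrite /F; case: (w i) => /=; nra.
have dsub k : k \in iota 0 n -> depends [set` iota 0 n] (F k).
  by move=> kn; apply: depends_sub (dF k) => _ ->.
rewrite (@mean_mul_disjoint _ _ _ _ [set i] [set j]) ?mF ?mul0r //; first exact: dsub.
by apply/seteqP; split => // k [-> /eqP]; rewrite eq_sym (negPf ji).
Qed.

(** Chebyshev: the frequency of successes is within del of y, except with probability
of order 1/n, and there g is bounded. *)
Lemma bernstein_close n (g : R -> R) (M eps del y : R) : (0 < n)%N -> 0 < del ->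
  0 <= y <= 1 -> (forall z, `|g z| <= M) ->
  (forall z, 0 <= z <= 1 -> `|z - y| < del -> `|g z - g y| <= eps) ->
  `|bernstein n g y - g y| <= eps + 2 * M / (n%:R * del ^+ 2).
Proof.
move=> n0 d0 y01 gM gy; have /andP[y0 y1] := y01.
have M0 : 0 <= M by apply: le_trans (gM 0).
have e0 : 0 <= eps by apply: le_trans (gy y y01 _); rewrite ?subrr ?normr0.
have nR : 0 < n%:R :> R by rewrite ltr0n.
rewrite /bernstein -[X in _ - X](mean_cst y (iota 0 n)) -meanB.
apply: le_trans (mean_norm y0 y1 _ _) _.
pose D := 2 * M / (n%:R * del) ^+ 2.
apply: (@le_trans _ _ (mean y (iota 0 n) (fun w => eps + D * (heads n w - n%:R * y) ^+ 2))).
  apply: le_mean => // w; set z := heads n w / n%:R.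
  have hz : heads n w = n%:R * z by rewrite mulrC divfK // gt_eqF.
  have z01 : 0 <= z <= 1.
    rewrite divr_ge0 ?ler0n ?sumr_ge0 //= ler_pdivrMr // mul1r.
    by rewrite [leRHS]natr_sum1; apply: ler_sum => i _; case: (w i).
  have D0 : 0 <= D * (heads n w - n%:R * y) ^+ 2.
    by rewrite mulr_ge0 ?sqr_ge0 // divr_ge0 ?sqr_ge0 // mulr_ge0.
  have [zy|zy] := ltP `|z - y| del; first by rewrite ler_wpDr ?gy.
  rewrite ler_wpDl //; apply: (@le_trans _ _ (2 * M)).
    by apply: le_trans (ler_normB _ _) _; have := gM z; have := gM y; lra.
  rewrite /D hz -mulrBr mulrAC ler_pdivlMr ?exprn_gt0 ?mulr_gt0 //.
  rewrite ler_wpM2l ?mulr_ge0 // !exprMn ler_wpM2l ?sqr_ge0 //.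
  by rewrite -[leRHS]real_normK ?num_real // lerXn2r ?nnegrE // ltW.
rewrite meanD mean_cst meanZ lerD2l.
have D0 : 0 <= D by rewrite divr_ge0 ?sqr_ge0 // mulr_ge0.
apply: le_trans (ler_wpM2l D0 (mean_heads_sqr n y01)) _.
by rewrite /D le_eqVlt; apply/orP; left; apply/eqP; field; rewrite !gt_eqF.
Qed.

End Bernstein.

Section TrigApproximation.
Variable R : realType.

(** The point z may leave the segment, as the frequency of successes at which a
Bernstein polynomial evaluates g does. *)
Lemma segment_unif_cont (g : R -> R) (a b eps : R) : 0 < eps ->
  (forall z, a <= z <= b -> {for z, continuous g}) ->
  exists2 del, 0 < del & forall y z, a <= y <= b -> `|z - y| < del ->
    `|g z - g y| <= eps.
Proof.
move=> e0 cg; have /compact_near_coveringP/= := @segment_compact R a b.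
move=> /(_ R (0^'+) (fun del y => forall z, `|z - y| < del -> `|g z - g y| <= eps) _).
case=> [y|del del0 H].
  rewrite /= in_itv /= => yab.
  have e2 : 0 < eps / 2 by rewrite divr_gt0.
  have /cvgrPdist_lt/(_ _ e2) := cg y yab.
  rewrite /= => -[eta eta0 He]; exists (ball y (eta / 2), [set t | t < eta / 2]).
    split; first by apply: nbhsx_ballx; rewrite divr_gt0.
    by apply: nbhs_right_lt; rewrite divr_gt0.
  move=> [y' del] /= [yy' dd] z zy.
  have eta2 : eta / 2 < eta by move: eta0 => /=; lra.
  have h1 : `|g y - g z| < eps / 2.
    apply: He => /=; rewrite (_ : y - z = (y - y') - (z - y')); last ring.
    apply: le_lt_trans (ler_normB _ _) _; move: yy'; rewrite -ball_normE /= => yy'.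
    by rewrite [ltRHS]splitr ltrD // (lt_trans zy).
  have h2 : `|g y - g y'| < eps / 2 
    by apply: He => /=; move: yy'; rewrite -ball_normE /= => /lt_trans; apply.
  rewrite (_ : g z - g y' = (g y - g y') - (g y - g z)); last ring.
  by apply: le_trans (ler_normB _ _) _; rewrite [leRHS]splitr lerD // ltW.
have {}del0 : 0 < del by [].
exists (del / 2); first by rewrite divr_gt0.
move=> y z yab zy; apply: (H (del / 2)) => //=.
  by rewrite sub0r normrN ger0_norm; lra.
by rewrite divr_gt0.
Qed.

(** On a segment strictly inside a half period, sin(x/2L) is a coordinate; in
this coordinate a continuous function is a uniform limit of polynomials. *)
Lemma sin_poly_approx (f : R -> R) (M L eps : R) : continuous f ->
  (forall x, `|f x| <= M) -> 0 < L -> 0 < eps ->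
  exists u (q : {poly R}), (forall x, `|q.[sin (u * x)]| <= M) /\
    forall x, `|x| <= L -> `|f x - q.[sin (u * x)]| <= eps.
Proof.
move=> cf fM L0 e0; pose u : R := (2 * L)^-1.
have u0 : 0 < u by rewrite invr_gt0 mulr_gt0.
pose c : R := sin (1 / 2).
have hp := @pihalf_ge1 R.
have c1 : c < 1.
  rewrite /c -[ltRHS]sin_pihalf ltr_sin ?in_itv /=; lra.
have M0 : 0 <= M by apply: le_trans (fM 0).
pose g (z : R) := f (asin (2 * z - 1) / u).
have [||del d0 gd] := @segment_unif_cont g ((1 - c) / 2) ((1 + c) / 2) (eps / 2).
- by rewrite divr_gt0.
- move=> z zc.
  have : {for 2 * z - 1, continuous (@asin R)}.
    by apply: continuous_asin; lra.
  move=> ca; apply: continuous_comp; last exact: cf.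
  apply: cvgM; last exact: cvg_cst.
  apply: continuous_comp; last exact: ca.
  by apply: cvgB; [apply: cvgM; [exact: cvg_cst|exact: cvg_id]|exact: cvg_cst].
(* this degree makes the Chebyshev error at most eps / 2 *)
pose n := (Num.bound (4 * M / (eps * del ^+ 2))).+1.
have [q0 hq0] := @avgs_horner R nat (iota 0 n)
  (fun w => g ((\sum_(i <- iota 0 n) (w i)%:R) / n%:R)) (fun=> false).
exists u, (q0 \Po ('X * (2^-1)%:P + (2^-1)%:P)).
have qE x : (q0 \Po ('X * (2^-1)%:P + (2^-1)%:P)).[sin (u * x)] =
    bernstein n g ((1 + sin (u * x)) / 2).
  rewrite horner_comp !hornerE /bernstein /mean hq0; congr (_.[_]); ring.
have y01 x : 0 <= (1 + sin (u * x)) / 2 <= 1.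
  by have := sin_geN1 (u * x); have := sin_le1 (u * x); lra.
split=> x; rewrite qE.
  by have /andP[? ?] := y01 x; apply: avgs_norm => // w; exact: fM.
move=> xL; rewrite distrC.
have uxL : `|u * x| <= 1 / 2.
  rewrite normrM gtr0_norm // /u mulrC ler_pdivrMr ?mulr_gt0 //; lra.
have fE : g ((1 + sin (u * x)) / 2) = f x.
  rewrite /g (_ : 2 * _ - 1 = sin (u * x)); last by field.
  rewrite sinK; first by congr f; rewrite mulrC mulKf // gt_eqF.
  by rewrite in_itv /=; move: uxL; rewrite ler_norml; lra.
rewrite -[X in _ - X]fE.
apply: le_trans (bernstein_close (M := M) (eps := eps / 2) _ d0 (y01 x) _ _) _ => //.
- by move=> z; exact: fM.
- move=> z _; apply: gd; move: uxL; rewrite ler_norml => /andP[h1 h2].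
  have : sin (u * x) <= c by rewrite /c leNgt ltr_sin -?leNgt ?in_itv //=; lra.
  have : - c <= sin (u * x).
    by rewrite /c -sinN leNgt ltr_sin -?leNgt ?in_itv //=; lra.
  lra.
have nb : 4 * M / (eps * del ^+ 2) < n%:R.
  apply: lt_trans (archi_boundP _) _; last by rewrite ltr_nat.
  by rewrite divr_ge0 ?mulr_ge0 ?exprn_ge0 // ltW.
have d2 : 0 < del ^+ 2 by rewrite exprn_gt0.
have : 2 * M / (n%:R * del ^+ 2) <= eps / 2; last lra.
rewrite ler_pdivrMr ?mulr_gt0 ?ltr0n //.
move: nb; rewrite ltr_pdivrMr ?mulr_gt0 //; lra.
Qed.

End TrigApproximation.

Section WeakConvergence.
Variable R : realType.
Implicit Types (f g h : R -> R) (I : (R -> R) -> R).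

Definition bcont f := continuous f /\ exists M : R, forall x, `|f x| <= M.

Lemma bcont_cst a : bcont (fun=> a).
Proof. by split; [exact: cst_continuous|exists `|a|]. Qed.

Lemma bcontD f g : bcont f -> bcont g -> bcont (fun x => f x + g x).
Proof.
move=> [cf [M fM]] [cg [N gN]]; split.
  by move=> x; apply: cvgD; [exact: cf|exact: cg].
by exists (M + N) => x; apply: le_trans (ler_normD _ _) _; rewrite lerD.
Qed.

Lemma bcontM f g : bcont f -> bcont g -> bcont (fun x => f x * g x).
Proof.
move=> [cf [M fM]] [cg [N gN]]; split.
  by move=> x; apply: cvgM; [exact: cf|exact: cg].
by exists (M * N) => x; rewrite normrM ler_pM.
Qed.

Lemma bcont_cos a t : bcont (fun x => cos (a + t * x)).
Proof.
split; last by exists 1 => x; exact: cos_max.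
move=> x; apply: continuous_comp; last exact: continuous_cos.
by apply: cvgD; [exact: cvg_cst|apply: cvgM; [exact: cvg_cst|exact: cvg_id]].
Qed.

Lemma bcont_sin t : bcont (fun x => sin (t * x)).
Proof.
split; last by exists 1 => x; exact: sin_max.
move=> x; apply: continuous_comp; last exact: continuous_sin.
by apply: cvgM; [exact: cvg_cst|exact: cvg_id].
Qed.

Lemma bcontX f k : bcont f -> bcont (fun x => f x ^+ k).
Proof.
move=> bf; elim: k => [|k IH].
  have -> : (fun x => f x ^+ 0) = fun=> 1 by apply/funext => x; rewrite expr0.
  exact: bcont_cst.
have -> : (fun x => f x ^+ k.+1) = fun x => f x * f x ^+ k.
  by apply/funext => x; rewrite exprS.
exact: bcontM.
Qed.

Lemma bcont_horner f (q : {poly R}) : bcont f -> bcont (fun x => q.[f x]).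
Proof.
move=> bf; elim/poly_ind: q => [|q c IH].
  have -> : (fun x => 0.[f x]) = fun=> 0 by apply/funext => x; rewrite horner0.
  exact: bcont_cst.
have -> : (fun x => (q * 'X + c%:P).[f x]) = fun x => q.[f x] * f x + c.
  by apply/funext => x; rewrite !hornerE.
by apply: bcontD; [exact: bcontM|exact: bcont_cst].
Qed.

Definition mean_functional I := [/\
  forall f g, bcont f -> bcont g -> I (fun x => f x + g x) = I f + I g,
  forall a f, bcont f -> I (fun x => a * f x) = a * I f,
  forall f g, bcont f -> bcont g -> (forall x, f x <= g x) -> I f <= I g &
  I (fun=> 1) = 1].

(** A bounded continuous substitute for the indicator of |x| >= L; being at most
(x/L)^2, it is controlled by second moments. *)
Definition tail (L : R) : R -> R := fun x => (x / L) ^+ 2 / (1 + (x / L) ^+ 2).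

Let den_gt0 (L x : R) : 0 < 1 + (x / L) ^+ 2.
Proof. by rewrite ltr_pwDl ?sqr_ge0. Qed.

Lemma tail_ge0 L x : 0 <= tail L x.
Proof. by rewrite /tail divr_ge0 ?sqr_ge0 // ltW. Qed.

Lemma bcont_tail L : bcont (tail L).
Proof.
split; last first.
  exists 1 => x; rewrite ger0_norm ?tail_ge0 // /tail.
  by rewrite ler_pdivrMr // mul1r lerDr.
have cs : continuous (fun x : R => (x / L) ^+ 2).
  move=> x; rewrite (_ : (fun x => _) = fun x => (x / L) * (x / L)); last first.
    by apply/funext => y; rewrite expr2.
  by apply: cvgM; apply: cvgM; [exact: cvg_id|exact: cvg_cst|exact: cvg_id|exact: cvg_cst].
move=> x; apply: cvgM; first exact: cs.
apply: cvgV; first by rewrite gt_eqF.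
by apply: cvgD; [exact: cvg_cst|exact: cs].
Qed.

Lemma tail_ge_half L x : 0 < L -> L <= `|x| -> 1 / 2 <= tail L x.
Proof.
move=> L0 Lx; rewrite /tail ler_pdivlMr //.
suff : 1 <= (x / L) ^+ 2 by lra.
rewrite -[leRHS]real_normK ?num_real // exprn_ege1 //.
by rewrite normrM (@gtr0_norm _ L^-1) ?invr_gt0 // ler_pdivlMr // mul1r.
Qed.

Lemma tail_le L x : tail L x <= x ^+ 2 / L ^+ 2.
Proof.
rewrite -expr_div_n /tail ler_pdivrMr // ler_peMr ?sqr_ge0 // lerDl sqr_ge0 //.
Qed.

Variables (I_ : nat -> (R -> R) -> R) (J : (R -> R) -> R).
Hypotheses (meanI : forall r, mean_functional (I_ r)) (meanJ : mean_functional J).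
Hypothesis cvg_cos : forall a t,
  (fun r => I_ r (fun x => cos (a + t * x))) @ \oo --> J (fun x => cos (a + t * x)).
Hypothesis tight : forall eps : R, 0 < eps -> exists L : R,
  [/\ 0 < L, \forall r \near \oo, I_ r (tail L) <= eps & J (tail L) <= eps].

Let cvgs f := (fun r => I_ r f) @ \oo --> J f.

Let cvgsD f g : bcont f -> bcont g -> cvgs f -> cvgs g -> cvgs (fun x => f x + g x).
Proof.
move=> bf bg If Ig; rewrite /cvgs; have [-> // _ _ _] := meanJ.
rewrite (_ : (fun r => _) = (fun r => I_ r f + I_ r g)); first exact: cvgD.
by apply/funext => r; have [-> // _ _ _] := meanI r.
Qed.

Let cvgsZ a f : bcont f -> cvgs f -> cvgs (fun x => a * f x).
Proof.
move=> bf If; rewrite /cvgs; have [_ -> // _ _] := meanJ.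
rewrite (_ : (fun r => _) = (fun r => a * I_ r f)); first by apply: cvgM => //; exact: cvg_cst.
by apply/funext => r; have [_ -> // _ _] := meanI r.
Qed.

(** By the product formula for sin and cos, one factor sin(ux) is traded for two
shifted phases and frequencies, which lowers the power of the sine. *)
Let cvgs_sinX u k a t : cvgs (fun x => sin (u * x) ^+ k * cos (a + t * x)).
Proof.
elim: k a t => [|k IH] a t.
  rewrite (_ : (fun x => _) = (fun x => cos (a + t * x))); first exact: cvg_cos.
  by apply/funext => x; rewrite expr0 mul1r.
pose F b s := fun x => sin (u * x) ^+ k * cos (b + s * x).
have bF b s : bcont (F b s).
  by apply: bcontM; [apply: bcontX; exact: bcont_sin|exact: bcont_cos].
rewrite (_ : (fun x => _) = (fun x => 2^-1 * F (a - pi / 2) (u + t) x +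
  - 2^-1 * F (a - pi / 2) (t - u) x)); last first.
  apply/funext => x; rewrite /F exprS.
  have -> : a - pi / 2 + (u + t) * x = (a + t * x) + (u * x) - pi / 2 by ring.
  have -> : a - pi / 2 + (t - u) * x = (a + t * x) - (u * x) - pi / 2 by ring.
  rewrite !cosBpihalf sinD sinB; lra.
by apply: cvgsD; try apply: cvgsZ; rewrite ?/F //; try (apply: bcontM; [exact: bcont_cst|]); exact: bF.
Qed.

Let cvgs_poly u (q : {poly R}) : cvgs (fun x => q.[sin (u * x)]).
Proof.
rewrite (_ : (fun x => _) = (fun x => \sum_(i < size q) q`_i * sin (u * x) ^+ i)); last first.
  by apply/funext => x; rewrite horner_coef.
have bS k : bcont (fun x => sin (u * x) ^+ k) by apply: bcontX; exact: bcont_sin.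
suff H (s : seq 'I_(size q)) : bcont (fun x => \sum_(i <- s) q`_i * sin (u * x) ^+ i) /\
    cvgs (fun x => \sum_(i <- s) q`_i * sin (u * x) ^+ i) by case: (H (index_enum _)).
elim: s => [|i s [IHb IHc]].
  rewrite (_ : (fun x => _) = fun=> 0); last by apply/funext => x; rewrite big_nil.
  split; first exact: bcont_cst.
  rewrite (_ : (fun=> 0) = fun x : R => 0 * 1); last by apply/funext => x; rewrite mul0r.
  apply: cvgsZ; first exact: bcont_cst.
  rewrite /cvgs; have [_ _ _ ->] := meanJ.
  rewrite (_ : (fun r => _) = fun=> 1); first exact: cvg_cst.
  by apply/funext => r; have [_ _ _ ->] := meanI r.
rewrite (_ : (fun x => _) = (fun x => q`_i * sin (u * x) ^+ i + \sum_(i <- s) q`_i * sin (u * x) ^+ i)); last first.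
  by apply/funext => x; rewrite big_cons.
have bz : bcont (fun x => q`_i * sin (u * x) ^+ i) by apply: bcontM; [exact: bcont_cst|exact: bS].
split; first exact: bcontD.
apply: cvgsD => //; apply: cvgsZ; first exact: bS.
rewrite (_ : (fun x => _) = (fun x => sin (u * x) ^+ i * cos (0 + 0 * x))); last first.
  by apply/funext => x; rewrite mul0r addr0 cos0 mulr1.
exact: cvgs_sinX.
Qed.

(** Outside [-L, L], where q does not approximate f, both functions are bounded by M
and the tail is at least 1/2. *)
Lemma mean_functional_close I f q M eps del L : mean_functional I -> 0 < L ->
  bcont f -> bcont q -> 0 <= M -> 0 <= eps ->
  (forall x, `|f x| <= M) -> (forall x, `|q x| <= M) ->
  (forall x, `|x| <= L -> `|f x - q x| <= eps) ->
  I (tail L) <= del -> `|I f - I q| <= eps + 4 * M * del.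
Proof.
move=> [ID IZ Ile I1] L0 bf bq M0 e0 fM qM fq Idel.
have pt x : `|f x - q x| <= eps + 4 * M * tail L x.
  have [xL|/ltW xL] := lerP `|x| L.
    apply: le_trans (fq x xL) _; rewrite lerDl mulr_ge0 ?tail_ge0 // mulr_ge0 //.
  have := tail_ge_half L0 xL; have := fM x; have := qM x; have := ler_normB (f x) (q x).
  nra.
have bt : bcont (fun x => 4 * M * tail L x).
  by apply: bcontM; [exact: bcont_cst|exact: bcont_tail].
have be : bcont (fun x => eps + 4 * M * tail L x) by apply: bcontD => //; exact: bcont_cst.
have Ie : I (fun x => eps + 4 * M * tail L x) <= eps + 4 * M * del.
  rewrite ID //; last exact: bcont_cst.
  rewrite (IZ (4 * M)); last exact: bcont_tail.
  rewrite (_ : (fun=> eps) = fun x : R => eps * 1); last by apply/funext => x; rewrite mulr1.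
  rewrite IZ; last exact: bcont_cst.
  by rewrite I1 mulr1 lerD2l ler_wpM2l // mulr_ge0.
have h1 : I f <= I q + I (fun x => eps + 4 * M * tail L x).
  rewrite -ID //; apply: Ile => //; first exact: bcontD.
  by move=> x; have := pt x; rewrite ler_norml; lra.
have h2 : I q <= I f + I (fun x => eps + 4 * M * tail L x).
  rewrite -ID //; apply: Ile => //; first exact: bcontD.
  by move=> x; have := pt x; rewrite ler_norml; lra.
by rewrite ler_norml; lra.
Qed.

(** On a large segment f is close to a polynomial in sin(ux), which is a
combination of functions cos(a + tx); tightness bounds the contribution of the
complement, uniformly in r. *)
Theorem weak_convergence_of_cos f : bcont f -> (fun r => I_ r f) @ \oo --> J f.
Proof.
move=> bf; have [cf [M fM]] := bf.
have M0 : 0 <= M by apply: le_trans (fM 0).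
apply/cvgrPdist_le => e e0.
pose del := e / (16 * (M + 1)).
have del0 : 0 < del by rewrite divr_gt0 // mulr_gt0 //; lra.
have Md : 4 * M * del <= e / 4.
  rewrite /del mulrA ler_pdivrMr; last by rewrite mulr_gt0 //; lra.
  by have := ltW e0; nra.
have [L [L0 IL JL]] := tight del0.
have e8 : 0 < e / 8 by rewrite divr_gt0.
have [u [q [qM fq]]] := sin_poly_approx cf fM L0 e8.
have bq : bcont (fun x => q.[sin (u * x)]) by apply: bcont_horner; exact: bcont_sin.
have Jq := mean_functional_close meanJ L0 bf bq M0 (ltW e8) fM qM fq JL.
have := @cvgs_poly u q; rewrite /cvgs => /cvgrPdist_le/(_ _ e8) qcvg.
near=> r.
have ILr : I_ r (tail L) <= del by near: r.
have Iq := mean_functional_close (meanI r) L0 bf bq M0 (ltW e8) fM qM fq ILr.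
have : `|J (fun x => q.[sin (u * x)]) - I_ r (fun x => q.[sin (u * x)])| <= e / 8.
  by near: r.
move: Jq Iq; rewrite !ler_norml => /andP[a1 a2] /andP[b1 b2] /andP[c1 c2].
by apply/andP; split; lra.
Unshelve. all: by end_near. Qed.

End WeakConvergence.

(** * The characteristic function of the Gaussian law *)

Section GaussianCosine.
Variable R : realType.
Notation lam := (@lebesgue_measure R).

Section FixedDeviation.
Variables (s : R).
Hypothesis s_gt0 : 0 < s.
Let s0 : s != 0. Proof. by rewrite gt_eqF. Qed.
Notation phi := (normal_pdf 0 s).

(** The density of the normal law is its Radon-Nikodym derivative almost everywhere. *)
Lemma integral_normal_prob (f : R -> R) : measurable_fun setT f ->
  (exists M : R, forall x, `|f x| <= M) ->
  (\int[normal_prob 0 s]_x (f x)%:E = \int[lam]_x (f x * phi x)%:E)%E.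
Proof.
move=> mf [M fM].
have fi : (normal_prob 0 s).-integrable setT (EFin \o f).
  apply: measurable_bounded_integrable => //.
    exact: (le_lt_trans (@probability_le1 _ _ R (normal_prob 0 s : probability (measurableTypeR R) R) _ measurableT) (ltry 1)).
  exists M; split; first by rewrite num_real.
  by move=> y My x _; apply: le_trans (fM x) (ltW My).
have dom := normal_prob_dominates 0 s.
have iRN : lam.-integrable setT
    (Radon_Nikodym (charge_of_finite_measure (normal_prob 0 s)) lam).
  exact: Radon_Nikodym_integrable.
rewrite -(Radon_Nikodym_change_of_variables dom measurableT fi).
apply: ae_eq_integral => //.
- apply: emeasurable_funM; first exact/measurable_EFinP.
  exact: measurable_int iRN.
- by apply/measurable_EFinP; apply: measurable_funM => //; exact: measurable_normal_pdf.
have : ae_eq lam setT (fun x => (phi x)%:E)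
    (Radon_Nikodym (charge_of_finite_measure (normal_prob 0 s)) lam).
  apply: integral_ae_eq => //.
  - exact: integrable_normal_pdf.
  - by move=> A _ mA; rewrite -Radon_Nikodym_integral.
apply: filterS => x /= H _; rewrite -H // EFinM //.
Qed.

Lemma continuous_phi : continuous phi.
Proof. exact: continuous_normal_pdf. Qed.

Lemma phi_ge0 x : 0 <= phi x. Proof. exact: normal_pdf_ge0. Qed.

Lemma phiE x : phi x = normal_peak s * expR (- (x ^+ 2 / (s ^+ 2 *+ 2))).
Proof. by rewrite normal_pdfE // /normal_fun subr0 mulNr. Qed.

Lemma phi_bound x : phi x <= normal_peak s / (1 + x ^+ 2 / (s ^+ 2 *+ 2)).
Proof.
have u0 : 0 <= x ^+ 2 / (s ^+ 2 *+ 2) by rewrite divr_ge0 ?sqr_ge0 // mulrn_wge0 ?sqr_ge0.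
rewrite phiE ler_wpM2l ?normal_peak_ge0 // expRN lef_pV2 ?posrE ?expR_gt0 ?expR_ge1Dx //.
by rewrite ltr_pwDl.
Qed.

Lemma is_derive_phi (x : R) : is_derive x 1 phi (- (x / s ^+ 2) * phi x).
Proof.
have -> : phi = fun y => normal_peak s * expR (- ((s ^+ 2 *+ 2)^-1 * y ^+ 2)).
  by apply/funext => y; rewrite phiE mulrC [_ * y ^+ 2]mulrC mulrC.
apply: is_derive_eq; rewrite /GRing.scale /= ?mulr2n; field.
by rewrite s0 -mulr2n mulrn_eq0 expf_eq0 (negPf s0).
Qed.

(** The first absolute moment is finite: the linear factor is absorbed by
doubling the standard deviation. *)
Lemma integrable_abs_phi : lam.-integrable setT (fun x => (`|x| * phi x)%:E).
Proof.
(* |x| <= 1 + x^2 <= (1 + 8 s^2 / 3) exp(3 x^2 / (8 s^2)), and the exponential is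
   the quotient of the Gaussian functions of deviations 2 s and s *)
pose K : R := (1 + 8 * s ^+ 2 / 3) * (normal_peak s / normal_peak (2 * s)).
have ss : 0 < s ^+ 2 by rewrite exprn_gt0.
have s20 : 2 * s != 0 by rewrite mulf_neq0.
have Ki : lam.-integrable setT (fun x => (K * normal_pdf 0 (2 * s) x)%:E).
  under eq_fun do rewrite EFinM.
  by apply: integrableZl => //; exact: integrable_normal_pdf.
apply: le_integrable Ki => //.
  apply/measurable_EFinP; apply: measurable_funM.
    apply: continuous_measurable_fun; exact: norm_continuous.
  exact: measurable_normal_pdf.
move=> x _; rewrite /= lee_fin.
rewrite ger0_norm ?mulr_ge0 ?phi_ge0 // [leRHS]ger0_norm; last first.
  rewrite mulr_ge0 ?normal_pdf_ge0 // mulr_ge0 ?divr_ge0 ?normal_peak_ge0 //.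
  by rewrite addr_ge0 // divr_ge0 // mulr_ge0 ?sqr_ge0.
rewrite phiE normal_pdfE // /normal_fun subr0 /K.
set e2 := expR (- x ^+ 2 / ((2 * s) ^+ 2 *+ 2)).
have pk : 0 < normal_peak (2 * s) by exact: normal_peak_gt0.
have -> : (1 + 8 * s ^+ 2 / 3) * (normal_peak s / normal_peak (2 * s)) *
   (normal_peak (2 * s) * e2) = normal_peak s * ((1 + 8 * s ^+ 2 / 3) * e2).
  by field; rewrite gt_eqF.
rewrite mulrCA ler_wpM2l ?normal_peak_ge0 //.
have -> : expR (- (x ^+ 2 / (s ^+ 2 *+ 2))) =
   e2 * expR (- (3 * x ^+ 2 / (8 * s ^+ 2))).
  rewrite -expRD; congr expR; rewrite ?mulr2n; field.
  by rewrite s0 -!mulr2n !mulrn_eq0 !expf_eq0 (negPf s0) (negPf s20).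
rewrite [leRHS]mulrC mulrCA ler_wpM2l ?expR_ge0 // expRN ler_pdivrMr ?expR_gt0 //.
set y := 3 * x ^+ 2 / _.
apply: le_trans (ler_wpM2l _ (expR_ge1Dx y)).
  have xy : x ^+ 2 = 8 * s ^+ 2 / 3 * y.
    by rewrite /y; field.
  have y0 : 0 <= y by rewrite /y divr_ge0 // mulr_ge0 // sqr_ge0.
  apply: (@le_trans _ _ (1 + x ^+ 2)).
    by rewrite -[x ^+ 2]real_normK ?num_real //; have := normr_ge0 x; nra.
  have : 0 <= 8 * s ^+ 2 / 3 by rewrite divr_ge0 // mulr_ge0 // ltW.
  rewrite xy; nra.
by rewrite addr_ge0 // divr_ge0 // mulr_ge0 // ltW.
Qed.

Lemma integrable_phi : lam.-integrable setT (fun x => (phi x)%:E).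
Proof. exact: integrable_normal_pdf. Qed.

Lemma integrable_cos_phi a t : lam.-integrable setT (EFin \o (fun x => cos (a + t * x) * phi x)).
Proof.
apply: le_integrable integrable_phi => //.
  apply/measurable_EFinP; apply: measurable_funM; last exact: measurable_normal_pdf.
  apply: continuous_measurable_fun; exact: (bcont_cos a t).1.
move=> x _; rewrite /= lee_fin normrM [leRHS]ger0_norm ?phi_ge0 //.
by rewrite (ger0_norm (phi_ge0 x)) ler_piMl ?phi_ge0 ?cos_max.
Qed.

Lemma continuous_sin_aff a t : continuous (fun x : R => sin (a + t * x)).
Proof.
move=> x; apply: continuous_comp; last exact: continuous_sin.
by apply: cvgD; [exact: cvg_cst|apply: cvgM; [exact: cvg_cst|exact: cvg_id]].
Qed.

Lemma integrable_xsin_phi a t :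
  lam.-integrable setT (EFin \o (fun x => x * sin (a + t * x) * phi x)).
Proof.
apply: le_integrable integrable_abs_phi => //.
  apply/measurable_EFinP; apply: measurable_funM; last exact: measurable_normal_pdf.
  apply: measurable_funM => //; apply: continuous_measurable_fun.
  exact: continuous_sin_aff.
move=> x _; rewrite /= lee_fin !normrM normr_id.
by rewrite ler_wpM2r // ler_piMr // sin_max.
Qed.

Let h (a t x : R) : R := t * (cos (a + t * x) * phi x) - (s ^+ 2)^-1 * (x * sin (a + t * x) * phi x).

Let is_derive_h (a t x : R) : is_derive x 1 (fun x => sin (a + t * x) * phi x) (h a t x).
Proof.
have d1 := is_derive_phi x.
have d2 : is_derive x 1 (fun x => sin (a + t * x)) (t * cos (a + t * x)).
  apply: is_derive_eq; rewrite /GRing.scale /=; ring.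
apply: is_derive_eq; rewrite /h /GRing.scale /=; field; rewrite s0 //.
Qed.

Let continuous_h a t : continuous (h a t).
Proof.
move=> x; apply: cvgB; apply: cvgM; try exact: cvg_cst.
  by apply: cvgM; [exact: (bcont_cos a t).1|exact: continuous_phi].
apply: cvgM; last exact: continuous_phi.
by apply: cvgM; [exact: cvg_id|exact: continuous_sin_aff].
Qed.

Let integrable_h a t : lam.-integrable setT (EFin \o h a t).
Proof.
pose c (x : R) : R := cos (a + t * x) * phi x.
pose d (x : R) : R := x * sin (a + t * x) * phi x.
rewrite (_ : EFin \o h a t = (fun x => t%:E * (c x)%:E - ((s ^+ 2)^-1)%:E * (d x)%:E)%E) //.
apply: integrableB => //; apply: integrableZl => //.
  exact: integrable_cos_phi.
exact: integrable_xsin_phi.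
Qed.

(** h is the derivative of sin(a + tx) phi(x), which vanishes at infinity. *)
Let int_h a t : (\int[lam]_x (h a t x)%:E = 0)%E.
Proof.
pose D n : set R := [set` `[- (n.+1%:R : R), n.+1%:R]].
have c1 : (fun n => \int[lam]_x ((h a t \_ (D n)) x)%:E)%E @ \oo --> (\int[lam]_x (h a t x)%:E)%E.
  have [] := @dominated_convergence _ _ _ lam setT measurableT
    (fun n x => ((h a t \_ (D n)) x)%:E) (fun x => (h a t x)%:E)
    (fun x => `|(h a t x)%:E|%E) => //.
  - move=> n; apply/measurable_EFinP; apply/measurable_restrict => //.
      exact: measurable_itv.
    rewrite setTI; apply: measurable_funTS.
    by apply: continuous_measurable_fun; exact: continuous_h.
  - by apply/measurable_EFinP; apply: continuous_measurable_fun; exact: continuous_h.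
  - apply: aeW => x _; apply: cvg_near_cst; near=> n.
    rewrite /= patchE mem_set // /D /= in_itv /= -ler_norml.
    apply: le_trans (ltW (archi_boundP (normr_ge0 x))) _.
    rewrite ler_nat; apply: leq_trans (leqnSn _); near: n; exact: nbhs_infty_ge.
  - exact: integrable_norm (integrable_h a t).
  - apply: aeW => x n _; rewrite /= patchE; case: ifP => //.
    by rewrite /= normr0 lee_fin.
have c2 : (fun n => \int[lam]_x ((h a t \_ (D n)) x)%:E)%E @ \oo --> 0%E.
  have FTC n : (\int[lam]_x ((h a t \_ (D n)) x)%:E)%E =
      (sin (a + t * n.+1%:R) * phi n.+1%:R - sin (a + t * - n.+1%:R) * phi (- n.+1%:R))%:E.
    have -> : (\int[lam]_x ((h a t \_ (D n)) x)%:E)%E = (\int[lam]_(x in D n) (h a t x)%:E)%E.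
      rewrite [RHS]integral_mkcond; apply: eq_integral => x _.
      by rewrite !patchE; case: ifP.
    rewrite (@continuous_FTC2 _ _ (fun x => sin (a + t * x) * phi x)) ?EFinB //.
    - have : 0 < n.+1%:R :> R by rewrite ltr0n.
      lra.
    - exact/continuous_subspaceT/continuous_h.
    - have cF : continuous (fun x => sin (a + t * x) * phi x).
        by move=> x; apply: cvgM; [exact: continuous_sin_aff|exact: continuous_phi].
      split.
      + by move=> x _; case: (is_derive_h a t x).
      + by apply: cvg_at_right_filter; exact: cF.
      + by apply: cvg_at_left_filter; exact: cF.
    - by move=> x _; rewrite derive1E; exact: (@derive_val _ _ _ _ _ _ _ (is_derive_h a t x)).
  rewrite (eq_fun FTC); apply: cvg_EFin; first exact: nearW.
  pose B (n : nat) : R := 2 * normal_peak s * (s ^+ 2 *+ 2) / n.+1%:R.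
  apply/cvgr0Pnorm_le => e e0.
  have cB : B @ \oo --> (0 : R).
    rewrite (_ : 0 = 2 * normal_peak s * (s ^+ 2 *+ 2) * 0); last by rewrite mulr0.
    by apply: cvgM; [exact: cvg_cst|exact: cvg_harmonic].
  have /cvgr0Pnorm_le/(_ e e0) cB' := cB.
  near=> n; apply: (@le_trans _ _ (`|B n|)); last by near: n.
  apply: le_trans (ler_norm _).
  have ph x : `|x| = n.+1%:R -> `|sin (a + t * x) * phi x| <= B n / 2.
    move=> xn; rewrite normrM (ger0_norm (phi_ge0 _)).
    apply: (@le_trans _ _ (phi x)); first by rewrite ler_piMl ?phi_ge0 ?sin_max.
    apply: le_trans (phi_bound x) _.
    rewrite /B -[x ^+ 2]real_normK ?num_real // xn.
    have n1 : 1 <= n.+1%:R :> R by rewrite ler1n.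
    have ss : 0 < s ^+ 2 *+ 2 by rewrite mulrn_wgt0 // exprn_gt0.
    move: n1 ss; move: (n.+1%:R : R) (s ^+ 2 *+ 2) => N S N1 S0.
    have N0 : 0 < N by apply: lt_le_trans N1.
    have pk := normal_peak_ge0 s.
    rewrite (_ : 2 * normal_peak s * S / N / 2 = normal_peak s * (S / N)); last first.
      by field; rewrite gt_eqF.
    rewrite ler_wpM2l // -[S / N]invrK lef_pV2 ?posrE ?invr_gt0 ?divr_gt0 //; last first.
      by rewrite ltr_pwDl // divr_ge0 ?sqr_ge0 // ltW.
    rewrite invfM invrK mulrC; apply: (@le_trans _ _ (N ^+ 2 / S)); last by rewrite lerDr.
    by rewrite ler_wpM2r ?invr_ge0 ?(ltW S0) // expr2 ler_peMr // ltW.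
  apply: le_trans (ler_normB _ _) _; rewrite [leRHS]splitr lerD // ph ?normrN //.
    by rewrite ger0_norm.
  by rewrite ger0_norm.
exact: cvg_unique c1 c2.
Unshelve. all: by end_near. Qed.

Let F a t : R := (\int[lam]_x (cos (a + t * x) * phi x))%R.

Let gaussian_ibp a t :
  (\int[lam]_x (x * sin (a + t * x) * phi x))%R = s ^+ 2 * t * F a t.
Proof.
have := int_h a t; rewrite /h.
under eq_integral do rewrite EFinB EFinM [((s ^+ 2)^-1 * _)%:E]EFinM.
rewrite integralB //; last 2 first.
- by apply: integrableZl => //; exact: integrable_cos_phi.
- by apply: integrableZl => //; exact: integrable_xsin_phi.
rewrite !integralZl //; last 2 first.
- exact: integrable_xsin_phi.
- exact: integrable_cos_phi.
rewrite -(fineK (integrable_fin_num measurableT (integrable_cos_phi a t))).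
rewrite -(fineK (integrable_fin_num measurableT (integrable_xsin_phi a t))).
rewrite -!EFinM -EFinB => -[] /eqP; rewrite subr_eq0 => /eqP e.
rewrite /F /Rintegral -mulrA [t * _]e mulrA divff ?mul1r //.
by rewrite expf_neq0.
Qed.

Let is_derive_F (a t : R) : is_derive t 1 (F a) (- (s ^+ 2 * t * F a t)).
Proof.
pose f (t x : R) : R := cos (a + t * x) * phi x.
have df (t' x : R) : is_derive t' 1 (f ^~ x) (- (x * sin (a + t' * x) * phi x)).
  rewrite /f; apply: is_derive_eq; rewrite /GRing.scale /=; ring.
have dfE t' x : partial1of2 f t' x = - (x * sin (a + t' * x) * phi x).
  by rewrite partial1of2E; exact: (@derive_val _ _ _ _ _ _ _ (df t' x)).
have It : [set` `](t - 1), (t + 1)[] t by rewrite /= in_itv /=; lra.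
have h1 x : [set` `](t - 1), (t + 1)[] x -> lam.-integrable setT (EFin \o f x).
  by move=> _; exact: integrable_cos_phi.
have h2 x y : [set` `](t - 1), (t + 1)[] x -> setT y -> derivable (f ^~ y) x 1.
  by move=> _ _; case: (df x y).
have G0 x : 0 <= `|x| * phi x by rewrite mulr_ge0 ?phi_ge0.
have h3 x y : [set` `](t - 1), (t + 1)[] x -> setT y -> `|partial1of2 f x y| <= `|y| * phi y.
  move=> _ _; rewrite dfE normrN !normrM (ger0_norm (phi_ge0 _)).
  by rewrite ler_wpM2r ?phi_ge0 // ler_piMr // sin_max.
have := @derivable_under_integral R _ _ lam f setT measurableT t _ _ It h1 h2 _ G0 integrable_abs_phi h3.
have := @differentiation_under_integral R _ _ lam f setT measurableT t _ _ It h1 h2 _ G0 integrable_abs_phi h3.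
move=> e1 e2; apply: DeriveDef => //.
rewrite -derive1E e1 -gaussian_ibp.
rewrite -mulN1r -RintegralZl //; last exact: integrable_xsin_phi.
by apply: eq_Rintegral => x _; rewrite dfE mulN1r.
Qed.

(** Integration by parts gives F' = - s^2 t F, so F(t) exp(s^2 t^2 / 2) is constant. *)
Lemma Rintegral_cos_phi a t : F a t = cos a * expR (- (s ^+ 2 * t ^+ 2 / 2)).
Proof.
have d (u : R) : is_derive u 1 (fun u => F a u * expR (s ^+ 2 * u ^+ 2 / 2)) 0.
  have dF := is_derive_F a u.
  by apply: is_derive_eq; rewrite /GRing.scale /= ?mulr2n; field.
have [c _] := mvt_from0 t d.
rewrite mul0r => /eqP; rewrite subr_eq0 => /eqP.
have -> : F a 0 = cos a.
  rewrite /F; under eq_Rintegral do rewrite mul0r addr0.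
  rewrite RintegralZl //; last exact: integrable_phi.
  by rewrite /Rintegral integral_normal_pdf mulr1.
rewrite expr0n /= mulr0 mul0r expR0 mulr1 => <-.
by rewrite -mulrA -expRD subrr expR0 mulr1.
Qed.

End FixedDeviation.

Lemma gaussian_cos (v a t : R) : 0 <= v ->
  (\int[gaussian 0 v]_x cos (a + t * x))%R = cos a * expR (- (v * t ^+ 2 / 2)).
Proof.
move=> v0; have mc : measurable_fun setT (fun x => cos (a + t * x)).
  by apply: continuous_measurable_fun; exact: (bcont_cos a t).1.
rewrite /gaussian /Rintegral; case: eqP => [->|/eqP vn0].
  rewrite integral_dirac //; last exact/measurable_EFinP.
  by rewrite diracT mul1e /= mulr0 addr0 !mul0r oppr0 expR0 mulr1.
have sv : 0 < Num.sqrt v by rewrite sqrtr_gt0 lt_def vn0.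
rewrite integral_normal_prob //; last by exists 1 => x; exact: cos_max.
by have := Rintegral_cos_phi sv a t; rewrite sqr_sqrtr.
Qed.

Lemma integrable_bcont (d : measure_display) (T : measurableType d) (P : probability T R) (X : T -> R) f :
  measurable_fun setT X -> bcont f -> P.-integrable setT (EFin \o (f \o X)).
Proof.
move=> mX [cf [M fM]]; apply: measurable_bounded_integrable => //.
- exact: (le_lt_trans (probability_le1 P measurableT) (ltry 1)).
- by apply: measurableT_comp => //; exact: continuous_measurable_fun.
exists M; split; first by rewrite num_real.
by move=> y My x _; apply: le_trans (fM _) (ltW My).
Qed.

Lemma mean_functional_integral (mu : probability (measurableTypeR R) R) :
  mean_functional (fun f => \int[mu]_x f x)%R.
Proof.
have mid : measurable_fun setT (fun x : measurableTypeR R => x : R) by exact: measurable_id.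
split => [f g bf bg|a f bf|f g bf bg fg|].
- by rewrite RintegralD //; exact: (integrable_bcont _ mid).
- by rewrite RintegralZl //; exact: (integrable_bcont _ mid).
- by apply: le_Rintegral => //; exact: (integrable_bcont _ mid).
- rewrite Rintegral_cst // mul1r; have e : mu setT = 1%E by exact: probability_setT.
  by rewrite -[RHS]/(fine 1%E) -e.
Qed.

(** Bounded convergence: the tails tend to 0 pointwise. *)
Lemma tight_integral (mu : probability (measurableTypeR R) R) (eps : R) : 0 < eps ->
  exists N, forall n, (N <= n)%N -> (\int[mu]_x tail n.+1%:R x)%R <= eps.
Proof.
move=> e0; have mid : measurable_fun setT (fun x : measurableTypeR R => x : R) by exact: measurable_id.
have mt n : measurable_fun setT (fun x : measurableTypeR R => tail n.+1%:R x : R).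
  by apply: continuous_measurable_fun; case: (@bcont_tail R n.+1%:R).
have t1 (L x : R) : `|tail L x| <= 1.
  rewrite ger0_norm ?tail_ge0 // /tail ler_pdivrMr ?mul1r ?lerDr //.
  by rewrite ltr_pwDl ?sqr_ge0.
have : (fun n => \int[mu]_x (tail n.+1%:R x)%:E)%E @ \oo --> (\int[mu]_x (0 : R)%:E)%E.
  have [] := @dominated_convergence _ _ _ mu setT measurableT
    (fun n x => (tail n.+1%:R x)%:E) (fun=> 0%E) (fun=> 1%E) => //.
  - by move=> n; exact/measurable_EFinP.
  - apply: aeW => x _; apply: cvg_EFin; first exact: nearW.
    have cB : (fun n : nat => x ^+ 2 / n.+1%:R : R) @ \oo --> (0 : R).
      rewrite (_ : 0 = x ^+ 2 * 0); last by rewrite mulr0.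
      by apply: cvgM; [exact: cvg_cst|exact: cvg_harmonic].
    apply: (squeeze_cvgr _ (@cvg_cst R 0 _ _ _) cB); apply: nearW => n /=.
    rewrite tail_ge0 /=; apply: le_trans (tail_le _ _) _.
    rewrite ler_wpM2l ?sqr_ge0 // lef_pV2 ?posrE ?exprn_gt0 // expr2 ler_peMr // ler1n //.
  - by apply: finite_measure_integrable_cst.
  - by apply: aeW => x n _; rewrite /= lee_fin.
rewrite integral0 => /fine_cvgP[_] /cvgr0Pnorm_le/(_ _ e0) [N _ H].
by exists N => n /H /=; apply: le_trans; exact: ler_norm.
Qed.

End GaussianCosine.

(** * Ranks of chain groups of nested complexes *)

(** Inside B1, the image of A1 meets B0 in the image of a subspace of A0; the
inequality is the dimension formula for the sum of io(A1) and B0. *)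
Lemma dim_gap_mono (K : fieldType) (U U' : vectType K) (io : 'Hom(U, U'))
    (A0 A1 : {vspace U}) (B0 B1 : {vspace U'}) :
  (lker io == 0)%VS -> (B0 <= B1)%VS ->
  (forall c, c \in A1 -> io c \in B1) ->
  (forall c, c \in A1 -> io c \in B0 -> c \in A0) ->
  (\dim A1 + \dim B0 <= \dim B1 + \dim A0)%N.
Proof.
move=> /eqP io0 B01 A1B1 A1B0.
have dimi (A : {vspace U}) : \dim (io @: A) = \dim A.
  by apply: limg_dim_eq; rewrite io0 capv0.
rewrite -(dimi A1) -dimv_sum_cap -(dimi A0); apply: leq_add; apply: dimvS.
  rewrite subv_add B01 andbT; apply/subvP => _ /memv_imgP[c cA ->]; exact: A1B1.
apply/subvP => v; rewrite memv_cap => /andP[/memv_imgP[c cA ->] icB].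
by apply: memv_img; exact: A1B0.
Qed.

Section ChainMembership.
Variables (R : realType) (V : choiceType) (W : {fset V}).
Implicit Types (X Y : set (set V)) (n : nat).

Definition support_of n (t : tuples W n) : set V := range (fun i => val (t i)).

Definition alternating n (c : chain R W n) : Prop :=
  forall t s, c (tperm_by t s) = (-1) ^+ s * c t.

Lemma tperm_byM n (t : tuples W n) a b :
  tperm_by (tperm_by t a) b = tperm_by t (b * a)%g.
Proof. by apply/ffunP => j; rewrite !ffunE permM. Qed.

Lemma tperm_by1 n (t : tuples W n) : tperm_by t 1%g = t.
Proof. by apply/ffunP => j; rewrite !ffunE perm1. Qed.

Lemma tperm_by_inj n a : injective (fun t : tuples W n => tperm_by t a).
Proof.
move=> t u /(congr1 (fun t => tperm_by t a^-1%g)).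
by rewrite !tperm_byM mulVg !tperm_by1.
Qed.

Lemma support_tperm n (t : tuples W n) s : support_of (tperm_by t s) = support_of t.
Proof.
apply/seteqP; split => [_ [i _ <-]|_ [i _ <-]]; first by rewrite ffunE; exists (s i).
by exists ((s^-1)%g i) => //; rewrite ffunE permKV.
Qed.

Lemma chain_expand n (c : chain R W n) : c = \sum_t (c t : R) *: delta R t.
Proof.
apply/ffunP => u; rewrite sum_ffunE (bigD1 u) //= !ffunE eqxx big1 ?addr0.
  by rewrite /GRing.scale /= mulr1.
by move=> t tu; rewrite !ffunE eq_sym (negPf tu) scaler0.
Qed.

Lemma orientE n (t u : tuples W n) : orient R t u =
  (n.+1)`!%:R^-1 * \sum_(s : 'S_n.+1) (-1) ^+ s * (u == tperm_by t s)%:R.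
Proof.
rewrite /orient ffunE; congr (_ * _); rewrite sum_ffunE; apply: eq_bigr => s _.
by rewrite !ffunE.
Qed.

Lemma orient_alternating n (t : tuples W n) : alternating (orient R t).
Proof.
move=> u a; rewrite !orientE mulrCA; congr (_ * _).
rewrite mulr_sumr (reindex_inj (mulgI a)) /=; apply: eq_bigr => s _.
rewrite mulrA odd_permM signr_addb; congr (_ * _%:R).
rewrite -tperm_byM; congr nat_of_bool.
by apply/eqP/eqP => [/tperm_by_inj|->].
Qed.

Lemma orient_support n (t u : tuples W n) : orient R t u != 0 ->
  support_of u = support_of t.
Proof.
rewrite orientE mulf_eq0 negb_or => /andP[_ h].
have [s /eqP us|nos] := pickP (fun s => u == tperm_by t s).
  by rewrite us support_tperm.
by move: h; rewrite big1 ?eqxx // => s _; rewrite nos mulr0.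
Qed.

Lemma alternating_sum_orient n (c : chain R W n) : alternating c ->
  c = \sum_t (c t : R) *: orient R t.
Proof.
move=> ac; apply/ffunP => u; rewrite sum_ffunE.
pose N : R := (n.+1)`!%:R.
have N0 : N != 0 by rewrite pnatr_eq0 -lt0n fact_gt0.
transitivity (N^-1 * \sum_(s : 'S_n.+1) c u).
  by rewrite sumr_const card_Sn -mulr_natl mulrA mulVf ?mul1r.
transitivity (\sum_t N^-1 * \sum_(s : 'S_n.+1)
    (c t * ((-1) ^+ s * (u == tperm_by t s)%:R))); last first.
  apply: eq_bigr => t _; rewrite -mulr_sumr ffunE orientE /N.
  rewrite [RHS]/GRing.scale /=; ring.
rewrite -mulr_sumr exchange_big /=; congr (_ * _); apply: eq_bigr => s _.
rewrite (reindex_inj (@tperm_by_inj n (s^-1)%g)) /= (bigD1 u) //= big1 ?addr0.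
  rewrite tperm_byM mulgV tperm_by1 eqxx ac odd_permV mulr1 mulrAC -expr2.
  by rewrite sqrr_sign mul1r.
move=> t tu; rewrite tperm_byM mulgV tperm_by1 eq_sym (negPf tu) !mulr0 //.
Qed.

Lemma alternating_injective n (c : chain R W n) t : alternating c -> c t != 0 ->
  injective t.
Proof.
move=> ac ct i j tij; apply/eqP; apply: contraNT ct => ij.
have e : tperm_by t (tperm i j) = t.
  apply/ffunP => k; rewrite ffunE; case: tpermP => [->|->|] //.
have := ac t (tperm i j); rewrite e odd_tperm ij expr1 mulN1r => /eqP.
by rewrite -addr_eq0 -mulr2n mulrn_eq0.
Qed.

(** Antisymmetrising an alternating function gives it back, so alternation
characterises the span of the oriented tuples; membership becomes a pointwise
condition, which is easy to compare between complexes. *)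
Lemma chainsP X n (c : chain R W n) :
  c \in chains R W X n <->
  alternating c /\ forall t, c t != 0 -> X (support_of t).
Proof.
rewrite /chains; set L := [seq _ | _ <- _]; split.
  move=> cL; rewrite (@coord_span _ _ _ (in_tuple L) c cL).
  have Lx (i : 'I_(size L)) : exists2 t, X (support_of t) & L`_i = orient R t.
    have /mapP[t + ->] : L`_i \in L by rewrite mem_nth.
    by rewrite mem_filter => /andP[/andP[_ /asboolP tX] _]; exists t.
  split=> [t s|t].
    rewrite !sum_ffunE mulr_sumr; apply: eq_bigr => i _; rewrite !ffunE.
    by have [u _ ->] := Lx i; rewrite orient_alternating mulrCA.
  rewrite sum_ffunE => h.
  have [i hi|noi] := pickP (fun i : 'I_(size L) => L`_i t != 0); last first.
    move: h; rewrite big1 ?eqxx // => i _; rewrite ffunE; move/negbFE/eqP: (noi i) => ->.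
    exact: mulr0.
  by move: hi; have [u uX ->] := Lx i => /orient_support ->.
move=> [ac cX]; rewrite (alternating_sum_orient ac); apply: memv_suml => t _.
have [->|ct] := eqVneq (c t) 0; first by rewrite scale0r mem0v.
apply/memvZ/memv_span/map_f; rewrite mem_filter mem_enum andbT; apply/andP; split.
  by apply/injectiveP; exact: alternating_injective ct.
by apply/asboolP; exact: cX.
Qed.

Lemma support_neq0 n (t : tuples W n) : support_of t !=set0.
Proof. by exists (val (t ord0)), ord0. Qed.

Lemma chains_sub X Y n : (forall s, X s -> s !=set0 -> Y s) ->
  (chains R W X n <= chains R W Y n)%VS.
Proof.
move=> XY; apply/subvP => c /chainsP[ac cX]; apply/chainsP; split=> // t /cX tX.
by apply: XY => //; exact: support_neq0.
Qed.

Lemma chains_cap X Y Z n c : (forall s, X s -> Y s -> s !=set0 -> Z s) ->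
  c \in chains R W X n -> c \in chains R W Y n -> c \in chains R W Z n.
Proof.
move=> XYZ /chainsP[ac cX] /chainsP[_ cY]; apply/chainsP; split=> // t ct.
by apply: XYZ; [exact: cX|exact: cY|exact: support_neq0].
Qed.

Definition is_cycle n : chain R W n -> bool :=
  match n with 0 => xpredT | k.+1 => fun c => bd R W k c == 0 end.

Lemma mem_cycles X n c :
  (c \in cycles R W X n) = (c \in chains R W X n) && is_cycle c.
Proof. by case: n c => [|n] c /=; rewrite ?andbT // memv_cap memv_ker. Qed.

(** By rank-nullity the boundaries disappear. The Betti number does not respond
monotonically to the opening of an edge, but each of the three dimensions does. *)
Lemma betti_dim X n : (forall s t : set V, X s -> t `<=` s -> X t) ->
  (betti R W X n)%:R = (\dim (cycles R W X n))%:R + (\dim (cycles R W X n.+1))%:R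
     - (\dim (chains R W X n.+1))%:R :> R.
Proof.
move=> Xsub; rewrite /betti natrB; last exact/dimvS/boundaries_sub_cycles.
have := limg_ker_dim (bd R W n) (chains R W X n.+1).
rewrite -/(boundaries R W X n) -/(cycles R W X n.+1) => <-.
by rewrite natrD; ring.
Qed.

Lemma dim_chains_gap_le (X Y : set (set V)) n (B : {fset V}) :
  (forall s, Y s -> ~ X s -> s !=set0 -> s `<=` [set` B]) ->
  (\dim (chains R W Y n) <= \dim (chains R W X n) + #|` B| ^ n.+1)%N.
Proof.
move=> YX; pose D := [set t : tuples W n | [forall i, val (t i) \in B]]%SET.
pose L := [seq orient R t | t <- enum D].
have sub : (chains R W Y n <= chains R W X n + <<L>>)%VS.
  rewrite /chains; apply/span_subvP => _ /mapP[t + ->].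
  rewrite mem_filter => /andP[/andP[tinj /asboolP tY] _].
  have [tX|tX] := pselect (X (support_of t)).
    apply: (subvP (addvSl _ _)); apply/memv_span/map_f.
    by rewrite mem_filter mem_enum tinj andbT; apply/asboolP.
  apply: (subvP (addvSr _ _)); apply/memv_span/map_f.
  rewrite mem_enum inE; apply/forallP => i.
  have := YX _ tY tX (support_neq0 t); apply; by exists i.
apply: leq_trans (dimvS sub) _; apply: leq_trans (dimv_add_leqif _ _).1 _.
rewrite leq_add2l; apply: leq_trans (dim_span _) _.
rewrite size_map -cardE.
pose A := [set x : W | val x \in B]%SET.
have -> : #|D| = #|(ffun_on (mem A) : pred (tuples W n))|.
  apply: eq_card => t; apply/idP/idP => [|/ffun_onP h].
    by rewrite finset.in_set => /forallP h; apply/ffun_onP => i; rewrite finset.in_set.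
  by rewrite finset.in_set; apply/forallP => i; have := h i; rewrite finset.in_set.
rewrite card_ffun_on card_ord leq_exp2r // cardE -(size_map val).
apply: uniq_leq_size; first by rewrite map_inj_uniq ?enum_uniq //; exact: val_inj.
by move=> _ /mapP[x + ->]; rewrite mem_enum inE.
Qed.

(** Killing cycles can only shrink a gap: a cycle of Y which is a chain of X is
a cycle of X. *)
Lemma dim_cycles_gap_le (X Y : set (set V)) n :
  (forall s, X s -> s !=set0 -> Y s) ->
  (\dim (cycles R W Y n) + \dim (chains R W X n) <=
   \dim (chains R W Y n) + \dim (cycles R W X n))%N.
Proof.
move=> XY; apply: (@dim_gap_mono _ _ _ \1%VF).
- by apply/lker0P => a b; rewrite !id_lfunE.
- exact: chains_sub.
- by move=> c; rewrite id_lfunE mem_cycles => /andP[].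
- by move=> c; rewrite id_lfunE !mem_cycles => /andP[_ ->] ->.
Qed.

Lemma cycles_sub X Y n : (forall s, X s -> s !=set0 -> Y s) ->
  (cycles R W X n <= cycles R W Y n)%VS.
Proof.
move=> XY; apply/subvP => c; rewrite !mem_cycles => /andP[cX ->]; rewrite andbT.
by move: c cX; apply/subvP; exact: chains_sub.
Qed.

End ChainMembership.

Section PushForward.
Variables (R : realType) (V V' : choiceType) (W : {fset V}) (W' : {fset V'}).
Variable phi : V -> V'.
Hypotheses (phi_inj : injective phi) (phiW : forall x, x \in W -> phi x \in W').

Definition phiS (x : W) : W' := [` phiW (valP x)]%fset.

Definition push_tuple n (t : tuples W n) : tuples W' n := [ffun j => phiS (t j)].

Lemma push_tuple_inj n : injective (@push_tuple n).
Proof.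
move=> t u /ffunP tu; apply/ffunP => j; have := tu j; rewrite !ffunE.
by move/(congr1 val) => /= /phi_inj /val_inj.
Qed.

Lemma support_push n (t : tuples W n) :
  support_of (push_tuple t) = phi @` support_of t.
Proof.
apply/seteqP; split=> [_ [j _ <-]|_ [_ [j _ <-] <-]].
  by rewrite ffunE /=; exists (val (t j)) => //; exists j.
by exists j => //; rewrite ffunE.
Qed.

Definition push_fun n (c : chain R W n) : chain R W' n :=
  [ffun u => \sum_(t : tuples W n | push_tuple t == u) c t].

Lemma push_fun_linear n : linear (@push_fun n).
Proof.
move=> a c d; apply/ffunP => u; rewrite !ffunE scaler_sumr.
by rewrite -big_split /=; apply: eq_bigr => t _; rewrite !ffunE.
Qed.

HB.instance Definition _ n :=
  GRing.isLinear.Build R (chain R W n) (chain R W' n) *:%R (@push_fun n)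
    (@push_fun_linear n).

Definition push n : 'Hom(chain R W n, chain R W' n) := linfun (@push_fun n).

Lemma push_tupleE n (c : chain R W n) t : push n c (push_tuple t) = c t.
Proof.
rewrite lfunE /= ffunE (big_pred1 t) // => u /=.
by rewrite (inj_eq (@push_tuple_inj n)).
Qed.

Lemma push_out n (c : chain R W n) u : (forall t, push_tuple t != u) ->
  push n c u = 0.
Proof. by move=> h; rewrite lfunE /= ffunE big_pred0 // => t; rewrite (negPf (h t)). Qed.

Lemma push_delta n (t : tuples W n) : push n (delta R t) = delta R (push_tuple t).
Proof.
apply/ffunP => u; rewrite [RHS]ffunE.
have [[v /eqP <-]|h] := pselect (exists v, push_tuple v == u).
  by rewrite push_tupleE ffunE (inj_eq (@push_tuple_inj n)).
rewrite push_out => [|v]; last by apply/negP => vu; apply: h; exists v.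
by case: eqP => // ut; case: h; exists t; rewrite ut.
Qed.

Lemma push_bd n (c : chain R W n.+1) : push n (bd R W n c) = bd R W' n (push n.+1 c).
Proof.
rewrite (chain_expand c) !linear_sum; apply: eq_bigr => t _ /=.
rewrite !linearZ /=; congr (_ *: _).
rewrite push_delta !bd_delta linear_sum; apply: eq_bigr => i _.
rewrite linearZ /= push_delta; congr (_ *: delta R _).
by apply/ffunP => j; rewrite !ffunE.
Qed.

Lemma lker_push n : (lker (push n) == 0)%VS.
Proof.
apply/lker0P => c d /ffunP cd; apply/ffunP => t.
by rewrite -!push_tupleE.
Qed.

Lemma push_tperm n (t : tuples W n) s :
  push_tuple (tperm_by t s) = tperm_by (push_tuple t) s.
Proof. by apply/ffunP => j; rewrite !ffunE. Qed.

Lemma mem_push_chains (X : set (set V)) (X' : set (set V')) n (c : chain R W n) :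
  (forall s, s `<=` [set` W] -> s !=set0 -> X' (phi @` s) <-> X s) ->
  (push n c \in chains R W' X' n) = (c \in chains R W X n).
Proof.
move=> XX'.
have XXt (t : tuples W n) : X' (support_of (push_tuple t)) <-> X (support_of t).
  rewrite support_push; apply: XX'; last exact: support_neq0.
  by move=> _ [i _ <-]; exact: valP.
apply/idP/idP => /chainsP[ac cX]; apply/chainsP; split.
- by move=> t s; rewrite -!push_tupleE push_tperm; exact: ac.
- by move=> t ct; apply/XXt/cX; rewrite push_tupleE.
- move=> u s; have [[t <-]|h] := pselect (exists t, push_tuple t = u).
    by rewrite -push_tperm !push_tupleE ac.
  rewrite !push_out ?mulr0 // => t; apply/eqP => tu; apply: h; first by exists t.
  exists (tperm_by t s^-1%g); rewrite push_tperm tu tperm_byM mulVg.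
  exact: tperm_by1.
- move=> u; have [[t <-]|h] := pselect (exists t, push_tuple t = u).
    by rewrite push_tupleE => /cX /XXt.
  by rewrite push_out ?eqxx // => t; apply/eqP => tu; apply: h; exists t.
Qed.

Lemma is_cycle_push n (c : chain R W n) : is_cycle (push n c) = is_cycle c.
Proof.
case: n c => [//|n] c /=; rewrite -push_bd; apply/eqP/eqP => [|->]; last by rewrite linear0.
by rewrite -[RHS](linear0 (push n)) => /lker0P; apply; exact: lker_push.
Qed.

Lemma mem_push_cycles (X : set (set V)) (X' : set (set V')) n (c : chain R W n) :
  (forall s, s `<=` [set` W] -> s !=set0 -> X' (phi @` s) <-> X s) ->
  (push n c \in cycles R W' X' n) = (c \in cycles R W X n).
Proof. by move=> XX'; rewrite !mem_cycles is_cycle_push (mem_push_chains _ XX'). Qed.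

Lemma dim_push_le (X : set (set V)) (X' : set (set V')) n :
  (forall s, s `<=` [set` W] -> s !=set0 -> X' (phi @` s) <-> X s) ->
  (\dim (chains R W X n) <= \dim (chains R W' X' n))%N /\
  (\dim (cycles R W X n) <= \dim (cycles R W' X' n))%N.
Proof.
move=> XX'; have dimi (A : {vspace chain R W n}) : \dim (push n @: A) = \dim A.
  by apply: limg_dim_eq; have /eqP -> := lker_push n; rewrite capv0.
split; rewrite -dimi; apply: dimvS; apply/subvP => _ /memv_imgP[c cX ->].
  by rewrite (mem_push_chains _ XX').
by rewrite (mem_push_cycles _ XX').
Qed.

End PushForward.

(** A chain of X1 which is already a chain of Y0 is one of X0, so the rank created by
enlarging X0 to X1 is not lost in the passage from Y0 to Y1. *)
Lemma dim_gap_widen (R : realType) (V : choiceType) (W W' : {fset V})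
    (X0 X1 Y0 Y1 : set (set V)) n :
  {subset W <= W'} ->
  (forall s, Y0 s -> s !=set0 -> Y1 s) -> (forall s, X1 s -> s !=set0 -> Y1 s) ->
  (forall s, X1 s -> Y0 s -> s !=set0 -> X0 s) ->
  (\dim (chains R W X1 n) + \dim (chains R W' Y0 n) <=
   \dim (chains R W' Y1 n) + \dim (chains R W X0 n))%N /\
  (\dim (cycles R W X1 n) + \dim (cycles R W' Y0 n) <=
   \dim (cycles R W' Y1 n) + \dim (cycles R W X0 n))%N.
Proof.
move=> WW' Y01 XY1 XY0.
have idi : injective (@id V) by move=> x y.
have XX' (X : set (set V)) s : s `<=` [set` W] -> s !=set0 -> X (id @` s) <-> X s.
  by rewrite image_id.
split; apply: (@dim_gap_mono _ _ _ (push R WW' n)).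
- exact: lker_push.
- exact: chains_sub.
- move=> c cX; apply: (subvP (chains_sub _ _ _ XY1)).
  by rewrite (mem_push_chains _ _ _ (XX' X1)).
- move=> c cX; rewrite -(mem_push_chains idi WW' c (XX' X1)) in cX * => cY.
  rewrite -(mem_push_chains idi WW' c (XX' X0)).
  exact: chains_cap XY0 _ _.
- exact: lker_push.
- exact: cycles_sub.
- move=> c cX; apply: (subvP (cycles_sub _ _ _ XY1)).
  by rewrite (mem_push_cycles _ _ _ (XX' X1)).
- move=> c; rewrite -(mem_push_cycles idi WW' c (XX' X1)) !mem_cycles.
  move=> /andP[cX cc] /andP[cY _].
  rewrite -(is_cycle_push idi WW') cc andbT -(mem_push_chains idi WW' c (XX' X0)).
  exact: chains_cap XY0 cX cY.
Qed.

(** * Cayley graph geometry *)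

Section Cayley.
Variables (Gamma : groupType) (S : {fset Gamma}).
Hypothesis S_gen : symmetric_generating S.
Implicit Types (g h x y : Gamma) (e : edge S) (W : {fset Gamma}) (w : edge S -> bool).

Definition tr h W : {fset Gamma} := [fset (h * x)%g | x in W]%fset.

Lemma mem_tr h W x : (x \in tr h W) = ((h^-1 * x)%g \in W).
Proof.
apply/imfsetP/idP => [[y yW ->]|xW]; first by rewrite mulKg.
by exists (h^-1 * x)%g; rewrite ?mulKVg.
Qed.

Lemma tr_mul g h W : tr g (tr h W) = tr (g * h)%g W.
Proof. by apply/fsetP => x; rewrite !mem_tr invMg mulgA. Qed.

Lemma tr1 W : tr 1%g W = W.
Proof. by apply/fsetP => x; rewrite mem_tr invg1 mul1g. Qed.

Lemma edge_adj x y : edges S [set x; y] -> (x^-1 * y)%g \in S.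
Proof.
have [Ssym S1 _] := S_gen; move=> [g [s [sS e]]].
have gs : g <> (g * s)%g.
  move=> /(congr1 (fun z => g^-1 * z)%g); rewrite mulVg mulKg => s1.
  by move: S1; rewrite s1 sS.
have hx : [set g; (g * s)%g] x by rewrite -e; left.
have hy : [set g; (g * s)%g] y by rewrite -e; right.
have hg : [set x; y] g by rewrite e; left.
have hgs : [set x; y] (g * s)%g by rewrite e; right.
case: hx => hx; case: hy => hy; move: hg hgs; rewrite hx hy.
- by move=> _ [] /esym.
- by rewrite mulKg.
- by rewrite invMg mulgKV => _ _; exact: Ssym.
- by move=> [].
Qed.

Lemma edge_mul x s : s \in S -> edges S [set x; (x * s)%g].
Proof. by move=> sS; exists x, s. Qed.

Fixpoint ball (k : nat) : {fset Gamma} :=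
  if k is k'.+1 then (ball k' `|` [fset (b * s)%g | b in ball k', s in S])%fset
  else [fset 1%g]%fset.

Lemma ball_step k b s : b \in ball k -> s \in S -> (b * s)%g \in ball k.+1.
Proof.
by move=> bk sS; rewrite /= inE; apply/orP; right; apply/imfset2P; exists b => //; exists s.
Qed.

Lemma ball_sub k l : (k <= l)%N -> {subset ball k <= ball l}.
Proof.
move=> /subnK <-; elim: (l - k)%N => [//|j IH] x /IH xk.
by rewrite addSn /= inE xk.
Qed.

Lemma walk_ball x y l : walk (cayley S) x y l -> (x^-1 * y)%g \in ball l.
Proof.
move=> [p [pp py ps]]; rewrite -py -ps {py ps y l}.
elim/last_ind: p pp => [|p z IH] /=; first by rewrite mulVg inE.
rewrite rcons_path last_rcons size_rcons => /andP[/IH h /asboolP /edge_adj hz].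
by have := ball_step h hz; rewrite mulgA mulgK.
Qed.

Lemma cayley_connected x y : exists l, walk (cayley S) x y l.
Proof.
have [_ _ /(_ (x^-1 * y)%g) [l lS e]] := S_gen.
suff H z : exists p, path (adj (cayley S)) z p /\ last z p = (z * \prod_(s <- l) s)%g.
  by have [p [pp pl]] := H x; exists (size p), p; rewrite pl -e mulKVg.
elim: l lS z {e} => [|s l IH] lS z; first by exists [::]; rewrite big_nil mulg1.
have [|p [pp pl]] := IH _ (z * s)%g; first by move=> t tl; apply: lS; rewrite inE tl orbT.
exists ((z * s)%g :: p); rewrite /= pp pl big_cons mulgA andbT; split=> //.
by apply/asboolP; apply: edge_mul; apply: lS; rewrite mem_head.
Qed.

Lemma gdist_ball x y k : (gdist S x y <= k)%N -> (x^-1 * y)%g \in ball k.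
Proof.
rewrite /gdist; case: xgetP => [l _ [wl _] lk|no _].
  by apply: ball_sub lk _ _; exact: walk_ball.
have [l wl] := cayley_connected x y.
have ex : exists l, `[< walk (cayley S) x y l >] by exists l; apply/asboolP.
case: (no (ex_minn ex)); case: ex_minnP => j /asboolP wj jmin.
by split=> // i wi; apply: jmin; apply/asboolP.
Qed.

Lemma edge_val e : exists x s, s \in S /\ val e = [set x; (x * s)%g].
Proof. by have /set_mem := valP e. Qed.

Lemma edge_inj e f : val e = val f -> e = f.
Proof. exact: val_inj. Qed.

Lemma eactE h e : val (eact h e) = [set (h * x)%g | x in val e].
Proof. by []. Qed.

Lemma eact_mul g h e : eact g (eact h e) = eact (g * h)%g e.
Proof.
apply: edge_inj; rewrite !eactE; apply/seteqP; split.
  by move=> _ [_ [x ex <-] <-]; exists x => //; rewrite mulgA.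
by move=> _ [x ex <-]; exists (h * x)%g; [exists x|rewrite mulgA].
Qed.

Lemma eact1 e : eact 1%g e = e.
Proof.
apply: edge_inj; rewrite eactE; apply/seteqP; split; first by move=> _ [x ex <-]; rewrite mul1g.
by move=> x ex; exists x; rewrite ?mul1g.
Qed.

Lemma eactK h : cancel (@eact _ S h) (@eact _ S (h^-1)%g).
Proof. by move=> e; rewrite eact_mul mulVg eact1. Qed.

Lemma eactKV h : cancel (@eact _ S (h^-1)%g) (@eact _ S h).
Proof. by move=> e; rewrite eact_mul mulgV eact1. Qed.

Definition edges_in W : set (edge S) := [set e | val e `<=` [set` W]].

Lemma edges_in_sub W W' : {subset W <= W'} -> edges_in W `<=` edges_in W'.
Proof. by move=> WW' e eW x /eW /= /WW'. Qed.

Lemma edges_in_tr h W e : edges_in (tr h W) (eact h e) <-> edges_in W e.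
Proof.
split=> [H x ex|H _ [x ex <-]] /=; last by rewrite mem_tr mulKg; exact: H.
have /H : val (eact h e) (h * x)%g by exists x.
by rewrite /= mem_tr mulKg.
Qed.

End Cayley.

(** * Local rules and stabilizing functionals *)

Section Stabilizing.
Variables (R : realType) (Gamma : groupType) (S : {fset Gamma}).
Implicit Types (g h x y : Gamma) (e : edge S) (W : {fset Gamma}) (w : edge S -> bool).

(** A simplex created by the edge e has its vertices at points x b, and a subgraph
confining it in a larger window lies in the points x b c; these must be in W for
the effect of e to be decided within W. *)
Definition deep (k : nat) e W := exists2 x, val e x &
  forall b c, b \in ball S k -> c \in ball S k -> (x * b * c)%g \in W.

(** What the limit theorem uses of the dimensions of chain and cycle spaces.
Monotonicity in the window makes the responses to opening an edge converge, and
reduces their L1 distances to differences of means. *)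
Record stabilizing (k : nat) (C : R) (f : {fset Gamma} -> (edge S -> bool) -> R) : Prop :=
  Stabilizing {
    stab_depends : forall W, depends (edges_in W) (f W);
    stab_bound : forall e W w, 0 <= gap e (f W) w <= C;
    stab_mono : forall e W W' w, deep k e W -> {subset W <= W'} ->
      gap e (f W) w <= gap e (f W') w;
    stab_tr : forall h W w, f (tr h W) w = f W (w \o eact h) }.

Lemma stabilizingD k C C' f f' : stabilizing k C f -> stabilizing k C' f' ->
  stabilizing k (C + C') (fun W w => f W w + f' W w).
Proof.
move=> [d b m t] [d' b' m' t'].
have gapD e W w : gap e (fun w => f W w + f' W w) w = gap e (f W) w + gap e (f' W) w.
  by rewrite /gap; ring.
split.
- by move=> W w w' ww'; rewrite (d W w w' ww') (d' W w w' ww').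
- by move=> e W w; rewrite gapD; have := b e W w; have := b' e W w; lra.
- by move=> e W W' w dW WW'; rewrite !gapD lerD // (m, m').
- by move=> h W w; rewrite t t'.
Qed.

Variables (Delta : graph Gamma -> set (set Gamma)).
Hypothesis S_gen : symmetric_generating S.
Hypothesis Delta_complex : graph_complex S Delta.
Hypothesis Delta_mono : monotone_complex S Delta.
Variable k : nat.
Hypothesis Delta_confined : forall K s, is_subgraph S K -> Delta K s ->
    exists L, [/\ is_subgraph S L, subgraph_le L K, vset L !=set0,
      forall u v, vset L u -> vset L v -> (gdist S u v <= k)%N &
      Delta L s].

Definition openX W w : set (set Gamma) := Delta (open_subgraph w [set` W]).

Lemma open_is_subgraph W w : is_subgraph S (open_subgraph w [set` W]).
Proof.
split=> [e [_ [f <- _]]|e [eW _] //].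
exact: set_mem (valP f).
Qed.

Lemma openX_le W W' w w' : {subset W <= W'} ->
  (forall e, edges_in W e -> w e -> w' e) -> openX W w `<=` openX W' w'.
Proof.
move=> WW' ww'; apply: Delta_mono; try exact: open_is_subgraph.
split=> [x /WW' //|e [eW [f fe wf]]]; split; first by move=> x /eW /= /WW'.
by exists f => //; apply: ww' => //; rewrite /edges_in /= fe.
Qed.

Lemma openX_depends W w w' : (forall e, edges_in W e -> w e = w' e) ->
  openX W w = openX W w'.
Proof. by move=> ww'; apply/seteqP; split; apply: openX_le => // e /ww' ->. Qed.

Lemma openX_closed W w s t : openX W w s -> t `<=` s -> openX W w t.
Proof. exact: (Delta_complex.1 _ (open_is_subgraph W w)).2. Qed.

Lemma openX_gap_sub e W w : openX W (upd w e false) `<=` openX W (upd w e true).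
Proof. by apply: openX_le => // f _; rewrite /upd; case: eqP. Qed.

(** A simplex created by opening e needs e, so by confinement it lies in a
fixed neighbourhood of e. *)
Lemma openX_new e W w s x : openX W (upd w e true) s -> ~ openX W (upd w e false) s ->
  val e x -> forall v, s v -> (x^-1 * v)%g \in ball S k.
Proof.
move=> s1 s0 ex v sv.
have [L [Lsub [LW LE] L0 Lk Ls]] := Delta_confined (open_is_subgraph _ _) s1.
have eL : eset L (val e).
  apply: contrapT => neL; apply: s0; apply: Delta_mono Ls => //; first exact: open_is_subgraph.
  split=> // a aL; have [aW [f fa wf]] := LE a aL; split=> //; exists f => //.
  move: wf; rewrite /upd; case: eqP => // fe _.
  by case: neL; rewrite -fe fa.
apply: (gdist_ball S_gen); apply: Lk; first exact: (Lsub.2 _ eL).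
exact: (Delta_complex.1 _ Lsub).1 _ Ls _ sv.
Qed.

(** If e were needed to create the simplex in W, its vertices would be close to e. A
subgraph confining it in the larger window, with e closed, is then close to e,
hence contained in W, and it yields the simplex in W without e. *)
Lemma openX_local e W W' w s : deep k e W -> {subset W <= W'} ->
  openX W (upd w e true) s -> openX W' (upd w e false) s -> s !=set0 ->
  openX W (upd w e false) s.
Proof.
move=> [x ex dW] WW' s1 s0' [v sv]; apply: contrapT => s0.
have xv := openX_new s1 s0 ex sv.
apply: s0; have [L [Lsub [LW LE] L0 Lk Ls]] := Delta_confined (open_is_subgraph _ _) s0'.
have vL : vset L v by exact: (Delta_complex.1 _ Lsub).1 _ Ls _ sv.
have LinW u : vset L u -> u \in W.
  move=> uL; have := dW _ _ xv (gdist_ball S_gen (Lk _ _ vL uL)).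
  by rewrite mulKVg mulKVg.
apply: (Delta_mono Lsub (open_is_subgraph _ _) _ Ls).
split; first by move=> u /LinW.
move=> a aL; have [aW [f fa wf]] := LE a aL; split; last by exists f.
by move=> u au; apply: LinW; exact: (Lsub.2 a aL).
Qed.

Lemma mulg_aut h : graph_aut S (fun x => (h * x)%g).
Proof.
split; first by exists (fun x => (h^-1 * x)%g) => x; rewrite ?mulKg ?mulKVg.
have H a x y : edges S [set x; y] -> edges S [set (a * x)%g; (a * y)%g].
  move=> [g [s [sS e]]]; exists (a * g)%g, s; split=> //.
  rewrite (_ : [set _; _] = [set (a * z)%g | z in [set x; y]]); last first.
    by rewrite image_setU !image_set1.
  by rewrite e image_setU !image_set1 mulgA.
move=> x y; split=> [/(H h^-1%g)|]; last exact: H.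
by rewrite !mulKg.
Qed.

Lemma openX_tr h W w s : openX (tr h W) w [set (h * x)%g | x in s] <->
  openX W (w \o eact h) s.
Proof.
have -> : openX (tr h W) w = [set [set (h * x)%g | x in s] | s in openX W (w \o eact h)].
  rewrite /openX -(Delta_complex.2 _ _ (mulg_aut h) (open_is_subgraph _ _)).
  congr Delta; rewrite /map_graph /open_subgraph /=; congr Graph; apply/seteqP; split.
  - by move=> x /=; rewrite mem_tr => xW; exists (h^-1 * x)%g; rewrite ?mulKVg.
  - by move=> _ [x xW <-]; rewrite /= mem_tr mulKg.
  - move=> e [eW [f fe wf]]; exists (val (eact h^-1%g f)); last first.
      by rewrite -eactE eactKV.
    split; last by exists (eact h^-1%g f); rewrite //= eactKV.
    by apply/(edges_in_tr h); rewrite eactKV /edges_in /= fe.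
  - move=> _ [a [aW [f fa wf]] <-]; split; last by exists (eact h f) => //; rewrite -fa.
    by move=> _ [x ax <-]; rewrite /= mem_tr mulKg; exact: aW.
split=> [[t tX]|sX]; last by exists s.
move=> e; suff <- : t = s by [].
apply/seteqP; split=> x.
  move=> xt; have : [set (h * z)%g | z in s] (h * x)%g by rewrite -e; exists x.
  by move=> [y ys /mulgI <-].
move=> xs; have : [set (h * z)%g | z in t] (h * x)%g by rewrite e; exists x.
by move=> [y yt /mulgI <-].
Qed.

Definition dimC n W w : R := (\dim (chains R W (openX W w) n))%:R.
Definition dimZ n W w : R := (\dim (cycles R W (openX W w) n))%:R.

Lemma betti_openX n W w :
  (betti R W (openX W w) n)%:R = dimZ n W w + dimZ n.+1 W w - dimC n.+1 W w :> R.
Proof. by apply: betti_dim => s t; exact: openX_closed. Qed.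

Lemma dim_tr_le h n W w : dimC n W (w \o eact h) <= dimC n (tr h W) w /\
  dimZ n W (w \o eact h) <= dimZ n (tr h W) w.
Proof.
rewrite /dimC /dimZ !ler_nat.
have hW x : x \in W -> (h * x)%g \in tr h W by rewrite mem_tr mulKg.
apply: (dim_push_le R (@mulgI _ h) hW) => s _ _; exact: openX_tr.
Qed.

Lemma dim_tr h n W w : dimC n (tr h W) w = dimC n W (w \o eact h) /\
  dimZ n (tr h W) w = dimZ n W (w \o eact h).
Proof.
have [a b] := dim_tr_le h n W w.
have [] := dim_tr_le h^-1%g n (tr h W) (w \o eact h).
rewrite tr_mul mulVg tr1 -compA (_ : eact h \o eact h^-1%g = id); last first.
  by apply/funext => e /=; rewrite eactKV.
by move=> c d; split; apply/eqP; rewrite eq_le ?a ?b ?c ?d.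
Qed.

Let C n : R := (#|` ball S k| ^ n.+1)%:R.

Lemma dimC_gap n e W w : 0 <= gap e (dimC n W) w <= C n.
Proof.
rewrite /gap /dimC subr_ge0 ler_nat dimvS /=; last first.
  by apply: chains_sub => s + _; exact: openX_gap_sub.
have [x [s [_ es]]] := edge_val e.
have ex : val e x by rewrite es; left.
rewrite lerBlDl -natrD ler_nat.
have hB : #|` tr x (ball S k)| = #|` ball S k|.
  by rewrite card_imfset //=; exact: mulgI.
rewrite -hB; apply: dim_chains_gap_le => t t1 t0 _ v tv /=.
by rewrite mem_tr; exact: openX_new t1 t0 ex _ tv.
Qed.

Lemma stabilizing_dimC n : stabilizing k (C n) (dimC n).
Proof.
split.
- by move=> W w w' ww'; rewrite /dimC (openX_depends ww').
- exact: dimC_gap.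
- move=> e W W' w dW WW'; rewrite /gap /dimC lerBrDr addrAC lerBlDr -!natrD ler_nat.
  apply: (dim_gap_widen R n WW' _ _ _).1 => [s + _|s + _|s s1 s0 sne].
  + exact: openX_gap_sub.
  + exact: openX_le.
  + exact: openX_local dW WW' s1 s0 sne.
- by move=> h W w; case: (dim_tr h n W w).
Qed.

Lemma stabilizing_dimZ n : stabilizing k (C n) (dimZ n).
Proof.
split.
- by move=> W w w' ww'; rewrite /dimZ (openX_depends ww').
- move=> e W w; have /andP[_ c] := dimC_gap n e W w; apply/andP; split.
    rewrite /gap /dimZ subr_ge0 ler_nat dimvS //.
    by apply: cycles_sub => s + _; exact: openX_gap_sub.
  apply: le_trans c; rewrite /gap /dimC /dimZ lerBrDr addrAC lerBlDr -!natrD ler_nat.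
  by apply: dim_cycles_gap_le => s + _; exact: openX_gap_sub.
- move=> e W W' w dW WW'; rewrite /gap /dimZ lerBrDr addrAC lerBlDr -!natrD ler_nat.
  apply: (dim_gap_widen R n WW' _ _ _).2 => [s + _|s + _|s s1 s0 sne].
  + exact: openX_gap_sub.
  + exact: openX_le.
  + exact: openX_local dW WW' s1 s0 sne.
- by move=> h W w; case: (dim_tr h n W w).
Qed.

End Stabilizing.

(** * Densities along a Folner sequence *)

Lemma cvg0D (R : realType) (f g : nat -> R) : f @ \oo --> (0 : R) ->
  g @ \oo --> (0 : R) -> (fun r => f r + g r) @ \oo --> (0 : R).
Proof.
move=> f0 g0; suff : (fun r => f r + g r) @ \oo --> (0 + 0 : R) by rewrite addr0.
exact: cvgD.
Qed.

Section Counting.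
Variables (R : realType) (Gamma : groupType) (S : {fset Gamma}).
Hypothesis S_gen : symmetric_generating S.
Implicit Types (g h x y u : Gamma) (A W : {fset Gamma}).

Definition exits A g : {fset Gamma} := [fset x in A | (x * g)%g \notin A]%fset.

(** A point which leaves A along a word leaves it at some letter, from a boundary
point. *)
Lemma card_exits A (l : seq Gamma) : {subset l <= S} ->
  (#|` exits A (\prod_(s <- l) s)%g| <= size l * #|` boundary S A|)%N.
Proof.
elim/last_ind: l => [|l s IH] lS.
  rewrite big_nil mul0n leqn0 cardfs_eq0; apply/eqP/fsetP => x.
  by rewrite !inE mulg1; case: (x \in A).
have sS : s \in S by apply: lS; rewrite mem_rcons mem_head.
have lS' : {subset l <= S} by move=> t tl; apply: lS; rewrite mem_rcons inE tl orbT.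
have {}IH := IH lS'.
rewrite big_rcons size_rcons mulSn /=; set g := (\prod_(t <- l) t)%g in IH *.
have sub : (exits A (g * s)%g `<=` exits A g `|` [fset (y * g^-1)%g | y in boundary S A])%fset.
  apply/fsubsetP => x; rewrite !inE /= => /andP[xA xgs].
  rewrite xA /=; case: (boolP ((x * g)%g \in A)) => //= xg.
  apply/imfsetP; exists (x * g)%g; last by rewrite mulgK.
  rewrite !inE /= xg /=; apply/asboolP; exists (x * g * s)%g; split.
    by rewrite -mulgA.
  exact: edge_mul.
apply: leq_trans (fsubset_leq_card sub) _.
apply: leq_trans (leq_card_fsetU _ _) _; rewrite addnC leq_add //.
  exact: leq_imfset_card.
Qed.

Variable A : nat -> {fset Gamma}.
Hypothesis A_folner : folner R S A.

Let a r : R := #|` A r|%:R.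

Lemma folner_size_gt0 r : 0 < a r.
Proof. by rewrite /a ltr0n cardfs_gt0; exact: A_folner.1. Qed.

Lemma exits_density g : (fun r => #|` exits (A r) g|%:R / a r) @ \oo --> (0 : R).
Proof.
have [_ _ /(_ g)[l lS ->]] := S_gen.
have c0 : (fun r => (size l)%:R * (#|` boundary S (A r)|%:R / a r)) @ \oo --> (0 : R).
  rewrite -(mulr0 (size l)%:R); apply: cvgM; [exact: cvg_cst|exact: A_folner.2].
apply: (squeeze_cvgr _ (@cvg_cst R 0 _ _ _) c0); apply: nearW => r.
rewrite divr_ge0 ?ler0n //= mulrA ler_pM2r ?invr_gt0 ?folner_size_gt0 //.
by rewrite -natrM ler_nat card_exits.
Qed.

Variables (H : set Gamma) (m : nat).
Hypothesis H_subgroup : subgroup H.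
Hypothesis H_index : has_index H m.

Lemma subgroup1 : H 1%g.
Proof. by have [/set_mem] := H_subgroup. Qed.

Lemma subgroupMV g h : H g -> H h -> H (g * h^-1)%g.
Proof. by move=> Hg Hh; have [_ /(_ g h)] := H_subgroup; rewrite !inE; apply. Qed.

Lemma subgroupV h : H h -> H h^-1%g.
Proof. by move=> Hh; rewrite -[_^-1%g]mul1g; apply: subgroupMV => //; exact: subgroup1. Qed.

Lemma subgroupM g h : H g -> H h -> H (g * h)%g.
Proof. by move=> Hg Hh; rewrite -[h]invgK; apply: subgroupMV => //; exact: subgroupV. Qed.

Definition in_coset u : pred Gamma := fun x => `[< H (x * u^-1)%g >].

Lemma right_transversal : exists2 us : seq Gamma, size us = m &
  forall x, count (in_coset^~ x) us = 1%N.
Proof.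
have /card_set_bijP[f [fL finj fsurj]] : (`I_m #= left_cosets H)%card.
  by rewrite card_eq_sym.
have /choice[g gP] (i : nat) : exists y : Gamma, (i < m)%N ->
    f i = [set (y * h)%g | h in H].
  have [im|_] := boolP (i < m)%N; last by exists 1%g.
  by have [y _ <-] := fL i im; exists y.
exists [seq (g i)^-1%g | i <- iota 0 m]; first by rewrite size_map size_iota.
move=> x.
have [i /= im fi] : (f @` `I_m) [set (x^-1 * h)%g | h in H] by apply: fsurj; exists x^-1%g.
rewrite count_map -(@eq_in_count _ (pred1 i)).
  by rewrite count_uniq_mem ?iota_uniq // mem_iota im.
move=> j; rewrite mem_iota add0n => /andP[_ jm] /=; rewrite /in_coset invgK.
apply/eqP/asboolP => [->|Hxg].
  have : [set (g i * h)%g | h in H] (g i) by exists 1%g; [exact: subgroup1|rewrite mulg1].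
  by rewrite -gP // fi => -[h Hh <-]; rewrite mulKVg.
apply: finj; rewrite ?inE //= fi gP //; apply/seteqP; split=> _ [h Hh <-].
  exists (x * g j * h)%g; first exact: subgroupM.
  by rewrite !mulgA mulVg mul1g.
exists ((x * g j)^-1 * h)%g; first by apply: subgroupM => //; exact: subgroupV.
by rewrite invMg !mulgA mulgV mul1g.
Qed.

Definition coset_part W u : {fset Gamma} := [fset x in W | in_coset u x]%fset.

Lemma coset_part_le W u v :
  (#|` coset_part W u| <= #|` coset_part W v| + #|` exits W (u^-1 * v)%g|)%N.
Proof.
pose t := (u^-1 * v)%g.
have sub : (coset_part W u `<=` [fset (y * t^-1)%g | y in coset_part W v] `|` exits W t)%fset.
  apply/fsubsetP => x; rewrite !inE /= => /andP[xW xu]; rewrite xW /=.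
  case: (boolP ((x * t)%g \in W)) => xt /=; last by rewrite orbT.
  rewrite orbF; apply/imfsetP; exists (x * t)%g; last by rewrite mulgK.
  by rewrite !inE /= xt /in_coset /t mulgA mulgK.
apply: leq_trans (fsubset_leq_card sub) _; apply: leq_trans (leq_card_fsetU _ _) _.
by rewrite leq_add2r leq_imfset_card.
Qed.

Lemma card_fset_filter (T : choiceType) (B : {fset T}) (P : pred T) :
  #|` [fset x in B | P x]%fset| = count P B.
Proof.
rewrite -size_filter; apply: perm_size; apply: uniq_perm.
- exact: fset_uniq.
- by rewrite filter_uniq // fset_uniq.
- by move=> x; rewrite mem_filter !inE andbC.
Qed.

Lemma sum_coset_part W (us : seq Gamma) :
  (forall x, count (in_coset^~ x) us = 1%N) ->
  (\sum_(u <- us) #|` coset_part W u| = #|` W|)%N.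
Proof.
move=> usP; under eq_bigr => u _ do rewrite card_fset_filter -sum1_count.
rewrite (exchange_big_dep predT) //= -[RHS]sum1_size; apply: eq_bigr => x _.
by rewrite sum1_count usP.
Qed.

(** Right translation by u^-1 v carries the part of A_r in the coset of u into the
part in the coset of v, up to few points; so the m cosets have asymptotically
equal shares. *)
Lemma coset_density u : (fun r => #|` coset_part (A r) u|%:R / a r) @ \oo --> (m%:R^-1 : R).
Proof.
have [us us_m usP] := right_transversal.
pose E r : R := \sum_(v <- us)
  (#|` exits (A r) (u^-1 * v)%g|%:R / a r + #|` exits (A r) (v^-1 * u)%g|%:R / a r).
have E0 : E @ \oo --> (0 : R).
  rewrite /E; elim: us {us_m usP E} => [|v us IH].
    by under eq_fun do rewrite big_nil; exact: cvg_cst.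
  under eq_fun do rewrite big_cons.
  apply: cvg0D; last exact: IH.
  by apply: cvg0D; exact: exits_density.
have m0 : 0 < m%:R :> R.
  by rewrite ltr0n -us_m -has_predT; have := usP 1%g; case: (us).
have key r : `|m%:R * (#|` coset_part (A r) u|%:R / a r) - 1| <= E r.
  have a0 := folner_size_gt0 r.
  have e1 : \sum_(v <- us) #|` coset_part (A r) v|%:R / a r = 1.
    by rewrite -mulr_suml -natr_sum sum_coset_part // divff // gt_eqF.
  have e2 : m%:R * (#|` coset_part (A r) u|%:R / a r) =
      \sum_(v <- us) #|` coset_part (A r) u|%:R / a r.
    by rewrite big_const_seq count_predT us_m iter_addr_0 mulr_natl.
  rewrite e2 -[X in _ - X]e1 -sumrB; apply: le_trans (ler_norm_sum _ _ _) _; apply: ler_sum => v _.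
  have h1 := coset_part_le (A r) u v; have h2 := coset_part_le (A r) v u.
  rewrite -mulrBl normrM (@gtr0_norm _ (a r)^-1) ?invr_gt0 // -mulrDl.
  rewrite ler_pM2r ?invr_gt0 // ler_norml lerBrDr lerBlDr.
  rewrite -(ler_nat R) natrD in h1; rewrite -(ler_nat R) natrD in h2.
  have p1 : 0 <= #|` exits (A r) (u^-1 * v)%g|%:R :> R by rewrite ler0n.
  have p2 : 0 <= #|` exits (A r) (v^-1 * u)%g|%:R :> R by rewrite ler0n.
  lra.
have c1 : (fun r => m%:R * (#|` coset_part (A r) u|%:R / a r)) @ \oo --> (1 : R).
  apply/cvgrPdist_le => e e0; have /cvgr0Pnorm_le/(_ e e0) := E0.
  apply: filterS => r Er; rewrite distrC; apply: le_trans (key r) _.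
  exact: le_trans (ler_norm _) Er.
rewrite (_ : (fun r => _) = (fun r => m%:R^-1 * (m%:R * (#|` coset_part (A r) u|%:R / a r)))).
  set F := (fun r => _); suff : F @ \oo --> (m%:R^-1 * 1 : R) by rewrite mulr1.
  by apply: cvgM => //; exact: cvg_cst.
by apply/funext => r; rewrite mulrA mulVf ?mul1r // gt_eqF.
Qed.

(** The translates hD, h in H, contained in W, recorded by their point h x. *)
Definition pattern_part W (D : {fset Gamma}) x : {fset Gamma} :=
  [fset y in W | in_coset x y &&
     all (fun d => (y * (x^-1 * d))%g \in W) D]%fset.

Lemma pattern_part_ge W D x : (#|` coset_part W x| <= #|` pattern_part W D x| +
  \sum_(d <- D) #|` exits W (x^-1 * d)%g|)%N.
Proof.
rewrite !card_fset_filter.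
have -> : (\sum_(d <- D) #|` exits W (x^-1 * d)%g| =
    \sum_(y <- W) count (fun d => (y * (x^-1 * d))%g \notin W) D)%N.
  under eq_bigr => d _ do rewrite card_fset_filter -sum1_count.
  rewrite (exchange_big_dep predT) //=; apply: eq_bigr => y _.
  by rewrite sum1_count.
rewrite -!sum1_count big_mkcond [X in (_ <= X + _)%N]big_mkcond -big_split /=.
apply: leq_sum => y _; case: (in_coset x y) => //=.
by case: (boolP (all _ D)) => //; rewrite -has_predC has_count.
Qed.

Lemma pattern_density D x :
  (fun r => #|` pattern_part (A r) D x|%:R / a r) @ \oo --> (m%:R^-1 : R).
Proof.
pose E r : R := \sum_(d <- D) #|` exits (A r) (x^-1 * d)%g|%:R / a r.
have E0 : E @ \oo --> (0 : R).
  rewrite /E; elim: (D : seq _) {E} => [|d ds IH].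
    by under eq_fun do rewrite big_nil; exact: cvg_cst.
  under eq_fun do rewrite big_cons.
  by apply: cvg0D; [exact: exits_density|exact: IH].
have lo : (fun r => #|` coset_part (A r) x|%:R / a r - E r) @ \oo --> (m%:R^-1 : R).
  set F := (fun r => _); suff : F @ \oo --> (m%:R^-1 - 0 : R) by rewrite subr0.
  by apply: cvgB => //; exact: coset_density.
apply: (squeeze_cvgr _ lo (coset_density x)); apply: nearW => r.
have a0 := folner_size_gt0 r.
rewrite /E -mulr_suml -mulrBl !ler_pM2r ?invr_gt0 // lerBlDr -natr_sum -natrD !ler_nat.
rewrite pattern_part_ge /=; apply: fsubset_leq_card; apply/fsubsetP => y.
by rewrite !inE /= => /and3P[-> ->].
Qed.

End Counting.

(** * Edge orbits and an invariant order *)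

Section Orbits.
Variables (Gamma : groupType) (S : {fset Gamma}) (H : set Gamma) (m : nat).
Hypothesis H_subgroup : subgroup H.
Hypothesis H_index : has_index H m.
Hypothesis H_left_orderable : left_orderable H.
Implicit Types (g h x y : Gamma) (e f : edge S).

Let H1 := subgroup1 H_subgroup.
Let HM := subgroupM H_subgroup.
Let HV := subgroupV H_subgroup.

(** A left-ordered group is torsion free, hence no nontrivial element can
reverse an edge: the action on edges is free. *)
Lemma eact_free h e : H h -> eact h e = e -> h = 1%g.
Proof.
have [lt [irr tr tot inv]] := H_left_orderable.
move=> Hh /(congr1 val) he; have [x [s [sS es]]] := edge_val e.
have sq1 : (h * h)%g = 1%g -> h = 1%g.
  move=> hh; have [h1|//|h1] := tot _ _ H1 Hh.
    have := inv _ _ _ H1 Hh Hh h1; rewrite mulg1 hh => h2.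
    by case: (irr _ H1); exact: tr h1 h2.
  have := inv _ _ _ Hh H1 Hh h1; rewrite mulg1 hh => h2.
  by case: (irr _ H1); exact: tr h2 h1.
have : val (eact h e) (h * x)%g by exists x => //; rewrite es; left.
rewrite he es => -[hx|hx].
  by apply: (mulIg x); rewrite mul1g.
have : val (eact h e) (h * (x * s))%g by exists (x * s)%g => //; rewrite es; right.
rewrite he es => -[hy|hy].
  apply: sq1; apply: (mulIg x); by rewrite mul1g -mulgA hx hy.
by apply: (mulIg (x * s)%g); rewrite mul1g.
Qed.

Lemma eact_free2 g h e : H g -> H h -> eact g e = eact h e -> g = h.
Proof.
move=> Hg Hh e1; apply: (mulgI g^-1%g); rewrite mulVg; apply/esym.
apply: (@eact_free _ e); first by apply: HM => //; exact: HV.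
by rewrite -eact_mul -e1 eact_mul mulVg eact1.
Qed.

Let orb e f := exists2 h, H h & e = eact h f.

Let orb_sym e f : orb e f -> orb f e.
Proof. by move=> [h Hh ->]; exists h^-1%g; [exact: HV|rewrite eactK]. Qed.

Let orb_trans e f e' : orb e f -> orb f e' -> orb e e'.
Proof. by move=> [h Hh ->] [k Hk ->]; exists (h * k)%g; [exact: HM|rewrite eact_mul]. Qed.

Lemma finite_orbits : exists F0 : seq (edge S), forall e, exists2 f, f \in F0 & orb e f.
Proof.
have [us _ usP] := right_transversal H_subgroup H_index.
pose cand := [seq [set u; (u * s)%g] | u <- us, s <- enum_fset S].
exists (pmap insub cand : seq (edge S)) => e.
have [x [s [sS es]]] := edge_val e.
have [u uus /asboolP Hxu] : exists2 u, u \in us & in_coset H u x.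
  by apply/hasP; rewrite has_count usP.
have ue : [set u; (u * s)%g] \in edges S by apply/mem_set; exists u, s.
exists (Sub [set u; (u * s)%g] ue).
  rewrite mem_pmap_sub; apply/allpairsP; exists (u, s); split => //.
exists (x * u^-1)%g => //; apply: edge_inj; rewrite eactE SubK es.
by rewrite image_setU !image_set1 mulgA mulgVK.
Qed.

(** The order compares the positions in H first and the orbits afterwards. It is
invariant because pos (h e) = h pos e and the order of H is left invariant. *)
Lemma orbit_structure : exists (reps : seq (edge S)) (rep : edge S -> edge S)
    (pos : edge S -> Gamma) (le : rel (edge S)),
  [/\ uniq reps, forall e, rep e \in reps, forall e, H (pos e),
      forall e, e = eact (pos e) (rep e) &
      forall h e, H h -> rep (eact h e) = rep e /\ pos (eact h e) = (h * pos e)%g] /\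
  [/\ forall f, f \in reps -> rep f = f /\ pos f = 1%g,
      total_order le & invariant_order H le].
Proof.
have [F0 F0P] := finite_orbits.
have [lt [irr tr tot inv]] := H_left_orderable.
pose P e f := `[< orb e f >].
have hasP e : has (P e) F0.
  by have [f fF ef] := F0P e; apply/hasP; exists f => //; apply/asboolP.
pose rep e := nth e F0 (find (P e) F0).
have rep_orb e : orb e (rep e) by apply/asboolP; exact: (nth_find e (hasP e)).
have rep_F0 e : rep e \in F0 by rewrite mem_nth // -has_find; exact: hasP.
have rep_eq e f : orb e f -> rep e = rep f.
  move=> ef; have PP : P e =1 P f.
    move=> g; apply/asboolP/asboolP; first exact: orb_trans (orb_sym ef).
    exact: orb_trans ef.
  by rewrite /rep (eq_find PP); apply: set_nth_default; rewrite -has_find; exact: hasP.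
pose pos e := xget 1%g [set h | H h /\ e = eact h (rep e)].
have posP e : H (pos e) /\ e = eact (pos e) (rep e).
  rewrite /pos; case: xgetP => [h _ //|noh].
  by have [h Hh eh] := rep_orb e; case: (noh h).
have orbA h e : H h -> orb (eact h e) e by move=> Hh; exists h.
have repA h e : H h -> rep (eact h e) = rep e by move=> Hh; exact/rep_eq/orbA.
have posA h e : H h -> pos (eact h e) = (h * pos e)%g.
  move=> Hh; have [Hp ep] := posP (eact h e); have [Hq eq] := posP e.
  apply: (@eact_free2 _ _ (rep e)) => //; first exact: HM.
  by rewrite -[in LHS](repA h e Hh) -ep -eact_mul -eq.
pose reps := undup [seq rep f | f <- F0].
have repsP e : rep e \in reps.
  rewrite mem_undup; apply/mapP; exists (rep e) => //.
  exact: rep_eq (rep_orb e).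
have repK f : f \in reps -> rep f = f.
  rewrite mem_undup => /mapP[e _ ->]; apply/esym; exact/rep_eq/rep_orb.
pose ix e := index (rep e) reps.
pose le e f := `[< lt (pos e) (pos f) \/ (pos e = pos f /\ (ix e <= ix f)%N) >].
exists reps, rep, pos, le; split; split.
- exact: undup_uniq.
- exact: repsP.
- by move=> e; case: (posP e).
- by move=> e; case: (posP e).
- by move=> h e Hh; rewrite repA // posA.
- move=> f fr; rewrite repK //; split=> //; have [Hp ep] := posP f.
  by apply: (@eact_free _ f Hp); rewrite -{2}(repK f fr) -ep.
- have Hpos e : H (pos e) by case: (posP e).
  split.
  + by move=> e; apply/asboolP; right.
  + move=> e f /andP[/asboolP ef /asboolP fe].
    have pp : pos e = pos f.
      case: ef => [ef|[]//]; case: fe => [fe|[]//].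
      by case: (irr _ (Hpos e)); exact: tr ef fe.
    have ixe : ix e = ix f.
      move: ef fe; rewrite pp => -[/(irr _ (Hpos f))//|[_ i1]] [/(irr _ (Hpos f))//|[_ i2]].
      by apply/eqP; rewrite eqn_leq i1 i2.
    have rr : rep e = rep f.
      by rewrite -(nth_index e (repsP e)) -/(ix e) ixe /ix nth_index.
    by have [_ ->] := posP e; have [_ ->] := posP f; rewrite pp rr.
  + move=> f e g /asboolP ef /asboolP fg; apply/asboolP.
    case: ef => [ef|[ef i1]]; case: fg => [fg|[fg i2]].
    * by left; exact: tr ef fg.
    * by left; rewrite -fg.
    * by left; rewrite ef.
    * by right; rewrite ef fg; split=> //; exact: leq_trans i1 i2.
  + move=> e f; have [h|h|h] := tot _ _ (Hpos e) (Hpos f).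
    * by apply/orP; left; apply/asboolP; left.
    * case/orP: (leq_total (ix e) (ix f)) => i; apply/orP; [left|right]; apply/asboolP; right => //.
    * by apply/orP; right; apply/asboolP; left.
- move=> h e f Hh /asboolP ef; apply/asboolP; rewrite /ix !repA // !posA //.
  case: ef => [ef|[-> i]]; last by right.
  by left; apply: inv => //; [case: (posP e)|case: (posP f)].
Qed.

End Orbits.

(** * Conditional responses in finite windows *)

Section Windows.
Variables (R : realType) (Gamma : groupType) (S : {fset Gamma}).
Variable le : rel (edge S).
Hypothesis le_order : total_order le.
Implicit Types (g h x y : Gamma) (e f : edge S) (W D : {fset Gamma}).

Let le_refl : reflexive le. Proof. by case: le_order. Qed.
Let le_anti : antisymmetric le. Proof. by case: le_order. Qed.
Let le_trans' : transitive le. Proof. by case: le_order. Qed.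
Let le_tot : total le. Proof. by case: le_order. Qed.

(** Sorted, so that revealing the edges in this order filters by the given order. *)
Definition window_edges W : seq (edge S) :=
  sort le [seq e <- undup (pmap insub
    [seq [set x; (x * s)%g] | x <- enum_fset W, s <- enum_fset S]) |
    `[< edges_in W e >] ].

Lemma mem_window_edges W e : (e \in window_edges W) = `[< edges_in W e >].
Proof.
rewrite mem_sort mem_filter; case: asboolP => //= eW.
have [x [s [sS es]]] := edge_val e.
rewrite mem_undup mem_pmap; apply/mapP; exists (val e); last by rewrite valK.
rewrite es; apply/allpairsP; exists (x, s); split=> //=.
by apply: eW; rewrite es; left.
Qed.

Lemma window_edgesP W e : reflect (edges_in W e) (e \in window_edges W).
Proof. by rewrite mem_window_edges; exact: asboolP. Qed.

Lemma uniq_window_edges W : uniq (window_edges W).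
Proof. by rewrite sort_uniq filter_uniq // undup_uniq. Qed.

Lemma size_window_edges W : (size (window_edges W) <= #|` S| * #|` W|)%N.
Proof.
rewrite size_sort size_filter; apply: leq_trans (count_size _ _) _.
apply: leq_trans (size_undup _) _; rewrite size_pmap.
apply: leq_trans (count_size _ _) _; rewrite size_allpairs mulnC //.
Qed.

Lemma window_edges_sub W W' : {subset W <= W'} ->
  {subset window_edges W <= window_edges W'}.
Proof. by move=> WW' e /window_edgesP eW; apply/window_edgesP; exact: edges_in_sub eW. Qed.

Lemma window_set W : [set` window_edges W] = edges_in W.
Proof. by apply/seteqP; split=> e /window_edgesP. Qed.

Definition later e W : seq (edge S) := [seq f <- window_edges W | ~~ le f e].

Lemma after_window e W : e \in window_edges W -> after e (window_edges W) = later e W.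
Proof.
rewrite /later; have : sorted le (window_edges W) by exact: sort_sorted.
have := uniq_window_edges W; move: (window_edges W) => s.
elim: s => //= e' s IH /andP[e's us] srt.
have srt' : sorted le s by exact: path_sorted srt.
have e'le : all (le e') s by exact: order_path_min srt.
rewrite inE; case: (eqVneq e' e) => [<-|ne].
  move=> _; rewrite le_refl /=; apply/esym/all_filterP/allP => f fs.
  apply/negP => fe; have := allP e'le f fs => ef'.
  have fe' : f = e' by apply: le_anti; rewrite fe ef'.
  by rewrite -fe' fs in e's.
move=> /= es.
by rewrite (IH us srt' es) (allP e'le e es).
Qed.

Variable p : R.
Hypotheses (p_ge0 : 0 <= p) (p_le1 : p <= 1).
Implicit Types (w : edge S -> bool) (F : (edge S -> bool) -> R).

Notation avgs := (avgs p).
Definition wmean W F := mean p (window_edges W) F.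

Lemma later_widen e W W' F w : {subset W <= W'} -> depends (edges_in W) F ->
  avgs (later e W') F w = avgs (later e W) F w.
Proof.
move=> WW' FW; rewrite (@avgs_filter _ _ _ (fun f => `[< edges_in W f >])); last first.
  by move=> f _ /asboolP fW; exact: depends_ignores fW.
congr (_ w); apply: avgs_perm; apply: uniq_perm; rewrite ?filter_uniq ?uniq_window_edges //.
move=> f; rewrite !mem_filter !mem_window_edges; case: asboolP => //= fW.
  by congr andb; apply/asboolP; exact: edges_in_sub fW.
by rewrite andbF.
Qed.

Lemma wmean_widen W W' F : {subset W <= W'} -> depends (edges_in W) F ->
  wmean W' F = wmean W F.
Proof.
move=> WW' FW; apply: mean_widen; rewrite ?uniq_window_edges //.
  exact: window_edges_sub.
by rewrite window_set.
Qed.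

Lemma wmean_later e W F : wmean W (avgs (later e W) F) = wmean W F.
Proof.
rewrite /wmean /mean avgsC avgs_ignores // => f.
by rewrite mem_filter => /andP[_ fW]; exact: ignores_avgs_mem.
Qed.

Variable H : set Gamma.
Hypothesis H_subgroup : subgroup H.
Hypothesis le_inv : invariant_order H le.

Lemma avgs_eact h (s : seq (edge S)) F w :
  avgs (map (eact h) s) (fun w => F (w \o eact h)) w = avgs s F (w \o eact h).
Proof.
have updE e b v : upd v (eact h e) b \o eact h = upd (v \o eact h) e b.
  apply/funext => f; rewrite /upd /=; case: (eqVneq f e) => [->|ne]; first by rewrite eqxx.
  by rewrite (inj_eq (can_inj (@eactK _ S h))) (negPf ne).
elim: s w => [//|e s IH] w /=.
by rewrite /avg !IH !updE.
Qed.

Lemma gap_eact h e F w :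
  gap (eact h e) (fun w => F (w \o eact h)) w = gap e F (w \o eact h).
Proof.
have updE b v : upd v (eact h e) b \o eact h = upd (v \o eact h) e b.
  apply/funext => f; rewrite /upd /=; case: (eqVneq f e) => [->|ne]; first by rewrite eqxx.
  by rewrite (inj_eq (can_inj (@eactK _ S h))) (negPf ne).
by rewrite /gap !updE.
Qed.

Lemma window_edges_tr h W :
  perm_eq (window_edges (tr h W)) (map (eact h) (window_edges W)).
Proof.
apply: uniq_perm; rewrite ?map_inj_uniq ?uniq_window_edges //; try exact: can_inj (eactK h).
move=> e; rewrite -{1 2}(eactKV h e) (mem_map (can_inj (@eactK _ S h))) !mem_window_edges.
by apply/asboolP/asboolP => /edges_in_tr.
Qed.

Lemma le_eact h e f : H h -> le (eact h e) (eact h f) = le e f.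
Proof.
move=> Hh; apply/idP/idP => [|]; last exact: le_inv.
have := le_inv (e := eact h e) (f := eact h f) (subgroupV H_subgroup Hh).
by rewrite !eactK.
Qed.

Lemma later_tr h e W : H h ->
  perm_eq (later (eact h e) (tr h W)) (map (eact h) (later e W)).
Proof.
move=> Hh; rewrite /later; have := window_edges_tr h W.
move/(perm_filter (fun f => ~~ le f (eact h e))) => /perm_trans; apply.
by rewrite filter_map (@eq_filter _ _ (fun f => ~~ le f e)) // => f /=; rewrite le_eact.
Qed.

Lemma wmean_tr h W F : depends (edges_in W) F ->
  wmean (tr h W) (fun w => F (w \o eact h)) = wmean W F.
Proof.
move=> FW; rewrite /wmean /mean (avgs_perm p _ (window_edges_tr h W)) avgs_eact.
by apply: avgs_const; rewrite window_set.
Qed.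

Section Response.
Variables (k : nat) (C : R) (f : {fset Gamma} -> (edge S -> bool) -> R).
Hypothesis f_stab : stabilizing k C f.

(** The conditional expectation, given the edges up to e, of the response of f
to opening e. *)
Definition resp e W := avgs (later e W) (gap e (f W)).

Lemma depends_gap_stab e W : depends (edges_in W) (gap e (f W)).
Proof. by apply: depends_gap; exact: stab_depends f_stab W. Qed.

Lemma resp_bound e W w : 0 <= resp e W w <= C.
Proof.
have b w' := stab_bound f_stab e W w'.
apply/andP; split; first by apply: avgs_ge0 => // w'; case/andP: (b w').
rewrite -[leRHS](congr1 (@^~ w) (avgs_cst p (later e W) C)).
by apply: le_avgs => // w'; case/andP: (b w').
Qed.

Lemma resp_mono e W W' w : deep k e W -> {subset W <= W'} ->
  resp e W w <= resp e W' w.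
Proof.
move=> dW WW'; rewrite /resp -(later_widen _ _ WW' (@depends_gap_stab e W)).
by apply: le_avgs => // v; exact: (stab_mono f_stab).
Qed.

Lemma depends_resp e W : depends (edges_in W `\` [set` later e W]) (resp e W).
Proof. exact: depends_avgs (@depends_gap_stab e W). Qed.

Lemma resp_tr h e W w : H h -> resp (eact h e) (tr h W) w = resp e W (w \o eact h).
Proof.
move=> Hh; rewrite /resp (avgs_perm p _ (later_tr e W Hh)).
rewrite (_ : gap _ _ = fun w => gap e (f W) (w \o eact h)); first exact: avgs_eact.
apply/funext => v; rewrite -gap_eact; congr gap; apply/funext => u.
exact: stab_tr f_stab h W u.
Qed.

Definition mresp e W := wmean W (gap e (f W)).

Lemma wmean_resp e W : wmean W (resp e W) = mresp e W.
Proof. exact: wmean_later. Qed.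

Lemma mresp_tr h e W : mresp (eact h e) (tr h W) = mresp e W.
Proof.
rewrite /mresp -(wmean_tr h (@depends_gap_stab e W)); congr mean.
apply/funext => v; rewrite -gap_eact; congr gap; apply/funext => u.
exact: stab_tr f_stab h W u.
Qed.

Lemma mresp_mono e W W' : deep k e W -> {subset W <= W'} -> mresp e W <= mresp e W'.
Proof.
move=> dW WW'; rewrite /mresp -(wmean_widen WW' (@depends_gap_stab e W)).
by apply: le_mean => // v; exact: (stab_mono f_stab).
Qed.

Lemma mresp_bound e W : 0 <= mresp e W <= C.
Proof.
have b w' := stab_bound f_stab e W w'.
apply/andP; split; first by apply: mean_ge0 => // w'; case/andP: (b w').
rewrite -[leRHS](mean_cst p (window_edges W)).
by apply: le_mean => // w'; case/andP: (b w').
Qed.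

(** Monotonicity turns closeness of the means into closeness in L1. *)
Lemma resp_close e W W' : deep k e W -> {subset W <= W'} ->
  wmean W' (fun w => `|resp e W' w - resp e W w|) = mresp e W' - mresp e W.
Proof.
move=> dW WW'.
rewrite (_ : (fun w => _) = (fun w => resp e W' w - resp e W w)); last first.
  by apply/funext => w; rewrite ger0_norm // subr_ge0; exact: resp_mono.
rewrite /wmean meanB -!/(wmean _ _) wmean_resp (wmean_widen WW') ?wmean_resp //.
by apply: depends_sub (@depends_resp e W) => g [].
Qed.

End Response.
End Windows.

(** * The law of large numbers for the squared increments *)

Lemma near_all_seq (T : eqType) (s : seq T) (P : T -> nat -> Prop) :
  (forall x, x \in s -> \forall N \near \oo, P x N) ->
  \forall N \near \oo, forall x, x \in s -> P x N.
Proof.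
elim: s => [|x s IH] sP; first by apply: nearW.
have h1 := sP x (mem_head _ _).
have h2 := IH (fun y ys => sP y (@mem_behead _ (x :: s) y ys)).
near=> N => y; rewrite inE => /orP[/eqP ->|ys]; first by near: N.
by move: y ys; near: N.
Unshelve. all: by end_near. Qed.

Section Exhaustion.
Variables (Gamma : groupType) (A : nat -> {fset Gamma}).
Hypothesis A_exhaustive : exhaustive A.

Lemma exhaustive_mono r r' : (r <= r')%N -> {subset A r <= A r'}.
Proof.
move=> /subnK <-; elim: (r' - r)%N => [//|j IH] x /IH.
by rewrite addSn; move: x; apply/fsubsetP; exact: A_exhaustive.1.
Qed.

Lemma exhaustive_near (s : seq Gamma) : \forall r \near \oo, {subset s <= A r}.
Proof.
have : forall x, x \in s -> \forall r \near \oo, x \in A r.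
  move=> x _; have [r xr] := A_exhaustive.2 x.
  by exists r => // r' /= rr'; exact: exhaustive_mono xr.
by move/near_all_seq.
Qed.

Lemma exhaustive_card (R : realType) : infinite_set [set: Gamma] ->
  forall M : R, \forall r \near \oo, M <= #|` A r|%:R.
Proof.
move=> inf M; have [B _ Bn] := infinite_set_fset (Num.bound `|M|) inf.
have := exhaustive_near (enum_fset B); apply: filterS => r BA.
apply: le_trans (ler_norm M) _; apply: le_trans (ltW (archi_boundP (normr_ge0 M))) _.
rewrite ler_nat; apply: leq_trans Bn _; apply: fsubset_leq_card.
by apply/fsubsetP => x; exact: BA.
Qed.

End Exhaustion.

Section SquaredIncrements.
Variables (R : realType) (Gamma : groupType) (S : {fset Gamma}).
Hypothesis S_gen : symmetric_generating S.
Hypothesis Gamma_infinite : infinite_set [set: Gamma].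
Variables (H : set Gamma) (m : nat).
Hypothesis H_subgroup : subgroup H.
Hypothesis H_index : has_index H m.
Variables (reps : seq (edge S)) (rep : edge S -> edge S) (pos : edge S -> Gamma).
Variable le : rel (edge S).
Hypothesis reps_uniq : uniq reps.
Hypothesis rep_mem : forall e, rep e \in reps.
Hypothesis pos_mem : forall e, H (pos e).
Hypothesis rep_pos : forall e, e = eact (pos e) (rep e).
Hypothesis rep_eact : forall h e, H h ->
  rep (eact h e) = rep e /\ pos (eact h e) = (h * pos e)%g.
Hypothesis reps_fix : forall f, f \in reps -> rep f = f /\ pos f = 1%g.
Hypothesis le_inv : invariant_order H le.
Variable A : nat -> {fset Gamma}.
Hypotheses (A_folner : folner R S A) (A_exhaustive : exhaustive A).
Variable p : R.
Hypotheses (p_ge0 : 0 <= p) (p_le1 : p <= 1).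
Variables (k : nat) (C1 C2 : R) (f1 f2 : {fset Gamma} -> (edge S -> bool) -> R).
Hypotheses (stab1 : stabilizing k C1 f1) (stab2 : stabilizing k C2 f2).
Implicit Types (g h x y : Gamma) (e f : edge S) (W D : {fset Gamma}) (w : edge S -> bool).

Notation resp1 := (resp le p f1).
Notation resp2 := (resp le p f2).
Notation mresp1 := (mresp le p f1).
Notation mresp2 := (mresp le p f2).
Notation wmean := (wmean le p).
Notation window_edges := (window_edges le).

Definition response e W w : R := resp1 e W w - resp2 e W w.
(** The martingale increment of f1 - f2 at the edge e, in the window W. *)
Definition incr e W w : R := (coord R e w - p) * response e W w.
Definition incr_sqr_mean e W : R := wmean W (fun w => incr e W w ^+ 2).

Let C : R := C1 + C2.

Let w0 : edge S -> bool := fun=> false.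

Lemma C1_ge0 e : 0 <= C1.
Proof. by have := resp_bound le p_ge0 p_le1 stab1 e fset0 w0; lra. Qed.

Lemma C2_ge0 e : 0 <= C2.
Proof. by have := resp_bound le p_ge0 p_le1 stab2 e fset0 w0; lra. Qed.

Lemma C_ge0 e : 0 <= C.
Proof. by rewrite addr_ge0 ?(C1_ge0 e) ?(C2_ge0 e). Qed.

Lemma response_bound e W w : `|response e W w| <= C.
Proof.
have := resp_bound le p_ge0 p_le1 stab1 e W w.
have := resp_bound le p_ge0 p_le1 stab2 e W w.
by rewrite ler_norml /response /C; lra.
Qed.

Lemma coord_sub_bound e w : `|coord R e w - p| <= 1.
Proof.
have h0 := p_ge0; have h1 := p_le1.
by rewrite /coord ler_norml; case: (w e) => /=; apply/andP; split; lra.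
Qed.

Lemma incr_bound e W w : `|incr e W w| <= C.
Proof.
rewrite /incr normrM -[leRHS]mul1r.
by apply: ler_pM => //; [exact: coord_sub_bound|exact: response_bound].
Qed.

Lemma incr_sqr_bound e W w : 0 <= incr e W w ^+ 2 <= C ^+ 2.
Proof.
rewrite sqr_ge0 /= -[leLHS]real_normK ?num_real //.
by rewrite lerXn2r ?nnegrE ?incr_bound ?(C_ge0 e).
Qed.

Lemma incr_sqr_mean_bound e W : 0 <= incr_sqr_mean e W <= C ^+ 2.
Proof.
apply/andP; split; first by apply: mean_ge0 => // w; exact: sqr_ge0.
rewrite -[leRHS](mean_cst p (window_edges W)); apply: le_mean => // w.
by case/andP: (incr_sqr_bound e W w).
Qed.

Lemma depends_incr e W : edges_in W e -> depends (edges_in W) (incr e W).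
Proof.
move=> eW w w' ww'; rewrite /incr /response /coord (ww' _ eW); congr (_ * (_ - _)).
  by apply: (depends_resp p stab1) => g [/ww'].
by apply: (depends_resp p stab2) => g [/ww'].
Qed.

Lemma incr_tr h e W w : H h -> incr (eact h e) (tr h W) w = incr e W (w \o eact h).
Proof.
move=> Hh; rewrite /incr /response.
by rewrite (resp_tr p H_subgroup le_inv stab1) // (resp_tr p H_subgroup le_inv stab2).
Qed.

Lemma incr_sqr_mean_tr h e W : H h -> edges_in W e ->
  incr_sqr_mean (eact h e) (tr h W) = incr_sqr_mean e W.
Proof.
move=> Hh eW; rewrite /incr_sqr_mean -[RHS](wmean_tr le p h); last first.
  by move=> w w' ww'; rewrite (depends_incr eW ww').
by congr mean; apply/funext => w; rewrite incr_tr.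
Qed.

Definition gap_to f D W : R :=
  (mresp1 f W - mresp1 f D) + (mresp2 f W - mresp2 f D).

Lemma deep_tr h e W : deep k e W -> deep k (eact h e) (tr h W).
Proof.
move=> [x ex dW]; exists (h * x)%g; first by exists x.
by move=> b c bk ck; rewrite mem_tr -!mulgA mulKg mulgA; exact: dW.
Qed.

(** Increments are bounded by C, so their squares are Lipschitz functions of the
responses; these grow with the window, so that their L1 distance is a
difference of means, and means are invariant under translation by h. *)
Lemma incr_sqr_close h f D W : H h -> deep k f D -> {subset tr h D <= W} ->
  wmean W (fun w => `|incr (eact h f) W w ^+ 2 - incr (eact h f) (tr h D) w ^+ 2|)
  <= 2 * C * gap_to f D (tr h^-1%g W).
Proof.
move=> Hh dD DW; set e := eact h f; set D' := tr h D.
have dD' : deep k e D' by exact: deep_tr.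
have WE : W = tr h (tr h^-1%g W) by rewrite tr_mul mulgV tr1.
have m1 : mresp1 e W = mresp1 f (tr h^-1%g W).
  by rewrite {1}WE (mresp_tr le p stab1).
have m2 : mresp2 e W = mresp2 f (tr h^-1%g W).
  by rewrite {1}WE (mresp_tr le p stab2).
rewrite /gap_to -m1 -m2.
rewrite -(mresp_tr le p stab1 h f D) -(mresp_tr le p stab2 h f D).
rewrite -(resp_close le p_ge0 p_le1 stab1 dD' DW).
rewrite -(resp_close le p_ge0 p_le1 stab2 dD' DW).
rewrite /wmean -meanD -meanZ; apply: le_mean => // w.
rewrite /incr !exprMn -mulrBr normrM.
have c1 : `|(coord R e w - p) ^+ 2| <= 1.
  by rewrite normrX exprn_ile1 // coord_sub_bound.
apply: (@le_trans _ _ `|response e W w ^+ 2 - response e D' w ^+ 2|).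
  by rewrite ler_piMl.
rewrite subr_sqr normrM mulrC; apply: ler_pM => //.
  apply: le_trans (ler_normD _ _) _.
  by have := response_bound e W w; have := response_bound e D' w; lra.
rewrite /response (_ : _ - _ = (resp1 e W w - resp1 e D' w) - (resp2 e W w - resp2 e D' w)); last ring.
exact: ler_normB.
Qed.

Lemma deep_near f : \forall N \near \oo, deep k f (A N).
Proof.
have [x [s [sS fs]]] := edge_val f.
have := exhaustive_near A_exhaustive
  [seq (x * b * c)%g | b <- enum_fset (ball S k), c <- enum_fset (ball S k)].
apply: filterS => N sub; exists x; first by rewrite fs; left.
by move=> b c bk ck; apply: sub; apply/allpairsP; exists (b, c).
Qed.

Lemma edges_in_near f : \forall N \near \oo, edges_in (A N) f.
Proof.
have [x [s [sS fs]]] := edge_val f.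
have := exhaustive_near A_exhaustive [:: x; (x * s)%g].
by apply: filterS => N sub y; rewrite fs => -[->|->]; apply: sub; rewrite !inE eqxx ?orbT.
Qed.

Lemma gap_to_small f eps : 0 < eps ->
  \forall N \near \oo, forall W, {subset A N <= W} -> gap_to f (A N) W <= eps.
Proof.
move=> eps0; have dnear := deep_near f.
have half fi Ci : stabilizing k Ci fi -> \forall N \near \oo,
    forall W, {subset A N <= W} -> mresp le p fi f W - mresp le p fi f (A N) <= eps / 2.
  move=> st; pose E := [set y : R | exists2 W, deep k f W & y = mresp le p fi f W].
  have hE : has_sup E.
    split; first by have [N _ /(_ N (leqnn N)) dN] := dnear; exists (mresp le p fi f (A N)), (A N).
    by exists Ci => _ [W _ ->]; case/andP: (mresp_bound le p_ge0 p_le1 st f W).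
  have [_ [W1 dW1 ->] W1s] : exists2 y, E y & sup E - eps / 2 < y.
    by apply: sup_adherent => //; rewrite divr_gt0.
  have W1near := exhaustive_near A_exhaustive (enum_fset W1).
  near=> N => W AW.
  have W1N : {subset W1 <= A N} by near: N.
  have h1 := mresp_mono le p_ge0 p_le1 st dW1 W1N.
  have dN : deep k f (A N) by near: N.
  have dW : deep k f W by have [y fy dy] := dN; exists y => // b c bk ck; exact/AW/dy.
  have h2 : mresp le p fi f W <= sup E by apply: sup_upper_bound => //; exists W.
  lra.
have half1 := half _ _ stab1; have half2 := half _ _ stab2.
near=> N => W AW; rewrite /gap_to.
have /(_ W AW) h1 : forall W, {subset A N <= W} ->
      mresp1 f W - mresp1 f (A N) <= eps / 2 by near: N.
have /(_ W AW) h2 : forall W, {subset A N <= W} ->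
      mresp2 f W - mresp2 f (A N) <= eps / 2 by near: N.
lra.
Unshelve. all: by end_near. Qed.

(** For large r the window A_r contains h D, where the squared increments of
eact h f have the same mean as those of f in D. *)
Lemma incr_sqr_mean_eact h f (c : R) : H h ->
  (fun r => incr_sqr_mean f (A r)) @ \oo --> c ->
  (fun r => incr_sqr_mean (eact h f) (A r)) @ \oo --> c.
Proof.
move=> Hh fc; apply/cvgrPdist_le => eps eps0.
have C1p : 0 < 2 * C + 1 by have := C_ge0 f; lra.
pose eps' := eps / 2 / (2 * C + 1).
have eps'0 : 0 < eps' by rewrite !divr_gt0.
have gnear := gap_to_small f eps'0.
have cnear : \forall N \near \oo, `|c - incr_sqr_mean f (A N)| <= eps / 2.
  by move: fc => /cvgrPdist_le; apply; rewrite divr_gt0.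
have dnear := deep_near f; have enear := edges_in_near f.
have [N [gN cN dN eN]] : exists N, [/\ forall W, {subset A N <= W} -> gap_to f (A N) W <= eps',
    `|c - incr_sqr_mean f (A N)| <= eps / 2, deep k f (A N) & edges_in (A N) f].
  near \oo => N; exists N; split; by near: N.
have := exhaustive_near A_exhaustive (enum_fset (tr h (A N))).
apply: filterS => r DW; set W := A r; set D := A N.
have AW : {subset D <= tr h^-1%g W}.
  by move=> x xD; rewrite mem_tr invgK; apply: DW; rewrite mem_tr mulKg.
have close := le_trans (incr_sqr_close Hh dN DW) (ler_wpM2l _ (gN _ AW)).
have {close} close : wmean W (fun w => `|incr (eact h f) W w ^+ 2 -
    incr (eact h f) (tr h D) w ^+ 2|) <= eps / 2.
  apply: le_trans (close _) _; first by rewrite mulr_ge0 ?(C_ge0 f).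
  rewrite /eps' mulrCA ler_piMr ?divr_ge0 ?(ltW eps0) //.
  by rewrite ler_pdivrMr // mul1r lerDl.
have eD : edges_in (tr h D) (eact h f) by apply/edges_in_tr.
have -> : c - incr_sqr_mean (eact h f) W = (c - incr_sqr_mean f D) -
    wmean W (fun w => incr (eact h f) W w ^+ 2 - incr (eact h f) (tr h D) w ^+ 2).
  rewrite /wmean meanB -!/(wmean _ _) (@wmean_widen _ _ _ le p _ _
    (fun w => incr (eact h f) (tr h D) w ^+ 2) DW); last first.
    by move=> w w' ww'; rewrite (depends_incr eD ww').
  rewrite -!/(incr_sqr_mean _ _) incr_sqr_mean_tr //; ring.
apply: le_trans (ler_normB _ _) _.
have := mean_norm p_ge0 p_le1 (window_edges W) (fun w => incr (eact h f) W w ^+ 2 -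
  incr (eact h f) (tr h D) w ^+ 2).
rewrite -/(wmean _ _) => h1; have := le_trans h1 close; lra.
Unshelve. all: by end_near. Qed.

Definition local_incr D e w : R :=
  incr e (tr (pos e) D) w ^+ 2 - incr_sqr_mean e (tr (pos e) D).

(** The contributions of e and e' are independent unless the translates of D attached
to them meet; given e, this occurs for at most |D|^2 edges e' in each orbit. *)
Lemma local_incr_sum_sqr D W (G : seq (edge S)) :
  uniq G -> (forall e, e \in G -> edges_in (tr (pos e) D) e /\ {subset tr (pos e) D <= W}) ->
  wmean W (fun w => (\sum_(e <- G) local_incr D e w) ^+ 2) <=
  (size G)%:R * ((#|` D| * #|` D| * size reps)%:R * (C ^+ 2) ^+ 2).
Proof.
move=> uG GW.
pose nb e := [seq eact (pos e * q)%g f |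
  q <- [seq (d * d'^-1)%g | d <- enum_fset D, d' <- enum_fset D], f <- reps].
have dL e : e \in G -> depends (edges_in (tr (pos e) D)) (local_incr D e).
  by move=> /GW[eD _] w w' ww'; rewrite /local_incr (depends_incr eD ww').
have mL e : e \in G -> wmean W (local_incr D e) = 0.
  move=> eG; have [eD DW] := GW e eG.
  rewrite (wmean_widen le p DW (dL e eG)) /wmean meanB mean_cst.
  by rewrite -/(wmean _ _) -/(incr_sqr_mean _ _) subrr.
have bL e w : `|local_incr D e w| <= C ^+ 2.
  have := incr_sqr_bound e (tr (pos e) D) w.
  have := incr_sqr_mean_bound e (tr (pos e) D).
  by rewrite ler_norml /local_incr; lra.
have disj (e e' : edge S) : e' \notin nb e ->
    edges_in (tr (pos e) D) `&` edges_in (tr (pos e') D) = set0.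
  move=> nbe; apply/seteqP; split=> // g [ge ge'].
  have [x [s [_ gs]]] := edge_val g.
  have gx : val g x by rewrite gs; left.
  have := ge x gx; have := ge' x gx; rewrite /= !mem_tr => d' d.
  case/negP: nbe; apply/allpairsP.
  exists ((pos e)^-1 * x * ((pos e')^-1 * x)^-1, rep e')%g; split=> /=.
  - by apply/allpairsP; exists ((pos e)^-1 * x, (pos e')^-1 * x)%g.
  - exact: rep_mem.
  - by rewrite {1}(rep_pos e') invMg invgK !mulgA mulgV mul1g mulgV mul1g.
rewrite /wmean mean_sqr_sum -sum1_size natr_sum mulr_suml big_seq [leRHS]big_seq.
apply: ler_sum => e eG; rewrite mul1r.
apply: (@le_trans _ _ (\sum_(e' <- G) (e' \in nb e)%:R * (C ^+ 2) ^+ 2)).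
  rewrite big_seq [leRHS]big_seq; apply: ler_sum => e' e'G.
  case: (boolP (e' \in nb e)) => nbe.
    rewrite mul1r -[leRHS](mean_cst p (window_edges W)); apply: le_mean => // w.
    apply: le_trans (ler_norm _) _; rewrite normrM expr2.
    by apply: ler_pM.
  have dW : depends [set` window_edges W] (local_incr D e).
    apply: depends_sub (dL e eG); rewrite window_set; apply: edges_in_sub.
    by case: (GW e eG).
  rewrite mul0r (mean_mul_disjoint p dW (dL e eG) (dL e' e'G)); last exact: disj.
  by rewrite -/(wmean _ _) mL // mul0r.
rewrite -mulr_suml ler_wpM2r ?exprn_ge0 ?(C_ge0 e) //.
have -> : \sum_(e' <- G) (e' \in nb e)%:R = (count (fun e' => e' \in nb e) G)%:R :> R.
  rewrite -sum1_count natr_sum [RHS]big_mkcond; apply: eq_bigr => e' _ /=.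
  by case: (e' \in nb e).
rewrite ler_nat -size_filter.
have sub : {subset [seq e' <- G | e' \in nb e] <= nb e}.
  by move=> e'; rewrite mem_filter => /andP[].
apply: leq_trans (uniq_leq_size (filter_uniq _ uG) sub) _.
by rewrite !size_allpairs.
Qed.

Definition inside W D e : bool := all (fun d => (pos e * d)%g \in W) D.

Lemma insideP W D e : inside W D e -> {subset tr (pos e) D <= W}.
Proof. by move=> /allP eD x; rewrite mem_tr => /eD; rewrite mulKVg. Qed.

(** An edge of the orbit of f is determined by its position h, hence by the point h x. *)
Lemma count_pattern f D x W : f \in reps -> val f `<=` [set` D] -> x \in D ->
  count (fun e => (rep e == f) && inside W D e) (window_edges W) =
  #|` pattern_part H W D x|.
Proof.
move=> fr fD xD; have [rf pf] := reps_fix fr.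
rewrite -size_filter -(size_map (fun e => (pos e * x)%g)).
apply/perm_size/uniq_perm; last 2 first.
- exact: fset_uniq.
- move=> y; apply/mapP/idP => [[e + ->]|].
    rewrite mem_filter => /andP[/andP[/eqP re eD] _].
    have px : (pos e * x)%g \in W := allP eD x xD.
    rewrite !inE /= px /= /in_coset mulgK.
    apply/andP; split; first by apply/asboolP; exact: pos_mem.
    by apply/allP => d dD; rewrite /= mulgA mulgK; exact: (allP eD d dD).
  rewrite !inE /= => /and3P[yW /asboolP Hyx /allP yD].
  have [re pe] := rep_eact f Hyx.
  exists (eact (y * x^-1)%g f); last by rewrite pe pf mulg1 mulgVK.
  rewrite mem_filter re rf eqxx /=; apply/andP; split.
    by apply/allP => d dD; rewrite pe pf mulg1 -mulgA; exact: yD.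
  by apply/window_edgesP => _ [d fd <-] /=; rewrite -mulgA; apply: yD; exact: fD.
rewrite map_inj_in_uniq ?filter_uniq ?uniq_window_edges // => e e'.
rewrite !mem_filter => /andP[/andP[/eqP re _] _] /andP[/andP[/eqP re' _] _] /mulIg pp.
by rewrite (rep_pos e) (rep_pos e') re re' pp.
Qed.

Let a r : R := #|` A r|%:R.

Lemma count_pattern_density f D : f \in reps -> val f `<=` [set` D] ->
  (fun r => (count (fun e => (rep e == f) && inside (A r) D e) (window_edges (A r)))%:R
     / a r) @ \oo --> (m%:R^-1 : R).
Proof.
move=> fr fD; have [x [s [_ fs]]] := edge_val f.
have xD : x \in D by apply: fD; rewrite fs; left.
under eq_fun do rewrite (count_pattern _ fr fD xD).
exact: (pattern_density S_gen A_folner H_subgroup H_index).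
Qed.

Lemma count_rep_density f : f \in reps ->
  (fun r => (count (fun e => rep e == f) (window_edges (A r)))%:R / a r) @ \oo
     --> (m%:R^-1 : R).
Proof.
move=> fr; have [x [s [_ fs]]] := edge_val f.
pose D : {fset Gamma} := [fset x; (x * s)%g]%fset.
have fD : val f `<=` [set` D] by rewrite fs => y /= -[->|->]; rewrite !inE eqxx ?orbT.
rewrite (_ : (fun r => _) = (fun r =>
  (count (fun e => (rep e == f) && inside (A r) D e) (window_edges (A r)))%:R / a r)).
  exact: count_pattern_density.
apply/funext => r; congr (_%:R / _); apply: eq_in_count => e /window_edgesP eW.
case: eqP => //= re; apply/esym/allP => d; rewrite !inE => dD.
have ee : e = eact (pos e) f by rewrite {1}(rep_pos e) re.
apply: eW; rewrite {1}ee; exists d => //; rewrite fs.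
by case/orP: dD => /eqP ->; [left|right].
Qed.

Variable cinf : edge S -> R.
Hypothesis incr_sqr_mean_cvg : forall f, f \in reps ->
  (fun r => incr_sqr_mean f (A r)) @ \oo --> cinf f.

Definition asymptotic_variance : R := m%:R^-1 * \sum_(f <- reps) cinf f.

Definition mean_sqr_incr r w : R := (\sum_(e <- window_edges (A r)) incr e (A r) w ^+ 2) / a r.

Let sg2 := asymptotic_variance.
Let nr : R := (size reps)%:R.

(** The four errors: localisation of the increments, edges too close to the border of
the window, fluctuation of the localised squares, and their total mean. *)
Lemma incr_sqr_split D r w :
  `|mean_sqr_incr r w - sg2| <=
   ((\sum_(e <- window_edges (A r) | inside (A r) D e)
        `|incr e (A r) w ^+ 2 - incr e (tr (pos e) D) w ^+ 2|) / a r
    + C ^+ 2 * ((count (predC (inside (A r) D)) (window_edges (A r)))%:R / a r)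
    + `|\sum_(e <- [seq e <- window_edges (A r) | inside (A r) D e]) local_incr D e w| / a r)
    + `|(\sum_(e <- window_edges (A r) | inside (A r) D e) incr_sqr_mean e (tr (pos e) D)) / a r - sg2|.
Proof.
set s := window_edges (A r); have a0 : 0 < a r by exact: (folner_size_gt0 A_folner).
have ai : `|(a r)^-1| = (a r)^-1 by rewrite gtr0_norm // invr_gt0.
set T4 := (\sum_(e <- s | _) incr_sqr_mean _ _).
rewrite /mean_sqr_incr -/s (bigID (inside (A r) D)) /=.
set B := \sum_(e <- s | ~~ _) _.
have -> : \sum_(e <- s | inside (A r) D e) incr e (A r) w ^+ 2 =
  \sum_(e <- s | inside (A r) D e) (incr e (A r) w ^+ 2 - incr e (tr (pos e) D) w ^+ 2)
  + (\sum_(e <- [seq e <- s | inside (A r) D e]) local_incr D e w + T4).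
  rewrite big_filter -!big_split /=; apply: eq_bigr => e _; rewrite /local_incr; ring.
set T1 := \sum_(e <- s | _) _; set T3 := \sum_(e <- [seq _ <- _ | _]) _.
have B0 : 0 <= B by apply: sumr_ge0 => e _; exact: sqr_ge0.
have BC : B <= C ^+ 2 * (count (predC (inside (A r) D)) s)%:R.
  rewrite -sum1_count natr_sum mulr_sumr; apply: ler_sum => e _; rewrite mulr1.
  by case/andP: (incr_sqr_bound e (A r) w).
rewrite (_ : _ - sg2 = T1 / a r + B / a r + T3 / a r + (T4 / a r - sg2)); last first.
  by rewrite !mulrDl; ring.
apply: le_trans (ler_normD _ _) _; rewrite lerD2r.
apply: le_trans (ler_normD _ _) _; apply: lerD; last by rewrite normrM ai.
apply: le_trans (ler_normD _ _) _; apply: lerD.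
  rewrite normrM ai ler_pM2r ?invr_gt0 //; exact: ler_norm_sum.
by rewrite normrM ai ger0_norm // mulrA ler_pM2r ?invr_gt0.
Qed.

Lemma sum_count_reps (P : pred (edge S)) (s : seq (edge S)) :
  (\sum_(f <- reps) count (fun e => (rep e == f) && P e) s = count P s)%N.
Proof.
elim: s => [|e s IH] /=; first by rewrite big1.
rewrite big_split /= IH; congr (_ + _)%N.
rewrite (bigD1_seq (rep e)) ?rep_mem //= eqxx big1 ?addn0 // => f.
by rewrite eq_sym => /negPf ->.
Qed.

Hypothesis C_nonneg : 0 <= C1 + C2.

(** D is taken large enough for the localisation error and for the second moments,
then r large enough for the densities and for the fluctuations, whose second
moment is of the order of |A_r|, to be small. *)
Lemma mean_sqr_incr_near eps : 0 < eps -> \forall r \near \oo,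
  wmean (A r) (fun w => `|mean_sqr_incr r w - sg2|) <=
  (2 * C * (#|` S|)%:R + C ^+ 2 * nr + 1 + nr * (C ^+ 2 + 1)) * eps.
Proof.
move=> eps0; have C0 : 0 <= C by exact: C_nonneg.
have [N _ HN] : \forall N \near \oo, forall f, f \in reps ->
  [/\ deep k f (A N), edges_in (A N) f,
   forall W, {subset A N <= W} -> gap_to f (A N) W <= eps &
   `|incr_sqr_mean f (A N) - cinf f| <= eps].
  apply: near_all_seq => f fr.
  have n1 := deep_near f; have n2 := edges_in_near f; have n3 := gap_to_small f eps0.
  have /cvgrPdist_le/(_ _ eps0) n4 := incr_sqr_mean_cvg fr.
  near=> N; split; [by near: N|by near: N|by near: N|].
  by rewrite distrC; near: N.
have {}HN := HN N (leqnn N); set D := A N in HN.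
pose good f r : R :=
  (count (fun e => (rep e == f) && inside (A r) D e) (window_edges (A r)))%:R.
pose tot f r : R := (count (fun e => rep e == f) (window_edges (A r)))%:R.
have near1 : \forall r \near \oo, forall f, f \in reps ->
    `|good f r / a r - m%:R^-1| <= eps / 2 /\ `|tot f r / a r - m%:R^-1| <= eps / 2.
  apply: near_all_seq => f fr; have e2 : 0 < eps / 2 by rewrite divr_gt0.
  have fD : val f `<=` [set` D] by case: (HN f fr).
  have /cvgrPdist_le/(_ _ e2) n1 := count_pattern_density fr fD.
  have /cvgrPdist_le/(_ _ e2) n2 := count_rep_density fr.
  near=> r; split; rewrite distrC; near: r; [exact: n1|exact: n2].
pose K : R := (#|` D| * #|` D| * size reps)%:R * (C ^+ 2) ^+ 2.
have near2 := exhaustive_card A_exhaustive Gamma_infinite ((#|` S|)%:R * K / eps ^+ 2).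
near=> r.
have a0 : 0 < a r by exact: (folner_size_gt0 A_folner).
have ar : (#|` S|)%:R * K / eps ^+ 2 <= a r by near: r.
have nearr : forall f, f \in reps ->
  `|good f r / a r - m%:R^-1| <= eps / 2 /\ `|tot f r / a r - m%:R^-1| <= eps / 2 by near: r.
set s := window_edges (A r).
have sa : (size s)%:R <= (#|` S|)%:R * a r.
  by rewrite -natrM ler_nat; exact: size_window_edges.
have goodP e : inside (A r) D e -> {subset D <= tr (pos e)^-1%g (A r)}.
  by move=> eD d dD; rewrite mem_tr invgK; exact: (allP eD d dD).
have eE e : eact (pos e) (rep e) = e by rewrite -rep_pos.
apply: le_trans (le_mean p_ge0 p_le1 _ (incr_sqr_split D r)) _.
rewrite !meanD !mean_cst -/s.
rewrite (_ : (_ + _ + _ + _) * eps = 2 * C * (#|` S|)%:R * eps + C ^+ 2 * (nr * eps) + eps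
   + nr * ((C ^+ 2 + 1) * eps)); last ring.
apply: lerD; first apply: lerD; first apply: lerD.
(* localisation of the increments *)
- rewrite (_ : (fun w => _) = (fun w => (a r)^-1 * \sum_(e <- s | inside (A r) D e)
      `|incr e (A r) w ^+ 2 - incr e (tr (pos e) D) w ^+ 2|)); last first.
    by apply/funext => w; rewrite mulrC.
  rewrite meanZ mean_sum ler_pdivrMl //.
  apply: (@le_trans _ _ (\sum_(e <- s) 2 * C * eps)).
    rewrite [leLHS]big_mkcond; apply: ler_sum => e _.
    case: ifP => eD; last by rewrite mulr_ge0 ?mulr_ge0 // ltW.
    have [dD _ gD _] := HN (rep e) (rep_mem e).
    have DW : {subset tr (pos e) D <= A r} by exact: insideP.
    have := incr_sqr_close (pos_mem e) dD DW; rewrite eE => /le_trans; apply.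
    by rewrite ler_wpM2l ?mulr_ge0 //; apply: gD; exact: goodP.
  have -> : \sum_(e <- s) 2 * C * eps = (size s)%:R * (2 * C * eps).
    rewrite big_const_seq count_predT iter_addr_0; exact/esym/mulr_natl.
  have : 0 <= 2 * C * eps by rewrite !mulr_ge0 // ltW.
  nra.
(* edges near the border: both densities tend to 1/m *)
- rewrite ler_wpM2l ?sqr_ge0 //.
  have cE : (count (predC (inside (A r) D)) s)%:R =
      \sum_(f <- reps) (tot f r - good f r).
    rewrite sumrB -!natr_sum (sum_count_reps (inside (A r) D)).
    have := sum_count_reps predT s.
    under eq_bigr => f _ do under eq_count => e do rewrite andbT.
    move=> ->; rewrite count_predT -(count_predC (inside (A r) D) s) natrD.
    by rewrite [X in X - _]addrC addrK.
  rewrite cE mulr_suml.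
  apply: (@le_trans _ _ (\sum_(f <- reps) eps)); last first.
    rewrite big_const_seq count_predT iter_addr_0 le_eqVlt; apply/orP; left.
  by apply/eqP/esym; exact: mulr_natl.
  rewrite big_seq [leRHS]big_seq; apply: ler_sum => f fr.
  have [] := nearr f fr; rewrite mulrBl !ler_norml; lra.
(* fluctuations: y / a <= eps / 2 + y^2 / (2 eps a^2) reduces them to a second moment *)
- pose G := [seq e <- s | inside (A r) D e].
  have uG : uniq G by rewrite filter_uniq // uniq_window_edges.
  have GP e : e \in G -> edges_in (tr (pos e) D) e /\ {subset tr (pos e) D <= A r}.
    rewrite mem_filter => /andP[eD _]; split; last exact: insideP.
    have [_ fD _ _] := HN (rep e) (rep_mem e).
    by rewrite -{2}(eE e); apply/edges_in_tr.
  have LS := local_incr_sum_sqr uG GP; rewrite -/K in LS.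
  have sG : (size G)%:R <= (#|` S|)%:R * a r.
    by apply: le_trans sa; rewrite ler_nat size_filter count_size.
  pose Y w : R := \sum_(e <- G) local_incr D e w.
  have K0 : 0 <= K by rewrite mulr_ge0 ?ler0n ?exprn_ge0.
  apply: (@le_trans _ _ (wmean (A r) (fun w => eps / 2 + (2 * eps * a r ^+ 2)^-1 * Y w ^+ 2))).
    apply: le_mean => // w; rewrite -/G -/(Y w).
    have y2 : `|Y w| ^+ 2 = Y w ^+ 2 by rewrite real_normK ?num_real.
    rewrite -y2; move: `|Y w| => y.
    have -> : eps / 2 + (2 * eps * a r ^+ 2)^-1 * y ^+ 2 =
        y / a r + (2 * eps * a r ^+ 2)^-1 * (y - eps * a r) ^+ 2.
      by field; rewrite !gt_eqF.
    by rewrite lerDl mulr_ge0 ?sqr_ge0 // invr_ge0 !mulr_ge0 ?exprn_ge0 // ltW.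
  rewrite /wmean meanD mean_cst meanZ -/(wmean _ _).
  have e2 : 0 < eps ^+ 2 by rewrite exprn_gt0.
  have h : wmean (A r) (fun w => Y w ^+ 2) <= a r ^+ 2 * eps ^+ 2.
    apply: le_trans LS _.
    apply: (@le_trans _ _ ((#|` S|)%:R * a r * K)); first by rewrite ler_wpM2r.
    move: ar; rewrite ler_pdivrMr // => ar.
    have := ler_wpM2l (ltW a0) ar; nra.
  suff : (2 * eps * a r ^+ 2)^-1 * wmean (A r) (fun w => Y w ^+ 2) <= eps / 2 by lra.
  rewrite ler_pdivrMl; last by rewrite !mulr_gt0 ?exprn_gt0.
  by apply: le_trans h _; rewrite le_eqVlt; apply/orP; left; apply/eqP; field.
(* total mean: the mean attached to e only depends on its orbit *)
have good_sum : \sum_(e <- s | inside (A r) D e) incr_sqr_mean e (tr (pos e) D) =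
    \sum_(f <- reps) incr_sqr_mean f D * good f r.
  transitivity (\sum_(e <- s | inside (A r) D e) incr_sqr_mean (rep e) D).
    apply: eq_bigr => e _; rewrite -{1}(eE e) incr_sqr_mean_tr //.
    by case: (HN (rep e) (rep_mem e)).
  rewrite [RHS](eq_bigr (fun f => \sum_(e <- s | inside (A r) D e && (rep e == f))
      incr_sqr_mean f D)); last first.
    move=> f _; rewrite /good -sum1_count natr_sum mulr_sumr.
    by apply: eq_big => [e|e _]; [rewrite andbC|rewrite mulr1].
  rewrite [RHS](exchange_big_dep (inside (A r) D)) /=; last by move=> f e _ /andP[].
  apply: eq_bigr => e eD; rewrite (big_rem (rep e)) ?rep_mem // eD eqxx big1_seq.
    exact/esym/addr0.
  by move=> f /andP[/andP[_ /eqP <-]]; rewrite mem_rem_uniq // inE eqxx.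
rewrite good_sum mulr_suml /sg2 /asymptotic_variance mulr_sumr -sumrB.
apply: le_trans (ler_norm_sum _ _ _) _.
apply: (@le_trans _ _ (\sum_(f <- reps) (C ^+ 2 + 1) * eps)); last first.
  rewrite big_const_seq count_predT iter_addr_0 le_eqVlt; apply/orP; left.
  by apply/eqP/esym; exact: mulr_natl.
rewrite big_seq [leRHS]big_seq; apply: ler_sum => f fr.
have [g1 _] := nearr f fr; have [_ _ _ c1] := HN f fr.
have cb := incr_sqr_mean_bound f D.
rewrite (_ : _ - _ = incr_sqr_mean f D * (good f r / a r - m%:R^-1)
  + m%:R^-1 * (incr_sqr_mean f D - cinf f)); last ring.
apply: le_trans (ler_normD _ _) _; rewrite mulrDl mul1r !normrM; apply: lerD.
  apply: ler_pM => //; first by rewrite ger0_norm; case/andP: cb.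
  by move: g1; lra.
rewrite -[leRHS]mul1r; apply: ler_pM => //.
rewrite ger0_norm ?invr_ge0 ?ler0n //; case: (m) => [|m']; first by rewrite invr0.
by rewrite invf_le1 ?ltr0n // ler1n.
Unshelve. all: by end_near. Qed.

Lemma mean_sqr_incr_cvg :
  (fun r => wmean (A r) (fun w => `|mean_sqr_incr r w - sg2|)) @ \oo --> (0 : R).
Proof.
have C0 : 0 <= C by exact: C_nonneg.
apply/cvgr0Pnorm_le => eps eps0.
set Kc := (2 * C * (#|` S|)%:R + C ^+ 2 * nr + 1 + nr * (C ^+ 2 + 1)).
have Kc0 : 0 < Kc.
  have h1 : 0 <= 2 * C * (#|` S|)%:R by rewrite !mulr_ge0.
  have h2 : 0 <= C ^+ 2 * nr by rewrite mulr_ge0 ?exprn_ge0 ?ler0n.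
  have h3 : 0 <= nr * (C ^+ 2 + 1) by rewrite mulr_ge0 ?ler0n // addr_ge0 ?exprn_ge0.
  rewrite /Kc; lra.
have e1 : 0 < eps / Kc by rewrite divr_gt0.
apply: filterS (mean_sqr_incr_near e1) => r; rewrite -/Kc mulrC divfK ?gt_eqF // => h.
rewrite ger0_norm //; apply: mean_ge0 => // w; exact: normr_ge0.
Qed.

End SquaredIncrements.

(** * The martingale central limit theorem for the functional *)

Section FunctionalCLT.
Variables (R : realType) (Gamma : groupType) (S : {fset Gamma}).
Variable le : rel (edge S).
Hypothesis le_order : total_order le.
Variable p : R.
Hypotheses (p_ge0 : 0 <= p) (p_le1 : p <= 1).
Variables (k : nat) (C1 C2 : R) (f1 f2 : {fset Gamma} -> (edge S -> bool) -> R).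
Hypotheses (stab1 : stabilizing k C1 f1) (stab2 : stabilizing k C2 f2).
Hypothesis C_nonneg : 0 <= C1 + C2.
Implicit Types (e : edge S) (W : {fset Gamma}) (w : edge S -> bool).

Notation wmean := (wmean le p).
Notation window_edges := (window_edges le).
Notation response := (response le p f1 f2).
Notation incr := (incr le p f1 f2).

Definition centered W w : R :=
  (f1 W w - f2 W w) - wmean W (fun w => f1 W w - f2 W w).

Lemma response_avgs e W w : response e W w =
  avgs p (later le e W) (gap e (fun w => f1 W w - f2 W w)) w.
Proof.
rewrite /response /resp -[LHS](congr1 (@^~ w) (avgsB p _ _ _)); congr (avgs _ _ _ w).
by apply/funext => v; rewrite /gap; ring.
Qed.

Lemma depends_diff W : depends (edges_in W) (fun w => f1 W w - f2 W w).
Proof.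
by move=> w w' ww'; rewrite (stab_depends stab1 ww') (stab_depends stab2 ww').
Qed.

Lemma centered_sum W w : centered W w = \sum_(e <- window_edges W) incr e W w.
Proof.
have := martingale_decomposition p (fun w => f1 W w - f2 W w) w (uniq_window_edges le W).
rewrite (@avgs_const R _ p _ _ w (fun=> false)); last first.
  by rewrite window_set; exact: depends_diff.
rewrite -/(mean _ _ _) -/(wmean _ _) -/(centered W w) => ->.
apply: eq_big_seq => e es; rewrite /increment (after_window le_order es) /incr.
by rewrite response_avgs.
Qed.

Lemma response_ignores e W : ignores e (response e W).
Proof.
move=> w b; rewrite !response_avgs; move: w b.
by apply: ignores_avgs; exact: ignores_gap_same.
Qed.

Lemma response_ignores_later e W : {in later le e W, forall e', ignores e' (response e W)}.
Proof.
move=> e' e's w b; rewrite !response_avgs; move: w b.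
exact: ignores_avgs_mem.
Qed.

Lemma wmean_avg e W F : e \in window_edges W -> wmean W (avg p e F) = wmean W F.
Proof.
by move=> eW; rewrite /wmean /mean -avg_avgs avg_ignores //; exact: ignores_avgs_mem.
Qed.

Lemma avg_incr e W : avg p e (incr e W) = fun=> 0.
Proof.
apply/funext => w; rewrite /avg /incr !response_ignores /coord /upd eqxx /=; ring.
Qed.

(** The later of two edges has an increment of mean 0 given the earlier edges. *)
Lemma wmean_incr_mul e e' W : e \in window_edges W -> e' \in window_edges W -> e != e' ->
  wmean W (fun w => incr e W w * incr e' W w) = 0.
Proof.
have [_ le_anti _ le_tot] := le_order.
suff H e1 e2 : e1 \in window_edges W -> e2 \in later le e1 W ->
    wmean W (fun w => incr e1 W w * incr e2 W w) = 0.
  move=> eW e'W ee'; case: (boolP (le e' e)) => e'e; last by apply: H => //; rewrite mem_filter e'e.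
  rewrite (_ : (fun w => _) = (fun w => incr e' W w * incr e W w)); last first.
    by apply/funext => w; rewrite mulrC.
  apply: H => //; rewrite mem_filter eW andbT; apply: contra ee' => ee'.
  by apply/eqP/le_anti; rewrite ee' e'e.
move=> e1W e2l; have [] : ~~ le e2 e1 /\ e2 \in window_edges W.
  by move: e2l; rewrite mem_filter => /andP.
move=> nle e2W; rewrite -(wmean_avg _ e2W).
have ig : ignores e2 (incr e1 W).
  move=> w b; rewrite /incr (response_ignores_later e2l) (ignores_coord R) //.
  by apply: contraNneq nle => ->; case: (le_order) => r _ _ _; exact: r.
rewrite (_ : avg p e2 _ = fun w => incr e1 W w * avg p e2 (incr e2 W) w); last first.
  by have := @avgs_pull R _ p [:: e2] (incr e2 W) (incr e1 W); apply=> e3; rewrite inE => /eqP ->.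
rewrite avg_incr (_ : (fun w => _) = fun=> 0); first exact: mean_cst.
by apply/funext => w; rewrite mulr0.
Qed.

Variable A : nat -> {fset Gamma}.
Let a r : R := #|` A r|%:R.
Hypothesis A_large : forall M : R, \forall r \near \oo, M <= a r.
Variable v : R.
Notation msi := (mean_sqr_incr le A p f1 f2).
Hypothesis msi_cvg : (fun r => wmean (A r) (fun w => `|msi r w - v|)) @ \oo --> (0 : R).

Lemma wmean_centered_sqr r :
  (a r)^-1 * wmean (A r) (fun w => centered (A r) w ^+ 2) = wmean (A r) (msi r).
Proof.
rewrite (_ : (fun w => _) = fun w => (\sum_(e <- window_edges (A r)) incr e (A r) w) ^+ 2); last first.
  by apply/funext => w; rewrite centered_sum.
rewrite /wmean mean_sqr_sum.
rewrite (_ : msi r = fun w => (a r)^-1 * \sum_(e <- window_edges (A r)) incr e (A r) w ^+ 2); last first.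
  by apply/funext => w; rewrite mulrC.
rewrite meanZ mean_sum; congr (_ * _); apply: eq_big_seq => e es.
rewrite (bigD1_seq e) ?uniq_window_edges //= big1_seq ?addr0 // => e' /andP[e'e e's].
by apply: wmean_incr_mul => //; rewrite eq_sym.
Qed.

Lemma wmean_msi_cvg : (fun r => wmean (A r) (msi r)) @ \oo --> v.
Proof.
apply/cvgrPdist_le => eps eps0; have /cvgr0Pnorm_le/(_ _ eps0) := msi_cvg.
apply: filterS => r; apply: le_trans; apply: le_trans (ler_norm _).
rewrite distrC -[X in _ - X](mean_cst p (window_edges (A r))) /wmean -meanB.
exact: mean_norm.
Qed.

Lemma variance_cvg :
  (fun r => (a r)^-1 * wmean (A r) (fun w => centered (A r) w ^+ 2)) @ \oo --> v.
Proof. by under eq_fun do rewrite wmean_centered_sqr; exact: wmean_msi_cvg. Qed.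

Lemma wmean_msi_ge0 r : 0 <= wmean (A r) (msi r).
Proof.
apply: mean_ge0 => // w; apply: mulr_ge0; first by apply: sumr_ge0 => e _; exact: sqr_ge0.
by rewrite invr_ge0 ler0n.
Qed.

Lemma limit_variance_ge0 : 0 <= v.
Proof.
rewrite -(cvg_lim (@Rhausdorff R) wmean_msi_cvg).
apply: limr_ge; first by apply/cvg_ex; exists v; exact: wmean_msi_cvg.
by apply: nearW => r; exact: wmean_msi_ge0.
Qed.

Definition rescaled r w : R := (Num.sqrt (a r))^-1 * centered (A r) w.

Definition law r (g : R -> R) : R := wmean (A r) (fun w => g (rescaled r w)).

Lemma mean_functional_law r : mean_functional (law r).
Proof.
split=> [g h _ _|b g _|g h _ _ gh|].
- exact: meanD.
- exact: meanZ.
- by apply: le_mean => // w; exact: gh.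
- exact: mean_cst.
Qed.

Lemma sqrt_size_cvg : (fun r => (Num.sqrt (a r))^-1) @ \oo --> (0 : R).
Proof.
apply/cvgr0Pnorm_le => eps eps0; apply: filterS (A_large (eps ^- 2)) => r ar.
rewrite ger0_norm ?invr_ge0 ?sqrtr_ge0 //.
have e2 : 0 < eps ^- 2 by rewrite invr_gt0 exprn_gt0.
rewrite -[leRHS]invrK lef_pV2 ?posrE ?invr_gt0 // ?sqrtr_gt0 ?(lt_le_trans e2) //.
have := ler_wsqrtr ar; rewrite -exprVn sqrtr_sqr ger0_norm // invr_ge0.
exact: ltW.
Qed.

(** The rescaled increments are at most c = |t| C / sqrt |A_r|, and there are at most
|S| |A_r| of them, so the sum of the cubes is of order 1 / sqrt |A_r| while
the sum of the squares is bounded. *)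
Lemma law_cos_cvg phi t : (fun r => law r (fun x => cos (phi + t * x))) @ \oo -->
  cos phi * expR (- (v * t ^+ 2 / 2)).
Proof.
pose C := C1 + C2; pose Sc : R := (#|` S|)%:R.
have C0 : 0 <= C by exact: C_nonneg.
pose q r := (Num.sqrt (a r))^-1.
pose B r : R := 2 * Sc * (`|t| * C) ^+ 3 * q r
  + expR (Sc * (`|t| * C) ^+ 2 / 2) *
    (t ^+ 2 * wmean (A r) (fun w => `|msi r w - v|) / 2).
have B0 : B @ \oo --> (0 : R).
  apply: cvg0D.
    rewrite -(mulr0 (2 * Sc * (`|t| * C) ^+ 3)).
    by apply: cvgM; [exact: cvg_cst|exact: sqrt_size_cvg].
  set b := expR _.
  rewrite (_ : (fun r => _) = (fun r => (b * t ^+ 2 / 2) * wmean (A r) (fun w => `|msi r w - v|))).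
    rewrite -(mulr0 (b * t ^+ 2 / 2)).
    by apply: cvgM; [exact: cvg_cst|exact: msi_cvg].
  by apply/funext => r; ring.
have small : \forall r \near \oo, `|t| * C * q r <= 1.
  have c0 : (fun r => `|t| * C * q r) @ \oo --> (0 : R).
    by rewrite -(mulr0 (`|t| * C)); apply: cvgM; [exact: cvg_cst|exact: sqrt_size_cvg].
  have /cvgr0Pnorm_le/(_ _ ltr01) := c0.
  by apply: filterS => r; apply: le_trans; exact: ler_norm.
apply/cvgrPdist_le => eps eps0; have /cvgr0Pnorm_le/(_ _ eps0) BN := B0.
near=> r; rewrite distrC; apply: (@le_trans _ _ (`|B r|)); last by near: r.
apply: le_trans (ler_norm _).
have a1 : 1 <= a r by near: r.
have a0 : 0 < a r by exact: lt_le_trans a1.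
have qr0 : 0 < q r by rewrite invr_gt0 sqrtr_gt0.
have q2 : q r ^+ 2 = (a r)^-1 by rewrite exprVn sqr_sqrtr // ltW.
have c1 : `|t| * C * q r <= 1 by near: r.
set s := window_edges (A r); pose c := `|t| * C * q r.
have c0 : 0 <= c by rewrite !mulr_ge0 // ltW.
pose y e w := t * q r * response e (A r) w.
have xE e w : (coord R e w - p) * y e w = t * q r * incr e (A r) w.
  by rewrite /y /incr; ring.
have sa : (size s)%:R <= Sc * a r by rewrite -natrM ler_nat; exact: size_window_edges.
have pred : predictable y s.
  move=> e es; split=> [w b|e' e'l w b]; first by rewrite /y response_ignores.
  by rewrite /y response_ignores_later // -(after_window le_order es).
have xc e w : e \in s -> `|(coord R e w - p) * y e w| <= c.
  move=> _; rewrite xE normrM normrM (gtr0_norm qr0) /c mulrAC ler_pM2r //.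
  by rewrite ler_wpM2l //; exact: (incr_bound le p_ge0 p_le1 stab1 stab2).
have v0 : 0 <= v * t ^+ 2 by rewrite mulr_ge0 ?sqr_ge0 // limit_variance_ge0.
have c01 : 0 <= c <= 1 by rewrite c0.
have := mcleish_bound p_ge0 p_le1 phi (uniq_window_edges le (A r)) pred c01 xc v0.
rewrite -/s.
have -> : mean p s (fun w => cos (phi + \sum_(e <- s) (coord R e w - p) * y e w)) =
    law r (fun x => cos (phi + t * x)).
  congr mean; apply/funext => w; congr (cos (_ + _)).
  rewrite /rescaled centered_sum mulrA mulr_sumr; apply: eq_bigr => e _; exact: xE.
have -> : mean p s (fun w => `|\sum_(e <- s) ((coord R e w - p) * y e w) ^+ 2 - v * t ^+ 2|)
    = t ^+ 2 * wmean (A r) (fun w => `|msi r w - v|).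
  rewrite -meanZ; congr mean; apply/funext => w.
  transitivity (`|t ^+ 2 * (msi r w - v)|); last by rewrite normrM ger0_norm ?sqr_ge0.
  congr (`|_|).
  rewrite /mean_sqr_incr -/s -/(a r) -q2 (mulrBr _ _ v) [v * _]mulrC; congr (_ - _).
  rewrite mulr_suml mulr_sumr; apply: eq_bigr => e _; rewrite xE; ring.
move=> /le_trans; apply; rewrite /B; set M := wmean _ _.
have M0 : 0 <= M by apply: mean_ge0 => // w; exact: normr_ge0.
apply: lerD.
  rewrite /c [_ ^+ 3](_ : _ = (`|t| * C) ^+ 3 * q r ^+ 3); last by rewrite exprMn.
  have -> : 2 * (size s)%:R * ((`|t| * C) ^+ 3 * q r ^+ 3) =
      2 * ((`|t| * C) ^+ 3 * q r) * ((size s)%:R * q r ^+ 2) by ring.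
  have -> : 2 * Sc * (`|t| * C) ^+ 3 * q r = 2 * ((`|t| * C) ^+ 3 * q r) * Sc by ring.
  apply: ler_wpM2l; first by rewrite !mulr_ge0 ?exprn_ge0 ?mulr_ge0 // ltW.
  by rewrite q2 ler_pdivrMr.
apply: ler_wpM2r; first by rewrite divr_ge0 // mulr_ge0 ?sqr_ge0.
rewrite ler_expR ler_wpM2r ?invr_ge0 // /c exprMn q2.
rewrite mulrCA [leRHS]mulrC ler_wpM2l ?exprn_ge0 ?mulr_ge0 //.
by rewrite ler_pdivrMr.
Unshelve. all: by end_near. Qed.

(** The cosine transforms converge to those of the Gaussian law; tightness is
Chebyshev's inequality, the variances being convergent. *)
Lemma law_cvg g : bcont g ->
  (fun r => law r g) @ \oo --> (\int[gaussian 0 v]_x g x)%R.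
Proof.
move=> bg; have v0 := limit_variance_ge0.
apply: (weak_convergence_of_cos mean_functional_law (mean_functional_integral _)) => //.
  move=> phi t; rewrite gaussian_cos //; exact: law_cos_cvg.
move=> eps eps0; have [N HN] := tight_integral (gaussian 0 v) eps0.
pose n := maxn N (Num.bound ((v + 1) / eps)).
exists n.+1%:R; split; first by rewrite ltr0n.
- have /cvgrPdist_le/(_ _ ltr01) := wmean_msi_cvg.
  move=> near1; near=> r.
  have a1 : 1 <= a r by near: r.
  have a0 : 0 < a r by exact: lt_le_trans a1.
  have m1 : wmean (A r) (msi r) <= v + 1.
    have : `|v - wmean (A r) (msi r)| <= 1 by near: r.
    by rewrite ler_norml; lra.
  apply: (@le_trans _ _ (wmean (A r) (fun w => (a r)^-1 * (n.+1%:R ^+ 2)^-1 * centered (A r) w ^+ 2))).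
    apply: le_mean => // w; apply: le_trans (tail_le _ _) _.
    rewrite /rescaled exprMn exprVn sqr_sqrtr ?(ltW a0) //.
    by rewrite le_eqVlt; apply/orP; left; apply/eqP; ring.
  rewrite /wmean meanZ -/(wmean _ _) mulrAC wmean_centered_sqr.
  rewrite ler_pdivrMr ?exprn_gt0 ?ltr0n //; apply: le_trans m1 _.
  have b1 : (v + 1) / eps < n.+1%:R.
    apply: lt_le_trans (archi_boundP _) _; first by rewrite divr_ge0 ?addr_ge0 // ltW.
    by rewrite ler_nat; apply: leq_trans (leqnSn _); rewrite leq_maxr.
  rewrite ltr_pdivrMr // in b1; apply: le_trans (ltW b1) _; rewrite mulrC.
  by rewrite ler_wpM2l ?(ltW eps0) // expr2 ler_peMr ?ler0n // ler1n.
- by apply: HN; rewrite leq_maxl.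
Unshelve. all: by end_near. Qed.

End FunctionalCLT.

(** * Cylinder functions of an independent Bernoulli family *)

Section BernoulliFamily.
Context {d : measure_display} {T : measurableType d} {R : realType}.
Variable P : probability T R.
Variables (I : choiceType) (p : R) (omega : I -> T -> bool).
Hypothesis omega_iid : iid_bernoulli P p omega.
Implicit Types (i e : I) (s : seq I) (J : set I) (A X : set T) (g : (I -> bool) -> R).

Definition config t : I -> bool := fun i => omega i t.

Let F J := sigma_gen omega J.

Let omega_meas i : measurable_fun setT (omega i). Proof. by case: omega_iid. Qed.

Definition opened i : set T := omega i @^-1` [set true].

Lemma sigma_gen_measurable J A : F J A -> measurable A.
Proof.
apply: smallest_sub; first exact: sigma_algebra_measurable.
by move=> _ [i _ [B mB <-]]; exact: omega_meas.
Qed.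

Lemma sigma_gen_sub J J' A : J `<=` J' -> F J A -> F J' A.
Proof.
move=> JJ'; apply: sub_smallest2r => // B [i iJ iB]; exists i => //; exact: JJ'.
Qed.

Lemma sigma_genT J : F J setT.
Proof. by have := @measurableT _ (g_sigma_algebraType
  (\bigcup_(i in J) preimage_set_system setT (omega i) measurable)). Qed.

Lemma sigma_genC J A : F J A -> F J (~` A).
Proof. exact: (@measurableC _ (g_sigma_algebraType
  (\bigcup_(i in J) preimage_set_system setT (omega i) measurable))). Qed.

Lemma sigma_genI J A B : F J A -> F J B -> F J (A `&` B).
Proof. exact: (@measurableI _ (g_sigma_algebraType
  (\bigcup_(i in J) preimage_set_system setT (omega i) measurable))). Qed.

Lemma sigma_gen_preimage J i (B : set bool) : J i -> F J (omega i @^-1` B).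
Proof.
by move=> Ji; apply: sub_sigma_algebra; exists i => //; exists B => //; rewrite setTI.
Qed.

Lemma dynkin_independent X : measurable X ->
  dynkin [set A | measurable A /\ P (X `&` A) = (P X * P A)%E].
Proof.
move=> mX; split => [|A [mA PA]|B tB HB] /=.
- by rewrite setIT probability_setT mule1.
- split; first exact: measurableC.
  rewrite -setDE measureD //; last by rewrite (le_lt_trans (probability_le1 _ _)) ?ltry.
  transitivity (P X - P X * P A)%E; first by congr (_ - _)%E; exact: PA.
  rewrite probability_setC //.
  have [x ->] : exists x : R, P X = x%:E by exists (fine (P X)); rewrite fineK // fin_num_measure.
  have [y ->] : exists y : R, P A = y%:E by exists (fine (P A)); rewrite fineK // fin_num_measure.
  by rewrite -EFinM -!EFinB -EFinM; congr EFin; ring.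
- have mB n : measurable (B n) by case: (HB n).
  split; first exact: bigcup_measurable.
  rewrite setI_bigcupr !measure_bigcup //; last first.
  + by apply: trivIset_setIl.
  + by move=> n _; exact: measurableI.
  have [x ex] : exists x : R, P X = x%:E by exists (fine (P X)); rewrite fineK // fin_num_measure.
  rewrite ex -nneseriesZl //; apply: eq_eseriesr => n _; rewrite -ex; by case: (HB n).
Qed.

(** By the pi-lambda theorem, one coordinate is independent of the others. *)
Lemma opened_fresh e A : F (~` [set e]) A -> P (opened e `&` A) = (p%:E * P A)%E.
Proof.
have [_ Pe ind] := omega_iid.
pose G : set (set T) := [set A | exists (K : {fset I}) (B : I -> set bool),
  e \notin K /\ A = \bigcap_(i in [set` K]) omega i @^-1` B i].
have GI : setI_closed G.
  move=> _ _ [K [B [eK ->]]] [K' [B' [eK' ->]]].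
  exists (K `|` K')%fset, (fun i => (if i \in K then B i else setT) `&`
    (if i \in K' then B' i else setT)); split; first by rewrite !inE negb_or eK.
  apply/seteqP; split=> t.
    move=> [h h'] i /=; rewrite !inE => iKK'; split.
      by case: ifP => // iK; exact: h.
    by case: ifP => // iK'; exact: h'.
  move=> h; split=> i /= iK.
    by have [|] := h i _; rewrite /= ?inE ?iK.
  by have [|_] := h i _; rewrite /= ?inE iK ?orbT.
have GP : G `<=` [set A | measurable A /\ P (opened e `&` A) = (P (opened e) * P A)%E].
  move=> _ [K [B [eK ->]]]; split.
    by apply: fin_bigcap_measurable => // i _; rewrite -[_ @^-1` _]setTI; exact: omega_meas.
  pose B' i := if i == e then [set true] else B i.
  have := ind (e |` K)%fset B'; rewrite big_fsetU1 //= {2}/B' eqxx.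
  have -> : (\prod_(i <- K) P (omega i @^-1` B' i))%E = (\prod_(i <- K) P (omega i @^-1` B i))%E.
    apply: eq_big_seq => i iK; rewrite /B'; case: eqP => // ie.
    by rewrite -ie iK in eK.
  rewrite -ind => <-; congr (P _); apply/seteqP; split=> t.
    move=> [te h] i /=; rewrite !inE => /orP[/eqP ->|iK]; first by rewrite /B' eqxx.
    by rewrite /B'; case: eqP => [->|_] //; exact: h.
  move=> h; split; first by have := h e; rewrite /B' eqxx /= !inE eqxx; apply.
  move=> i iK; have := h i; rewrite /B' /= !inE iK orbT; case: eqP => [ie|_]; last exact.
  by rewrite /= ie in iK; rewrite iK in eK.
move=> FA; rewrite -(Pe e).
have mX : measurable (opened e) by rewrite /opened -[_ @^-1` _]setTI; exact: omega_meas.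
suff [_ ->] : [set A | measurable A /\ P (opened e `&` A) = (P (opened e) * P A)%E] A by [].
have sd : <<s G >> `<=` [set A | measurable A /\ P (opened e `&` A) = (P (opened e) * P A)%E].
  rewrite -setI_closed_g_dynkin_g_sigma_algebra //.
  by apply: smallest_sub => //; exact: dynkin_independent.
apply: sd; suff sub : F (~` [set e]) `<=` <<s G >> by exact: sub.
apply: smallest_sub; first exact: smallest_sigma_algebra.
move=> _ [i ie [B mB <-]]; apply: (@sub_sigma_algebra _ setT G).
exists [fset i]%fset, (fun=> B); split; first by rewrite !inE eq_sym; apply/eqP.
by rewrite set_fset1 bigcap_set1 /= setTI.
Qed.

Lemma cylinder_bounded s g : depends [set` s] g -> exists M, forall w, `|g w| <= M.
Proof.
elim: s g => [|e s IH] g gs.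
  by exists `|g (fun=> false)| => w; rewrite (gs w (fun=> false)).
have h b : depends [set` s] (fun w => g (upd w e b)).
  move=> w w' ww'; apply: gs => i /=; rewrite inE /upd; case: eqP => //= _; exact: ww'.
have [M HM] := IH _ (h true); have [N HN] := IH _ (h false).
exists (Num.max M N) => w; rewrite -(upd_id w e) le_max.
by case: (w e); rewrite ?HM ?HN ?orbT.
Qed.

Lemma cylinder_measurable (d' : measure_display) (T' : measurableType d')
    (xi : I -> T' -> bool) s g :
  (forall i, i \in s -> measurable_fun setT (xi i)) -> depends [set` s] g ->
  measurable_fun setT (fun t => g (fun i => xi i t)).
Proof.
elim: s g => [|e s IH] g mxi gs.
  rewrite (_ : (fun t => _) = cst (g (fun=> false))); first exact: measurable_cst.
  by apply/funext => t; apply: gs.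
have h b : depends [set` s] (fun w => g (upd w e b)).
  move=> w w' ww'; apply: gs => i /=; rewrite inE /upd; case: eqP => //= _; exact: ww'.
rewrite (_ : (fun t => _) = fun t => if xi e t then g (upd (xi^~ t) e true)
    else g (upd (xi^~ t) e false)).
  apply: measurable_fun_ifT; first by apply: mxi; exact: mem_head.
  - by apply: IH (h true) => i iz; apply: mxi; rewrite inE iz orbT.
  - by apply: IH (h false) => i iz; apply: mxi; rewrite inE iz orbT.
apply/funext => t; rewrite -{1}(upd_id (xi^~ t) e).
by case: (xi e t).
Qed.

Definition bmeas (g : T -> R) := measurable_fun setT g /\ exists M, forall t, `|g t| <= M.

Lemma bmeas_integrable (g : T -> R) A : measurable A -> bmeas g -> P.-integrable A (EFin \o g).
Proof.
move=> mA [mg [M gM]]; apply: measurable_bounded_integrable => //.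
- exact: (le_lt_trans (probability_le1 P mA) (ltry 1)).
- exact: measurable_funTS.
exists M; split; first by rewrite num_real.
by move=> y My x _; apply: le_trans (gM x) (ltW My).
Qed.

Lemma bmeas_cylinder s g : depends [set` s] g -> bmeas (g \o config).
Proof.
move=> gs; split; first exact: (cylinder_measurable (s := s)).
by have [M HM] := cylinder_bounded gs; exists M => t; exact: HM.
Qed.

Notation RI A g := (\int[P]_(t in A) g t)%R.

Lemma Rintegral_split A X (g : T -> R) : measurable A -> measurable X -> bmeas g ->
  RI A g = RI (A `&` X) g + RI (A `&` ~` X) g.
Proof.
move=> mA mX bg; rewrite -{1}(setIT A) -(setUv X) setIUr Rintegral_setU //.
- exact: measurableI.
- by apply: measurableI => //; exact: measurableC.
- by rewrite -setIUr setUv setIT; exact: bmeas_integrable.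
- apply/disj_setPS => t [[_ Xt] [_ nXt]]; exact: nXt.
Qed.

Let mopened i : measurable (opened i).
Proof. by rewrite /opened -[_ @^-1` _]setTI; exact: omega_meas. Qed.

Let depends_upd e b s g : depends [set` e :: s] g -> depends [set` s] (fun w => g (upd w e b)).
Proof.
move=> gs w w' ww'; apply: gs => i /=; rewrite inE /upd; case: eqP => //= _; exact: ww'.
Qed.

Let RI_opened A e g : RI (A `&` opened e) (g \o config) =
  RI (A `&` opened e) ((fun w => g (upd w e true)) \o config).
Proof.
apply: eq_Rintegral => t; rewrite inE => -[_ te] /=.
by rewrite -{1}(upd_id (config t) e) /config te.
Qed.

Let RI_closed A e g : RI (A `&` ~` opened e) (g \o config) =
  RI (A `&` ~` opened e) ((fun w => g (upd w e false)) \o config).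
Proof.
apply: eq_Rintegral => t; rewrite inE => -[_ te] /=.
rewrite -{1}(upd_id (config t) e) /config.
by have -> : omega e t = false by apply/negbTE/negP.
Qed.

(** By induction on the coordinates of g: according to the state of the first one,
A splits into two events of the same sigma-algebra, on each of which g depends
on the remaining coordinates. *)
Lemma fresh_integral X J s g A : measurable X ->
  (forall A, F J A -> P (X `&` A) = (p%:E * P A)%E) ->
  [set` s] `<=` J -> depends [set` s] g -> F J A ->
  RI (X `&` A) (g \o config) = p * RI A (g \o config).
Proof.
move=> mX fresh sJ gs; elim: s g sJ gs A => [|e s IH] g sJ gs A FA.
  have mA := sigma_gen_measurable FA.
  rewrite (_ : g \o config = cst (g (fun=> false))); last first.
    by apply/funext => t; apply: gs.
  rewrite !Rintegral_cst //; last exact: measurableI.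
  have -> : fine (P (X `&` A)) = p * fine (P A).
    by rewrite fresh // fineM // fin_num_measure.
  by rewrite mulrCA.
have mA := sigma_gen_measurable FA.
have Je : J e by apply: sJ; rewrite /= mem_head.
have sJ' : [set` s] `<=` J by move=> i iz; apply: sJ; rewrite /= inE orbC; apply/orP; left.
have bg := bmeas_cylinder gs.
have Fe : F J (opened e) by exact: sigma_gen_preimage.
rewrite (Rintegral_split _ (mopened e) bg); last exact: measurableI.
rewrite (Rintegral_split mA (mopened e) bg).
rewrite (RI_opened (X `&` A)) (RI_closed (X `&` A)) (RI_opened A) (RI_closed A) -!setIA.
rewrite !IH //; try exact: depends_upd.
- by rewrite mulrDr.
- by apply: sigma_genI => //; exact: sigma_genC.
- exact: sigma_genI.
Qed.

Lemma Rintegral_avg e s g A : depends [set` s] g -> F (~` [set e]) A ->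
  RI A (g \o config) = RI A (avg p e g \o config).
Proof.
move=> gs FA; have mA := sigma_gen_measurable FA.
pose s' := [seq i <- s | i != e].
have dep b : depends [set` s'] (fun w => g (upd w e b)).
  move=> w w' ww'; apply: gs => i iz; rewrite /upd; case: (eqVneq i e) => // ie.
  by apply: ww'; rewrite /= mem_filter ie.
have sJ : [set` s'] `<=` ~` [set e].
  by move=> i /=; rewrite mem_filter => /andP[/eqP].
have bg := bmeas_cylinder gs.
have b1 := bmeas_cylinder (dep true); have b0 := bmeas_cylinder (dep false).
have X1 := fresh_integral (mopened e) (@opened_fresh e) sJ (dep true) FA.
have X0 := fresh_integral (mopened e) (@opened_fresh e) sJ (dep false) FA.
rewrite (Rintegral_split mA (mopened e) bg) RI_opened RI_closed.
have := Rintegral_split mA (mopened e) b0; rewrite (setIC A (opened e)) X0 => h0.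
rewrite X1.
have -> : RI (A `&` ~` opened e) ((fun w => g (upd w e false)) \o config) =
  (1 - p) * RI A ((fun w => g (upd w e false)) \o config).
  by lra.
rewrite -!RintegralZl //; try exact: bmeas_integrable.
have bd b c : bmeas ((fun w => c * g (upd w e b)) \o config).
  by apply: (@bmeas_cylinder s') => w w' ww'; rewrite (dep b _ _ ww').
rewrite -RintegralD //; try (by apply: bmeas_integrable => //; exact: bd).
Qed.

Lemma Rintegral_avgs (L s : seq I) g A J : depends [set` s] g -> F J A ->
  (forall e, e \in L -> ~ J e) ->
  RI A (g \o config) = RI A (avgs p L g \o config).
Proof.
move=> gs FA LJ; elim: L LJ => [//|e L IH] LJ.
rewrite IH; last by move=> e' eL; apply: LJ; rewrite inE eL orbT.
apply: (@Rintegral_avg e s).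
  by apply: depends_sub (depends_avgs (s := L) p gs) => i [].
by apply: sigma_gen_sub FA => i Ji ie; apply: (LJ e (mem_head _ _)); rewrite -ie.
Qed.

Lemma Rintegral_mean s g : depends [set` s] g ->
  RI setT (g \o config) = mean p s g.
Proof.
move=> gs; rewrite (Rintegral_avgs (L := s) gs (@sigma_genT set0)); last by move=> e _ [].
rewrite (_ : avgs p s g \o config = cst (mean p s g)); last first.
  by apply/funext => t; exact: avgs_const.
rewrite Rintegral_cst //; have -> : fine (P setT) = 1 by rewrite probability_setT.
exact: mulr1.
Qed.

Lemma expectation_cylinder s g : depends [set` s] g ->
  'E_P[g \o config]%E = (mean p s g)%:E.
Proof.
move=> gs; rewrite -(Rintegral_mean gs) unlock /Rintegral fineK //.
by apply: integrable_fin_num => //; apply: bmeas_integrable => //; exact: bmeas_cylinder gs.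
Qed.

Lemma variance_cylinder s g : depends [set` s] g ->
  'V_P[g \o config]%E = (mean p s (fun w => (g w - mean p s g) ^+ 2))%:E.
Proof.
move=> gs; rewrite /variance unlock (expectation_cylinder gs) /=.
rewrite -(@expectation_cylinder s); last by move=> w w' ww'; rewrite (gs _ _ ww').
by congr expectation; apply/funext => t /=; rewrite expr2.
Qed.

End BernoulliFamily.

(** * Bounded limits of random variables *)

Section BoundedLimits.
Context {d : measure_display} {T : measurableType d} {R : realType}.
Variables (P : probability T R) (u : nat -> T -> R) (g : T -> R) (M : R).
Hypothesis u_meas : forall r, measurable_fun setT (u r).
Hypothesis u_bound : forall r t, `|u r t| <= M.
Hypothesis u_cvg : forall t, u ^~ t @ \oo --> g t.

Lemma bounded_limit_bmeas : bmeas g.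
Proof.
split; first by apply: (measurable_fun_cvg (h := u)) => // t _; exact: u_cvg.
exists M => t; have h : (fun r => `|u r t|) @ \oo --> `|g t| by apply: cvg_norm; exact: u_cvg.
rewrite -(cvg_lim _ h) //; apply: limr_le; first by apply/cvg_ex; exists `|g t|.
by apply: nearW => r; exact: u_bound.
Qed.

Lemma bounded_convergence A : measurable A ->
  (fun r => (\int[P]_(t in A) u r t)%R) @ \oo --> (\int[P]_(t in A) g t)%R.
Proof.
move=> mA; apply: fine_cvg.
have ig := bmeas_integrable P mA bounded_limit_bmeas.
rewrite fineK; last exact: integrable_fin_num.
apply: (@dominated_cvg _ _ _ P A mA (fun r => EFin \o u r) (EFin \o g) (cst M%:E)) => //.
- by move=> r; apply/measurable_EFinP; exact: measurable_funTS.
- by move=> t _; apply: cvg_EFin; [exact: nearW|exact: u_cvg].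
- apply: (bmeas_integrable P mA (g := cst M)).
  by split; [exact: measurable_cst|exists `|M|].
- by move=> r t _ /=; rewrite lee_fin.
Qed.

(** Bounded convergence for the indicators of the events of deviation. *)
Lemma cvg_in_probability_pointwise : cvg_in_probability P u g.
Proof.
move=> eps eps0; pose B r := [set t | eps <= `|u r t - g t|].
have mB r : measurable (B r).
  have [mg _] := bounded_limit_bmeas.
  have m : measurable_fun setT (fun t => `|u r t - g t|).
    by apply: measurableT_comp => //; exact: measurable_funB.
  have := m measurableT `[eps, +oo[%classic (measurable_itv _).
  rewrite setTI; congr measurable; apply/seteqP.
  by split=> t; rewrite /B /= in_itv /= andbT.
rewrite -(_ : (\int[P]_(t in setT) (cst 0%:E t))%E = 0%E); last first.
  by rewrite integral_cst // mul0e.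
rewrite (_ : (fun r => _) = fun r => (\int[P]_(t in setT) (EFin \o \1_(B r)) t)%E); last first.
  apply/funext => r; transitivity (P (B r `&` setT)); first by rewrite setIT.
  by rewrite -integral_indic.
apply: (@dominated_cvg _ _ _ P setT _ (fun r => EFin \o \1_(B r)) (cst 0%:E) (cst 1%:E)) => //.
- by move=> r; apply/measurable_EFinP; exact: measurable_indic.
- move=> t _; apply: cvg_EFin; first exact: nearW.
  apply: cvg_near_cst; move: (u_cvg (t := t)) => /cvgrPdist_lt /(_ _ eps0).
  apply: filterS => r; rewrite distrC ltNge => h.
  by rewrite /= indicE memNset //; exact/negP.
- apply: (bmeas_integrable P measurableT (g := cst 1)).
  by split; [exact: measurable_cst|exists `|1|].
- move=> r t _ /=; rewrite lee_fin indicE.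
  by case: (_ \in _); rewrite ?normr1 ?normr0.
Qed.

End BoundedLimits.

(** * The effect of resampling one edge *)

Section Resampling.
Variables (R : realType) (Gamma : groupType) (S : {fset Gamma}).
Variable le : rel (edge S).
Hypothesis le_order : total_order le.
Variable p : R.
Hypotheses (p_ge0 : 0 <= p) (p_le1 : p <= 1).
Variable A : nat -> {fset Gamma}.
Hypothesis A_exhaustive : exhaustive A.
Variables (k : nat) (C1 C2 : R) (f1 f2 : {fset Gamma} -> (edge S -> bool) -> R).
Hypotheses (stab1 : stabilizing k C1 f1) (stab2 : stabilizing k C2 f2).
Implicit Types (e : edge S) (w : edge S -> bool) (r : nat).

Notation window_edges := (window_edges le).
Notation incr := (incr le p f1 f2).

(** The windows A_r are increasing and eventually contain a neighbourhood of e. *)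
Lemma nondecreasing_window_cvg (u : {fset Gamma} -> R) C e :
  (forall W W', deep k e W -> {subset W <= W'} -> u W <= u W') ->
  (forall W, u W <= C) -> cvgn (fun r => u (A r)).
Proof.
move=> umono uC; apply: near_nondecreasing_is_cvgn; last by apply: nearW => r; exact: uC.
have := deep_near A_exhaustive k e; apply: filterS => r dr r' rr'.
by apply: umono => //; exact: exhaustive_mono.
Qed.

Definition difference r w : R := f1 (A r) w - f2 (A r) w.

Lemma gap_difference e r w :
  gap e (difference r) w = gap e (f1 (A r)) w - gap e (f2 (A r)) w.
Proof. by rewrite /gap /difference; ring. Qed.

Lemma gap_difference_cvg e w : cvgn (fun r => gap e (difference r) w).
Proof.
rewrite (_ : (fun r => _) = (fun r => gap e (f1 (A r)) w) - (fun r => gap e (f2 (A r)) w)).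
  apply: is_cvgB.
    apply: (@nondecreasing_window_cvg (fun W => gap e (f1 W) w) C1 e).
      by move=> W W'; exact: (stab_mono stab1).
    by move=> W; case/andP: (stab_bound stab1 e W w).
  apply: (@nondecreasing_window_cvg (fun W => gap e (f2 W) w) C2 e).
    by move=> W W'; exact: (stab_mono stab2).
  by move=> W; case/andP: (stab_bound stab2 e W w).
by apply/funext => r; rewrite gap_difference.
Qed.

Lemma gap_difference_bound e r w : `|gap e (difference r) w| <= C1 + C2.
Proof.
rewrite gap_difference ler_norml.
have /andP[? ?] := stab_bound stab1 e (A r) w; have /andP[? ?] := stab_bound stab2 e (A r) w.
by apply/andP; split; lra.
Qed.

Lemma incr_cvg e w : cvgn (fun r => incr e (A r) w).
Proof.
rewrite /incr; apply: is_cvgM; first exact: is_cvg_cst.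
apply: is_cvgB.
  apply: (@nondecreasing_window_cvg (fun W => resp le p f1 e W w) C1 e).
    by move=> W W'; exact: (resp_mono le p_ge0 p_le1 stab1).
  by move=> W; case/andP: (resp_bound le p_ge0 p_le1 stab1 e W w).
apply: (@nondecreasing_window_cvg (fun W => resp le p f2 e W w) C2 e).
  by move=> W W'; exact: (resp_mono le p_ge0 p_le1 stab2).
by move=> W; case/andP: (resp_bound le p_ge0 p_le1 stab2 e W w).
Qed.

Lemma depends_difference r : depends [set` window_edges (A r)] (difference r).
Proof. by rewrite window_set; exact: (@depends_diff _ _ _ _ _ _ _ _ stab1 stab2). Qed.

Context {d : measure_display} {T : measurableType d}.
Variables (P : probability T R) (omega eta : edge S -> T -> bool).
Hypothesis omega_iid : iid_bernoulli P p omega.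
Hypothesis eta_fresh : fresh_bernoulli P p omega eta.

Notation conf := (config omega).
Notation F := (sigma_gen omega).

Definition resampling_effect e r t : R :=
  ((omega e t)%:R - (eta e t)%:R) * gap e (difference r) (conf t).

Lemma resampling_effectE e r t : resampling_effect e r t =
  difference r (conf t) - difference r (resample (conf t) e (eta e t)).
Proof.
set g := difference r; set w := conf t.
have -> : g w = g (upd w e (omega e t)) by rewrite -[in LHS](upd_id w e).
rewrite -[resample _ _ _]/(upd w e (eta e t)) /resampling_effect /gap -/g -/w.
by case: (omega e t); case: (eta e t) => /=; ring.
Qed.

Definition limit_effect e t : R :=
  ((omega e t)%:R - (eta e t)%:R) * limn (fun r => gap e (difference r) (conf t)).

Definition limit_incr e t : R := limn (fun r => incr e (A r) (conf t)).

Lemma resampling_effect_cvg e t : resampling_effect e ^~ t @ \oo --> limit_effect e t.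
Proof. by apply: cvgM; [exact: cvg_cst|exact: gap_difference_cvg]. Qed.

Lemma incr_config_cvg e t : (fun r => incr e (A r) (conf t)) @ \oo --> limit_incr e t.
Proof. exact: incr_cvg. Qed.

Lemma resampling_effect_bound e r t : `|resampling_effect e r t| <= C1 + C2.
Proof.
rewrite normrM -[leRHS]mul1r; apply: ler_pM => //; last exact: gap_difference_bound.
by case: (omega e t); case: (eta e t); rewrite /= ?subrr ?subr0 ?sub0r ?normrN ?normr0 ?normr1.
Qed.

Let bmeas_bool (x : T -> bool) : measurable_fun setT x -> bmeas (fun t => (x t)%:R : R).
Proof.
move=> mx; split; last by exists 1 => t; case: (x t); rewrite ?normr1 ?normr0.
apply: (@cylinder_measurable R unit _ _ (fun=> x) [:: tt] (coord R tt)) => //.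
by move=> w w' ww'; rewrite /coord ww' //= mem_head.
Qed.

Let bmeas_gap e r : bmeas (gap e (difference r) \o conf).
Proof.
apply: (bmeas_cylinder omega_iid (s := window_edges (A r))).
exact: depends_gap (depends_difference (r := r)).
Qed.

Lemma resampling_effect_measurable e r : measurable_fun setT (resampling_effect e r).
Proof.
have [mo _ _] := omega_iid; have [me _ _] := eta_fresh e.
apply: measurable_funM; last by case: (bmeas_gap e r).
by apply: measurable_funB; [case: (bmeas_bool (mo e))|case: (bmeas_bool me)].
Qed.

Lemma incr_depends_past e r :
  depends [set` e :: [seq e' <- window_edges (A r) | le e' e]] (incr e (A r)).
Proof.
have le_refl : reflexive le by case: le_order.
move=> w w' ww'; rewrite /incr /response /coord (ww' e) /= ?mem_head //; congr (_ * (_ - _)).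
  apply: (depends_resp p stab1) => f [fW nl]; apply: ww' => /=.
  rewrite inE mem_filter; apply/orP; right; move/window_edgesP : fW => fW; rewrite fW andbT.
  by apply/negPn/negP => nle; apply: nl; rewrite /= mem_filter nle fW.
apply: (depends_resp p stab2) => f [fW nl]; apply: ww' => /=.
rewrite inE mem_filter; apply/orP; right; move/window_edgesP : fW => fW; rewrite fW andbT.
by apply/negPn/negP => nle; apply: nl; rewrite /= mem_filter nle fW.
Qed.

Lemma bmeas_incr e r : bmeas (incr e (A r) \o conf).
Proof. exact: (bmeas_cylinder omega_iid (@incr_depends_past e r)). Qed.

Lemma bmeas_limit_effect e : bmeas (limit_effect e).
Proof.
apply: (bounded_limit_bmeas (@resampling_effect_measurable e)).
  exact: resampling_effect_bound.
exact: resampling_effect_cvg.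
Qed.

Lemma bmeas_limit_incr e : bmeas (limit_incr e).
Proof.
apply: (@bounded_limit_bmeas _ _ _ (fun r => incr e (A r) \o conf) _ (C1 + C2)).
- by move=> r; case: (bmeas_incr e r).
- by move=> r t; exact: (incr_bound le p_ge0 p_le1 stab1 stab2).
- exact: incr_config_cvg.
Qed.

Lemma limit_incr_past_measurable e (B : set R) : measurable B ->
  F [set e' | le e' e] (limit_incr e @^-1` B).
Proof.
have le_refl : reflexive le by case: le_order.
move=> mB; pose T' := g_sigma_algebraType
  (\bigcup_(i in [set e' | le e' e]) preimage_set_system setT (omega i) measurable).
suff m : @measurable_fun _ _ T' _ setT (limit_incr e).
  by have := m measurableT B mB; rewrite setTI.
apply: (@measurable_fun_cvg _ T' R setT (fun r => incr e (A r) \o conf)); last first.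
  by move=> t _; exact: incr_config_cvg.
move=> r; apply: (@cylinder_measurable R _ _ T' omega _ _ _ (@incr_depends_past e r)) => i.
rewrite inE mem_filter => ile _ B' mB'; rewrite setTI; apply: sigma_gen_preimage => /=.
by case/orP: ile => [/eqP ->|/andP[]].
Qed.

(** The fresh state of e is independent of everything else, and averages to p;
the edges after e are independent of the past and average out. *)
Lemma Rintegral_effect e r B : edges_in (A r) e -> F [set e' | le e' e] B ->
  (\int[P]_(t in B) resampling_effect e r t)%R = (\int[P]_(t in B) (incr e (A r) \o conf) t)%R.
Proof.
have le_refl : reflexive le by case: le_order.
move=> eA FB; have mB := sigma_gen_measurable omega_iid FB.
have FTB : F setT B by apply: sigma_gen_sub FB.
have [mo _ _] := omega_iid; have [me Pe ind] := eta_fresh e.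
pose Q := gap e (difference r).
have dQ : depends [set` window_edges (A r)] Q by exact: depends_gap (depends_difference (r := r)).
pose X := eta e @^-1` [set true].
have mX : measurable X by rewrite /X -[_ @^-1` _]setTI; exact: me.
have fresh D : F setT D -> P (X `&` D) = (p%:E * P D)%E.
  by move=> FD; rewrite ind // -Pe.
have bg := bmeas_gap e r.
have bw : bmeas (fun t => (omega e t)%:R * Q (conf t)).
  apply: (bmeas_cylinder omega_iid (s := window_edges (A r)) (g := fun w => coord R e w * Q w)).
  move=> w w' ww'; rewrite (dQ _ _ ww') /coord ww' //=; exact/window_edgesP.
have bn : bmeas (fun t => (eta e t)%:R * Q (conf t)).
  have [m1 _] := bmeas_bool me; have [m2 [M HM]] := bg.
  split; first exact: measurable_funM.
  exists M => t; case: (eta e t); rewrite ?mul1r ?mul0r ?normr0 //; first exact: HM.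
  exact: le_trans (normr_ge0 _) (HM t).
rewrite (_ : resampling_effect e r =
  fun t => (omega e t)%:R * Q (conf t) - (eta e t)%:R * Q (conf t)); last first.
  by apply/funext => t; rewrite /resampling_effect mulrBl.
rewrite RintegralB //; try exact: bmeas_integrable.
rewrite (Rintegral_split P mB mX bn).
rewrite [X in _ - (_ + X)](_ : _ = 0) ?addr0; last first.
  rewrite (@eq_Rintegral _ _ _ P _ (cst 0)) ?Rintegral_cst ?mul0r //.
    by apply: measurableI => //; exact: measurableC.
  move=> t; rewrite inE => -[_ nX] /=.
  by have -> : eta e t = false; [apply/negbTE/negP|rewrite mul0r].
rewrite (@eq_Rintegral _ _ _ P (B `&` X) (Q \o conf)); last first.
  by move=> t; rewrite inE => -[_ /= ->]; rewrite mul1r.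
rewrite setIC (fresh_integral omega_iid mX fresh _ dQ FTB) //.
rewrite -RintegralZl //; last exact: bmeas_integrable.
rewrite -RintegralB //; try exact: bmeas_integrable; last first.
  apply: bmeas_integrable => //; apply: (bmeas_cylinder omega_iid (s := window_edges (A r))
    (g := fun w => p * Q w)).
  by move=> w w' ww'; rewrite (dQ _ _ ww').
rewrite (@eq_Rintegral _ _ _ P _ ((fun w => (coord R e w - p) * Q w) \o conf)); last first.
  by move=> t _ /=; rewrite mulrBl.
rewrite (Rintegral_avgs omega_iid (L := later le e (A r)) (s := window_edges (A r))
  (g := fun w => (coord R e w - p) * Q w) _ FB).
- apply: eq_Rintegral => t _ /=; rewrite avgs_pull; first by rewrite /incr response_avgs.
  move=> f; rewrite mem_filter => /andP[nf _] w b; rewrite /coord /upd.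
  by case: eqP => // ef; rewrite ef le_refl in nf.
- move=> w w' ww'; rewrite (dQ _ _ ww') /coord ww' //=; exact/window_edgesP.
- by move=> f; rewrite mem_filter => /andP[/negP].
Qed.

Lemma limit_incr_cond_expectation e :
  is_cond_expectation P (F [set e' | le e' e]) (limit_effect e) (limit_incr e).
Proof.
split.
- exact: bmeas_integrable (bmeas_limit_effect e).
- exact: bmeas_integrable (bmeas_limit_incr e).
- exact: limit_incr_past_measurable.
move=> B FB; have mB := sigma_gen_measurable omega_iid FB.
have fin g : bmeas g -> (\int[P]_(t in B) (g t)%:E)%E = ((\int[P]_(t in B) g t)%R)%:E.
  by move=> bg; rewrite fineK //; apply: integrable_fin_num => //; exact: bmeas_integrable.
rewrite (fin _ (bmeas_limit_effect e)) (fin _ (bmeas_limit_incr e)); congr EFin.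
have c1 := @bounded_convergence _ _ _ P (resampling_effect e) (limit_effect e) (C1 + C2)
  (@resampling_effect_measurable e) (@resampling_effect_bound e) (@resampling_effect_cvg e) B mB.
have c2 : (fun r => (\int[P]_(t in B) (incr e (A r) \o conf) t)%R) @ \oo -->
    (\int[P]_(t in B) limit_incr e t)%R.
  apply: (@bounded_convergence _ _ _ P _ _ (C1 + C2)) => //.
  - by move=> r; case: (bmeas_incr e r).
  - by move=> r t; exact: (incr_bound le p_ge0 p_le1 stab1 stab2).
  - exact: incr_config_cvg.
have := @cvg_unique _ (@norm_hausdorff _ R) _ _ _ _ c2; apply; apply: cvg_trans c1; apply: near_eq_cvg.
have := edges_in_near A_exhaustive e; apply: filterS => r eA.
exact: Rintegral_effect.
Qed.

Lemma effect_cvg_in_probability e :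
  cvg_in_probability P (resampling_effect e) (limit_effect e).
Proof.
apply: (@cvg_in_probability_pointwise _ _ _ P _ _ (C1 + C2)).
- exact: resampling_effect_measurable.
- exact: resampling_effect_bound.
- exact: resampling_effect_cvg.
Qed.

Definition limit_sqr_mean e : R := (\int[P]_t (limit_incr e t ^+ 2))%R.

Lemma expectation_limit_incr_sqr e :
  'E_P[(fun t => limit_incr e t ^+ 2)%R]%E = (limit_sqr_mean e)%:E.
Proof.
rewrite unlock /limit_sqr_mean /Rintegral fineK //; apply: integrable_fin_num => //.
apply: bmeas_integrable => //; have [m [M HM]] := bmeas_limit_incr e; split.
  exact: measurable_funX.
by exists (M ^+ 2) => t; rewrite normrX lerXn2r ?nnegrE // (le_trans _ (HM t)).
Qed.

Lemma incr_sqr_mean_limit e :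
  (fun r => incr_sqr_mean le p f1 f2 e (A r)) @ \oo --> limit_sqr_mean e.
Proof.
have c : (fun r => (\int[P]_t (((fun w => incr e (A r) w ^+ 2) \o conf) t))%R) @ \oo -->
    limit_sqr_mean e.
  apply: (@bounded_convergence _ _ _ P _ _ ((C1 + C2) ^+ 2)) => //.
  - by move=> r; apply: measurable_funX; case: (bmeas_incr e r).
  - move=> r t /=; have h := incr_bound le p_ge0 p_le1 stab1 stab2 e (A r) (conf t).
    by rewrite normrX lerXn2r ?nnegrE // (le_trans _ h).
  - by move=> t; rewrite /= expr2; under eq_fun do rewrite expr2; apply: cvgM; exact: incr_config_cvg.
apply: cvg_trans c; apply: near_eq_cvg.
have := edges_in_near A_exhaustive e; apply: filterS => r eA.
rewrite (Rintegral_mean omega_iid (s := window_edges (A r))) //.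
rewrite window_set => w w' ww'.
by rewrite (@depends_incr _ _ _ le p _ _ _ _ _ stab1 stab2 e (A r) eA _ _ ww').
Qed.

End Resampling.

(** * The central limit theorem *)

Lemma infinite_group_nontrivial (Gamma : groupType) (H : set Gamma) m :
  infinite_set [set: Gamma] -> subgroup H -> has_index H m ->
  exists2 h, H h & h <> 1%g.
Proof.
move=> inf H_sub H_ind; apply: contrapT => no; apply: inf.
have [us _ cov] := right_transversal H_sub H_ind.
apply: (sub_finite_set _ (finite_seq us)) => x _ /=.
have : has (fun u => in_coset H u x) us by rewrite has_count cov.
case/hasP => u uus /asboolP Hxu.
suff xu1 : (x * u^-1)%g = 1%g by rewrite -[x](mulgVK u) xu1 mul1g.
by apply: contrapT => ne; apply: no; exists (x * u^-1)%g.
Qed.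

(** The formula for the variance carries a factor 1/2, so every orbit has to be
represented twice in the fundamental set: by a representative, and by its
translate by a fixed nontrivial element. *)
Lemma doubled_fundamental_edges (R : realType) (Gamma : groupType) (S : {fset Gamma})
    (H : set Gamma) (reps : seq (edge S)) (rep : edge S -> edge S)
    (pos : edge S -> Gamma) (h1 : Gamma) (c : edge S -> R) :
  subgroup H -> uniq reps -> (forall e, rep e \in reps) -> (forall e, H (pos e)) ->
  (forall e, e = eact (pos e) (rep e)) ->
  (forall h e, H h -> pos (eact h e) = (h * pos e)%g) ->
  (forall f, f \in reps -> pos f = 1%g) ->
  H h1 -> h1 <> 1%g -> (forall f, c (eact h1 f) = c f) ->
  exists2 Et : {fset edge S}, fundamental_edges H Et &
    \sum_(e <- Et) c e = 2 * \sum_(f <- reps) c f.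
Proof.
move=> H_sub ur rep_mem pos_mem rep_pos pos_eact pos_reps Hh1 h1n c_inv.
pose s := reps ++ map (@eact _ S h1) reps.
have us : uniq s.
  rewrite cat_uniq ur map_inj_uniq ?ur ?andbT /=; last exact: can_inj (eactK h1).
  apply/hasPn => _ /mapP[f fr ->]; apply/negP => hfr; apply: h1n.
  by have := pos_eact h1 f Hh1; rewrite (pos_reps _ hfr) (pos_reps _ fr) mulg1.
exists [fset e in s]%fset.
  move=> e; exists (pos e)^-1%g; first exact: subgroupV.
  by rewrite {2}(rep_pos e) eactK !inE rep_mem.
have pe : perm_eq (enum_fset [fset e in s]%fset) s.
  by apply: uniq_perm => [||e]; [exact: fset_uniq|exact: us|rewrite !inE /s mem_cat].
rewrite (perm_big s) //= big_cat big_map /=.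
under [X in _ + X]eq_bigr => f _ do rewrite c_inv.
by rewrite mulr2n mulrDl mul1r.
Qed.

Section CentralLimit.
Variables (R : realType) (Gamma : groupType) (S : {fset Gamma}).
Variable le : rel (edge S).
Hypothesis le_order : total_order le.
Variable p : R.
Hypotheses (p_ge0 : 0 <= p) (p_le1 : p <= 1).
Variable A : nat -> {fset Gamma}.
Variables (k : nat) (C1 C2 : R) (f1 f2 : {fset Gamma} -> (edge S -> bool) -> R).
Hypotheses (stab1 : stabilizing k C1 f1) (stab2 : stabilizing k C2 f2).
Context {d : measure_display} {T : measurableType d}.
Variables (P : probability T R) (omega : edge S -> T -> bool).
Hypothesis omega_iid : iid_bernoulli P p omega.
Variable v : R.
Hypothesis msi_cvg : (fun r => wmean le p (A r)
  (fun w => `|mean_sqr_incr le A p f1 f2 r w - v|)) @ \oo --> (0 : R).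

Notation beta r := (difference A f1 f2 r \o config omega).

Lemma expectation_difference r :
  'E_P[beta r]%E = (wmean le p (A r) (difference A f1 f2 r))%:E.
Proof. exact: (expectation_cylinder omega_iid (@depends_difference _ _ _ le A _ _ _ _ _ stab1 stab2 r)). Qed.

Lemma variance_difference_cvg :
  (fun r => ((#|` A r|%:R)^-1%:E * 'V_P[beta r])%E) @ \oo --> v%:E.
Proof.
rewrite (_ : (fun r => _) = (fun r => (#|` A r|%:R^-1 *
    wmean le p (A r) (fun w => centered le p f1 f2 (A r) w ^+ 2))%:E)).
  apply: cvg_EFin; first exact: nearW.
  exact: (variance_cvg le_order p_ge0 p_le1 stab1 stab2 msi_cvg).
apply/funext => r.
by rewrite (variance_cylinder omega_iid (@depends_difference _ _ _ le A _ _ _ _ _ stab1 stab2 r)) EFinM.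
Qed.

Hypothesis A_large : forall M : R, \forall r \near \oo, M <= #|` A r|%:R.
Hypothesis C_nonneg : 0 <= C1 + C2.

Lemma difference_cvg_in_distribution :
  cvg_in_distribution P (fun r t => (Num.sqrt #|` A r|%:R)^-1 *
    (beta r t - fine ('E_P[beta r])%E)) (gaussian 0 v).
Proof.
move=> g cg gb; have bg : bcont g by [].
have -> : (\int[gaussian 0 v]_x (g x)%:E)%E = ((\int[gaussian 0 v]_x g x)%R)%:E.
  rewrite fineK //; apply: integrable_fin_num => //.
  exact: (@integrable_bcont R _ _ (gaussian 0 v) id g).
rewrite (_ : (fun r => _) = (fun r => (law le p f1 f2 A r g)%:E)).
  apply: cvg_EFin; first exact: nearW.
  exact: (law_cvg le_order p_ge0 p_le1 stab1 stab2 C_nonneg A_large msi_cvg bg).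
apply/funext => r; rewrite expectation_difference /=.
rewrite -(expectation_cylinder omega_iid (s := window_edges le (A r))) //.
move=> w w' ww'; rewrite /rescaled /centered.
by have := @depends_difference _ _ _ le A _ _ _ _ _ stab1 stab2 r _ _ ww'; rewrite /difference => ->.
Qed.

End CentralLimit.

Theorem theorem3p4
  (R : realType)
  (Gamma : groupType) (S : {fset Gamma}) (H : set Gamma) (m : nat)
  (Gamma_infinite : infinite_set [set: Gamma])
  (S_generating : symmetric_generating S)
  (Gamma_amenable : amenable R S)
  (H_subgroup : subgroup H)
  (H_index : has_index H m)
  (H_left_orderable : left_orderable H)
  (d : measure_display) (T : measurableType d) (P : probability T R)
  (p : R) (p_gt0 : 0 < p) (p_lt1 : p < 1)
  (omega eta : edge S -> T -> bool)
  (omega_iid : iid_bernoulli P p omega)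
  (eta_fresh : fresh_bernoulli P p omega eta)
  (A : nat -> {fset Gamma})
  (A_folner : folner R S A) (A_exhaustive : exhaustive A)
  (Delta : graph Gamma -> set (set Gamma))
  (Delta_local : local_rule S Delta)
  (n : nat) :
  let Betti r (w : edge S -> bool) : R :=
    (betti R (A r) (Delta (open_subgraph w [set` A r])) n)%:R in
  let conf t : edge S -> bool := fun e => omega e t in
  let beta r : T -> R := fun t => Betti r (conf t) in
  let D_ e r : T -> R :=
    fun t => Betti r (conf t) - Betti r (resample (conf t) e (eta e t)) in
  {ae P, forall t, exists r, 0 < beta r t} ->
  exists (Et : {fset edge S}) (le : rel (edge S))
         (Dinf condD : edge S -> {RV P >-> R}) (sigma2 : R),
    [/\ fundamental_edges H Et, total_order le & invariant_order H le] /\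
    [/\ forall e, cvg_in_probability P (D_ e) (Dinf e),
        forall e, is_cond_expectation P
          (sigma_gen omega [set e' | le e' e]) (Dinf e) (condD e) &
        sigma2%:E = (((2 * m%:R)^-1)%:E *
          \sum_(e <- Et) 'E_P[(fun t => condD e t ^+ 2)%R])%E] /\
    (fun r => ((#|` A r|%:R)^-1%:E * 'V_P[beta r])%E) @ \oo --> sigma2%:E /\
    cvg_in_distribution P
      (fun r t => (Num.sqrt #|` A r|%:R)^-1 *
                  (beta r t - fine ('E_P[beta r])%E))
      (gaussian 0 sigma2).
Proof.
move=> Betti conf beta D_ _.
have [Dc Dm _ [k Dk]] := Delta_local.
have p0 := ltW p_gt0; have p1 := ltW p_lt1.
have sZ j := stabilizing_dimZ R S_generating Dc Dm Dk j.
have st1 := stabilizingD (sZ n) (sZ n.+1).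
have st2 := stabilizing_dimC R S_generating Dc Dm Dk n.+1.
move: st1 st2; set f1 := fun (W : {fset Gamma}) w => _; set f2 := dimC R Delta n.+1.
set C1 := _ + _; set C2 := _%:R => st1 st2.
have C0 : 0 <= C1 + C2 by rewrite !addr_ge0.
have BE r : Betti r = difference A f1 f2 r.
  by apply/funext => w; exact: (betti_openX R Dc n (A r) w).
have [reps [rep [pos [le [[ur rep_mem pos_mem rep_pos rep_eact] [reps_fix le_ord le_inv]]]]]] :=
  orbit_structure S H_subgroup H_index H_left_orderable.
have [h1 Hh1 h1n] := infinite_group_nontrivial Gamma_infinite H_subgroup H_index.
pose c := limit_sqr_mean le p A f1 f2 P omega.
have cc e : (fun r => incr_sqr_mean le p f1 f2 e (A r)) @ \oo --> c e.
  exact: (incr_sqr_mean_limit le_ord p0 p1 A_exhaustive st1 st2 omega_iid).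
have c_inv f : c (eact h1 f) = c f.
  apply: (@cvg_unique _ (@norm_hausdorff _ R) _ _ _ _ (cc (eact h1 f))).
  exact: (incr_sqr_mean_eact H_subgroup le_inv A_exhaustive p0 p1 st1 st2 Hh1 (cc f)).
have [Et Etf Ets] := @doubled_fundamental_edges R _ _ _ reps rep pos h1 c H_subgroup ur
  rep_mem pos_mem rep_pos (fun h e Hh => (rep_eact h e Hh).2) (fun f fr => (reps_fix f fr).2)
  Hh1 h1n c_inv.
pose v := asymptotic_variance m reps c.
have msi := mean_sqr_incr_cvg S_generating Gamma_infinite H_subgroup H_index ur rep_mem
  pos_mem rep_pos rep_eact reps_fix le_inv A_folner A_exhaustive p0 p1 st1 st2
  (fun f _ => cc f) C0.
have mD e := (bmeas_limit_effect le A_exhaustive st1 st2 omega_iid eta_fresh e).1.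
have mc e := (bmeas_limit_incr le_ord p0 p1 A_exhaustive st1 st2 omega_iid e).1.
exists Et, le, (fun e => mfun_Sub (mem_set (mD e))), (fun e => mfun_Sub (mem_set (mc e))), v.
split; first by split.
have betaE : beta = fun r => difference A f1 f2 r \o config omega.
  by apply/funext => r; rewrite /beta BE.
split; [split|split].
- move=> e; have -> : D_ e = resampling_effect A f1 f2 omega eta e.
    by apply/funext => r; apply/funext => t; rewrite resampling_effectE /D_ BE.
  exact: (effect_cvg_in_probability le A_exhaustive st1 st2 omega_iid eta_fresh).
- move=> e.
  exact: (limit_incr_cond_expectation le_ord p0 p1 A_exhaustive st1 st2 omega_iid eta_fresh).
- rewrite (eq_bigr (fun e => (c e)%:E)); last first.
    move=> e _; exact: (expectation_limit_incr_sqr le_ord p0 p1 A_exhaustive st1 st2 omega_iid).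
  rewrite sumEFin -EFinM Ets /v /asymptotic_variance invfM mulrACA.
  by rewrite mulVf ?mul1r // pnatr_eq0.
- rewrite betaE; exact: (variance_difference_cvg le_ord p0 p1 st1 st2 omega_iid msi).
- rewrite betaE; apply: (difference_cvg_in_distribution le_ord p0 p1 st1 st2 omega_iid msi) => //.
  exact: exhaustive_card.
Qed.
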